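(* There exist universal numerical constants $c_N,c_m,c_\Delta,c_t>0$ such that the following holds. Let $n\ge8$, $p\in\{1,2\}$, let $x^*$ be an arbitrary minimizer of $f(x)=\mathbb{E}_\xi[F(x,\xi)]$ on $\mathbb{R}^n$ and let $\Theta_p$ satisfy $V[x_0](x^* )\le\Theta_p$. Let $\varepsilon>0$ and define, for $p=1$, $$A=\sqrt{\tfrac{n\ln n\,L_2\Theta_1}{\varepsilon}},\quad M=\max\Big\{1,\tfrac{\sigma^2}{\varepsilon^{3/2}}\sqrt{\tfrac{\Theta_1\ln n}{nL_2}}\Big\},\quad D=\min\Big\{\tfrac{\varepsilon^{3/2}}{\sqrt{L_2\Theta_1n\ln n}},\tfrac{\varepsilon^2}{nL_2\Theta_1}\Big\},\quad T=\min\Big\{\tfrac{\varepsilon^{3/4}}{\sqrt[4]{L_2^3\Theta_1n\ln n}},\tfrac{\varepsilon}{L_2\sqrt{n\Theta_1}}\Big\},$$ and, for $p=2$, $$A=\sqrt{\tfrac{n^2L_2\Theta_2}{\varepsilon}},\quad M=\max\Big\{1,\tfrac{\sigma^2}{\varepsilon^{3/2}}\sqrt{\tfrac{\Theta_2}{L_2}}\Big\},\quad D=\min\Big\{\tfrac{\varepsilon^{3/2}}{n\sqrt{L_2\Theta_2}},\tfrac{\varepsilon^2}{nL_2\Theta_2}\Big\},\quad T=\min\Big\{\tfrac{\varepsilon^{3/4}}{\sqrt[4]{n^2L_2^3\Theta_2}},\tfrac{\varepsilon}{L_2\sqrt{n\Theta_2}}\Big\}.$$ Assume that the noise level satisfies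 $0<\Delta\le L_2\Theta_pn^3\rho_n^2/2$ and $\Delta=c_\Delta D$, and that ARDFDS (defined in the context) is run from $x_0$ with smoothing parameter $t=c_tT$ and positive integers $N,m$ such that $c_NA\le N\le 2c_NA$ and $c_mM\le m\le 2c_mM$. Then its output satisfies $\mathbb{E}[f(y_N)]-f(x^* )\le\varepsilon$. Moreover, the overall number of oracle calls is $Nm$, which is at most a universal constant times $$\max\Big\{\sqrt{\tfrac{n\ln n\,L_2\Theta_1}{\varepsilon}},\tfrac{\sigma^2\Theta_1\ln n}{\varepsilon^2}\Big\}\ \text{ for } p=1,\qquad \max\Big\{\sqrt{\tfrac{n^2L_2\Theta_2}{\varepsilon}},\tfrac{\sigma^2\Theta_2n}{\varepsilon^2}\Big\}\ \text{ for } p=2.$$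
   Context: Problem. $\xi$ is a random vector with distribution $P$ on $\mathcal{X}$; $f(x)=\mathbb{E}_\xi[F(x,\xi)]$ is a closed convex function on $\mathbb{R}^n$ having a minimizer ($F(\cdot,\xi)$ itself need not be convex). Almost surely in $\xi$, $F(\cdot,\xi)$ has a gradient $g(x,\xi)$ with $\|g(x,\xi)-g(y,\xi)\|_2\le L(\xi)\|x-y\|_2$ for all $x,y$. The constant $L_2>0$ satisfies $\sqrt{\mathbb{E}_\xi L(\xi)^2}\le L_2$; consequently $\mathbb{E}_\xi g(x,\xi)=\nabla f(x)$ and $\nabla f$ is $L_2$-Lipschitz in $\|\cdot\|_2$. For all $x$, $\mathbb{E}_\xi\|g(x,\xi)-\nabla f(x)\|_2^2\le\sigma^2$. Oracle. Given a pair of points $(x,y)$, an oracle call returns $(\widetilde f(x,\xi),\widetilde f(y,\xi))$ for one sample $\xi\sim P$ (the same for both points), where $\widetilde f(x,\xi)=F(x,\xi)+\eta(x,\xi)$ and $|\eta(x,\xi)|\le\Delta$ for all $x\in\mathbb{R}^n$, a.s. in $\xi$. All functions are measurable, so that expectations make sense. Proximal setup. $q$ is given by $\frac1p+\frac1q=1$ ($q=\infty$ for $p=1$, $q=2$ for $p=2$). The prox-function is $d(x)=\frac12\|x\|_2^2$ for $p=2$, and $d(x)=\frac12\,\exp(1)\,n^{(\kappa-1)(2-\kappa)/\kappa}\ln n\,\|x\|_\kappa^2$ with $\kappa=1+\frac1{\ln n}$ for $p=1$; it is $1$-strongly convex w.r.t. $\|\cdot\|_p$. $V[z](x)=d(x)-d(z)-\langle\nabla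 d(z),x-z\rangle$ is the Bregman divergence. $\rho_n=\min\{q-1,\,16\ln n-8\}\,n^{2/q-1}$, i.e. $\rho_n=(16\ln n-8)/n$ for $p=1$ and $\rho_n=1$ for $p=2$ (when $n\ge 8$). Gradient approximation. For $e$ in the unit Euclidean sphere and samples $\xi_1,\dots,\xi_m$, $\widetilde\nabla^m f^t(x)=\frac1m\sum_{i=1}^m\frac{\widetilde f(x+te,\xi_i)-\widetilde f(x,\xi_i)}{t}\,e$. ARDFDS. Input $x_0\in\mathbb{R}^n$, $N,m\ge1$, $t>0$. Set $y_0=z_0=x_0$ and $\alpha_k=\frac{k+1}{96n^2\rho_nL_2}$. For $k=0,\dots,N-1$: draw $e_{k+1}$ uniformly from the unit Euclidean sphere of $\mathbb{R}^n$ and $m$ independent copies $\xi_1^{k+1},\dots,\xi_m^{k+1}$ of $\xi$, all independent of each other and of previous iterations; set $\tau_k=\frac{2}{k+2}$ and $x_{k+1}=\tau_kz_k+(1-\tau_k)y_k$; compute $\widetilde\nabla^m f^t(x_{k+1})$ with $e=e_{k+1}$ and $\xi_i=\xi_i^{k+1}$; set $y_{k+1}=x_{k+1}-\frac1{2L_2}\widetilde\nabla^m f^t(x_{k+1})$ and $z_{k+1}=\arg\min_{z\in\mathbb{R}^n}\{\alpha_{k+1}n\langle\widetilde\nabla^m f^t(x_{k+1}),z-z_k\rangle+V[z_k](z)\}$. Output $y_N$. $\mathbb{E}$ is the expectation over all randomness of the algorithm. ''Universal'' constants do not depend on any problem data or on $\varepsilon$, $n$, $p$. *)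

(* Defs.v *)
From HB Require Import structures.
From mathcomp Require Export all_boot all_order all_algebra.
From mathcomp Require Export all_classical all_reals all_analysis.
Export Order.TTheory GRing.Theory Num.Theory.
Export numFieldNormedType.Exports.

Set Implicit Arguments.
Unset Strict Implicit.
Unset Printing Implicit Defensive.

Local Open Scope classical_set_scope.
Local Open Scope ring_scope.

(* R^n is 'rV[R]_n.  The library norm `|x| on it is the sup norm: it serves only
   for the topology and for differentiability, which are the Euclidean ones. *)
Section euclidean.
Context {R : realType} {n : nat}.
Implicit Types (x y z : 'rV[R]_n) (h : 'rV[R]_n -> R).

Definition dotv x y : R := \sum_i x 0 i * y 0 i.

Definition norm2 x : R := Num.sqrt (\sum_i x 0 i ^+ 2).

Definition normp (r : R) x : R := (\sum_i `|x 0 i| `^ r) `^ r^-1.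

Definition is_gradient h x (v : 'rV[R]_n) : Prop := is_diff x h (dotv v).

(* Total version: the row of partial derivatives. *)
Definition grad h x : 'rV[R]_n := \row_i 'D_(delta_mx 0 i) h x.

Definition closed_function h : Prop :=
  closed [set xt : 'rV[R]_n * R | h xt.1 <= xt.2].

Definition minimizer h x : Prop := forall y, h x <= h y.

(* Unspecified when h has no minimizer. *)
Definition argmin h : 'rV[R]_n := get [set x | minimizer h x].

End euclidean.

(* R^n with its Borel sigma-algebra. *)
Definition rVborel (R : realType) (n : nat) :=
  g_sigma_algebraType (@open 'rV[R]_n).

Section proximal_setup.
Context {R : realType}.
Variables (p n : nat).

Definition kappa : R := 1 + 1 / ln n%:R.

(* Only p = 1 and p = 2 are meaningful, here and below. *)
Definition prox (x : 'rV[R]_n) : R :=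
  if p == 1%N then
    2^-1 * expR 1 * n%:R `^ ((kappa - 1) * (2 - kappa) / kappa) * ln n%:R
      * normp kappa x ^+ 2
  else 2^-1 * norm2 x ^+ 2.

(* bregman z x is V[z](x) *)
Definition bregman (z x : 'rV[R]_n) : R :=
  prox x - prox z - dotv (grad prox z) (x - z).

Definition qexp : \bar R := hoelder_conjugate p%:R%:E.

(* For q = +oo the minimum is its second argument, and 2 / q = 0. *)
Definition rho : R :=
  if qexp is r%:E
  then Num.min (r - 1) (16 * ln n%:R - 8) * n%:R `^ (2 / r - 1)
  else (16 * ln n%:R - 8) * n%:R `^ (- 1).

End proximal_setup.

Section probability_notions.
Context {R : realType}.

Definition mutually_independent {d} {Omega : measurableType d}
    (Pr : probability Omega R) {I : finType} (G : I -> set (set Omega)) : Prop :=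
  forall (J : {set I}) (A : I -> set Omega),
    (forall i, i \in J -> G i (A i)) ->
    Pr (\bigcap_(i in [set` J]) A i) = (\prod_(i in J) Pr (A i))%E.

(* The events determined by Y; this is the sigma-algebra generated by Y. *)
Definition events_of {d d'} {Omega : measurableType d} {T : measurableType d'}
    (Y : Omega -> T) : set (set Omega) :=
  preimage_set_system setT Y measurable.

(* The uniform distribution on the sphere is the rotation-invariant Borel
   probability measure carried by it. *)
Definition uniform_on_sphere {n : nat} (mu : set (rVborel R n) -> \bar R) : Prop :=
  mu [set e : 'rV[R]_n | norm2 e = 1] = 1%E /\
  forall (Q : 'M[R]_n) (B : set (rVborel R n)),
    Q *m Q^T = 1%:M -> measurable B ->
    mu ((fun e : 'rV[R]_n => e *m Q) @^-1` B) = mu B.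

End probability_notions.

(* The expectation of F x being the real number (f x) makes F x integrable. *)
Record stochastic_problem {R : realType} {n : nat} {dX} {X : measurableType dX}
    (P : probability X R) (F : 'rV[R]_n -> X -> R) (g : 'rV[R]_n -> X -> 'rV[R]_n)
    (L : X -> R) (f : 'rV[R]_n -> R) (L2 sigma : R) : Prop := {
  measurable_obj :
    measurable_fun setT (fun z : rVborel R n * X => F z.1 z.2) ;
  measurable_gradient :
    measurable_fun setT (fun z : rVborel R n * X => g z.1 z.2 : rVborel R n) ;
  measurable_lip : measurable_fun setT L ;
  expected_obj : forall x, ('E_P[F x] = (f x)%:E)%E ;
  convex_obj : convex_function setT f ;
  closed_obj : closed_function f ;
  gradientP : {ae P, forall xi, forall x, is_gradient (F ^~ xi) x (g x xi)} ;
  gradient_lip : {ae P, forall xi, forall x y,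
    norm2 (g x xi - g y xi) <= L xi * norm2 (x - y)} ;
  L2_gt0 : 0 < L2 ;
  lip_moment : (sqrte 'E_P[fun xi => (L xi ^+ 2)%R] <= L2%:E)%E ;
  gradient_variance : forall x,
    ('E_P[fun xi => (norm2 (g x xi - grad f x) ^+ 2)%R] <= (sigma ^+ 2)%:E)%E
}.

Record bounded_noise {R : realType} {n : nat} {dX} {X : measurableType dX}
    (P : probability X R) (eta : 'rV[R]_n -> X -> R) (Delta : R) : Prop := {
  measurable_noise :
    measurable_fun setT (fun z : rVborel R n * X => eta z.1 z.2) ;
  noise_le : {ae P, forall xi, forall x, `|eta x xi| <= Delta}
}.

(* Iteration k, from 0 to N - 1, uses the direction e k and the samples xi k i,
   with i from 0 to m - 1. *)
Record algorithm_randomness {R : realType} {n : nat} {dX} {X : measurableType dX}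
    (P : probability X R) {d} {Omega : measurableType d} (Pr : probability Omega R)
    (N m : nat) (e : nat -> Omega -> 'rV[R]_n) (xi : nat -> nat -> Omega -> X)
    : Prop := {
  measurable_direction : forall k, (k < N)%N ->
    measurable_fun setT (e k : Omega -> rVborel R n) ;
  measurable_sample : forall k i, (k < N)%N -> (i < m)%N ->
    measurable_fun setT (xi k i) ;
  direction_law : forall k, (k < N)%N ->
    uniform_on_sphere (pushforward Pr (e k : Omega -> rVborel R n)) ;
  sample_law : forall k i (B : set X), (k < N)%N -> (i < m)%N -> measurable B ->
    pushforward Pr (xi k i) B = P B ;
  independent_draws :
    mutually_independent Pr (fun s : 'I_N + 'I_N * 'I_m =>
      match s with
      | inl k => events_of (e k : Omega -> rVborel R n)
      | inr (k, i) => events_of (xi k i)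
      end)
}.

Definition alpha {R : realType} (p n : nat) (L2 : R) (k : nat) : R :=
  k.+1%:R / (96 * n%:R ^+ 2 * rho p n * L2).

Section ardfds.
Context {R : realType} {n : nat} {X : Type}.
Variables (F eta : 'rV[R]_n -> X -> R).

Definition noisy_value (x : 'rV[R]_n) (s : X) : R := F x s + eta x s.

Definition oracle (xy : 'rV[R]_n * 'rV[R]_n) (s : X) : R * R :=
  (noisy_value xy.1 s, noisy_value xy.2 s).

(* The answers of the oracle at (x + t e, x), one call per sample. *)
Definition oracle_answers (t : R) (x e : 'rV[R]_n) (samples : seq X) : seq (R * R) :=
  [seq oracle (x + t *: e, x) s | s <- samples].

Definition grad_approx (t : R) (e : 'rV[R]_n) (answers : seq (R * R)) : 'rV[R]_n :=
  (size answers)%:R^-1 *: \sum_(a <- answers) ((a.1 - a.2) / t) *: e.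

Record state := State {
  st_y : 'rV[R]_n ;
  st_z : 'rV[R]_n ;
  st_calls : nat  (* number of oracle calls made so far *)
}.

Variables (p m : nat) (L2 t : R) (x0 : 'rV[R]_n).

Definition ardfds_step (k : nat) (e : 'rV[R]_n) (samples : seq X) (s : state) : state :=
  let: State y z calls := s in
  let tau := 2 / k.+2%:R in
  let x := tau *: z + (1 - tau) *: y in
  let answers := oracle_answers t x e samples in
  let gr := grad_approx t e answers in
  State (x - (2 * L2)^-1 *: gr)
        (argmin (fun z' => alpha p n L2 k.+1 * n%:R * dotv gr (z' - z) + bregman p z z'))
        (calls + size answers)%N.

(* The state after N iterations, for given draws e and xi. *)
Fixpoint ardfds (e : nat -> 'rV[R]_n) (xi : nat -> nat -> X) (N : nat) : state :=
  if N is k.+1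
  then ardfds_step k (e k) (mkseq (xi k) m) (ardfds e xi k)
  else State x0 x0 0.

End ardfds.

Section parameters.
Context {R : realType}.
Variables (p n : nat) (L2 sigma Theta eps : R).
Let nr : R := n%:R.

Definition iter_scale : R :=
  if p == 1%N then Num.sqrt (nr * ln nr * L2 * Theta / eps)
  else Num.sqrt (nr ^+ 2 * L2 * Theta / eps).

Definition batch_scale : R :=
  if p == 1%N then
    Num.max 1 (sigma ^+ 2 / eps `^ (3 / 2) * Num.sqrt (Theta * ln nr / (nr * L2)))
  else
    Num.max 1 (sigma ^+ 2 / eps `^ (3 / 2) * Num.sqrt (Theta / L2)).

Definition noise_scale : R :=
  if p == 1%N then
    Num.min (eps `^ (3 / 2) / Num.sqrt (L2 * Theta * nr * ln nr))
            (eps ^+ 2 / (nr * L2 * Theta))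
  else
    Num.min (eps `^ (3 / 2) / (nr * Num.sqrt (L2 * Theta)))
            (eps ^+ 2 / (nr * L2 * Theta)).

Definition smoothing_scale : R :=
  if p == 1%N then
    Num.min (eps `^ (3 / 4) / (L2 ^+ 3 * Theta * nr * ln nr) `^ (1 / 4))
            (eps / (L2 * Num.sqrt (nr * Theta)))
  else
    Num.min (eps `^ (3 / 4) / (nr ^+ 2 * L2 ^+ 3 * Theta) `^ (1 / 4))
            (eps / (L2 * Num.sqrt (nr * Theta))).

Definition call_scale : R :=
  if p == 1%N then
    Num.max (Num.sqrt (nr * ln nr * L2 * Theta / eps))
            (sigma ^+ 2 * Theta * ln nr / eps ^+ 2)
  else
    Num.max (Num.sqrt (nr ^+ 2 * L2 * Theta / eps))
            (sigma ^+ 2 * Theta * nr / eps ^+ 2).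

End parameters.

(* Main.v *)
Require Import Defs.
From HB Require Import structures.
From mathcomp Require Import measurable_realfun.
From mathcomp Require Import ring lra zify.
Set Implicit Arguments.
Unset Strict Implicit.
Unset Printing Implicit Defensive.

Local Open Scope classical_set_scope.
Local Open Scope ring_scope.

(* Writing z_k = mirror s_k, the mirror step becomes the additive update
   s_{k+1} = s_k - alpha n g~ of a dual variable, and V[z_k](xstar) becomes the
   Fenchel gap d(xstar) + d^*(s_k) - <s_k, xstar>, which is controlled by the smoothness of d^*.
   For a fixed state (y, s) the direction and the batch are integrated out with Tonelli's
   theorem, so that no conditional expectation is needed.  The potential
     Phi_k = k (k + 2) / (2 Q) (f(y_k) - f(xstar)) + Fenchel gap,   Q = 96 n^2 rho_n L_2,
   then satisfies E Phi_{k+1} <= (1 + alpha / mu) E Phi_k + (noise terms): the only error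
   linear in the dual norm, alpha n zeta <e, z - xstar>, is split by Young's inequality with
   weight mu of order Theta / eps.  With the prescribed parameters the expected potential
   stays below Theta (1 + k / N), hence E f(y_N) - f(xstar) <= 4 Q Theta / (N (N + 2)). *)

(** The [argmin] of the algorithm is a choice operator, so nothing about it is measurable a priori;
    the dual variable replaces it by the closed form [mirror], which settles measurability and the
    mirror step at once. Nor is [f] assumed differentiable: [grad f] is only the row of partial
    derivatives, and it is identified with the mean of [g] by integrating a two-sided descent
    inequality of the samples. The two values of [p] share one argument; the split is confined to
    the smoothness of d^*, to the moments of [dual_weight] and to the scales. These moments come
    from rotation invariance alone, through a recursion for the even moments of a coordinate. The
    factor 96 = 12 * 8 in Q makes the second-order mirror term equal to C / (8 L2) with C = (k +
    2)^2 / (2 Q); the terms in |grad f|^2 then cancel exactly, 1/8 + 1/4 + 1/8 = 1/2. The weight mu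
    is of order Theta / eps because alpha / mu is then of order 1 / N, so that N steps inflate the
    potential by a constant factor only, while alpha n mu times the squared error stays of order
    Theta / N by the choice of t and Delta. *)

Section euclidean_theory.
Context {R : realType} {n : nat}.
Implicit Types (x y z : 'rV[R]_n) (a b : R).

Lemma dotvC x y : dotv x y = dotv y x.
Proof. by apply: eq_bigr => i _; rewrite mulrC. Qed.

Lemma dotvDl x y z : dotv (x + y) z = dotv x z + dotv y z.
Proof. by rewrite -big_split; apply: eq_bigr => i _; rewrite mxE mulrDl. Qed.

Lemma dotvZl a x y : dotv (a *: x) y = a * dotv x y.
Proof. by rewrite mulr_sumr; apply: eq_bigr => i _; rewrite mxE mulrA. Qed.

Lemma dotvNl x y : dotv (- x) y = - dotv x y.
Proof. by rewrite -scaleN1r dotvZl mulN1r. Qed.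

Lemma dotvBl x y z : dotv (x - y) z = dotv x z - dotv y z.
Proof. by rewrite dotvDl dotvNl. Qed.

Lemma dotvDr x y z : dotv z (x + y) = dotv z x + dotv z y.
Proof. by rewrite !(dotvC z) dotvDl. Qed.

Lemma dotvZr a x y : dotv x (a *: y) = a * dotv x y.
Proof. by rewrite !(dotvC x) dotvZl. Qed.

Lemma dotvNr x y : dotv x (- y) = - dotv x y.
Proof. by rewrite !(dotvC x) dotvNl. Qed.

Lemma dotvBr x y z : dotv z (x - y) = dotv z x - dotv z y.
Proof. by rewrite !(dotvC z) dotvBl. Qed.

Lemma dotv0 x : dotv x 0 = 0.
Proof. by rewrite -(scale0r 0) dotvZr mul0r. Qed.

Lemma dot0v x : dotv 0 x = 0.
Proof. by rewrite dotvC dotv0. Qed.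

Lemma dotv_sumr I (r : seq I) (P : pred I) (F : I -> 'rV[R]_n) x :
  dotv x (\sum_(i <- r | P i) F i) = \sum_(i <- r | P i) dotv x (F i).
Proof.
elim/big_rec2: _ => [|i a y _ <-]; first exact: dotv0.
by rewrite dotvDr.
Qed.

Lemma dotv_suml I (r : seq I) (P : pred I) (F : I -> 'rV[R]_n) x :
  dotv (\sum_(i <- r | P i) F i) x = \sum_(i <- r | P i) dotv (F i) x.
Proof. by rewrite dotvC dotv_sumr; apply: eq_bigr => i _; rewrite dotvC. Qed.

Lemma dotv_delta x i : dotv x (delta_mx 0 i) = x 0 i.
Proof.
rewrite /dotv (bigD1 i) //= mxE !eqxx mulr1 big1 ?addr0 // => j ji.
by rewrite mxE eqxx (negbTE ji) mulr0.
Qed.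

Lemma sqr_norm2 x : norm2 x ^+ 2 = dotv x x.
Proof.
rewrite sqr_sqrtr; last by apply: sumr_ge0 => i _; exact: sqr_ge0.
by apply: eq_bigr => i _; rewrite expr2.
Qed.

Lemma dotvv_ge0 x : 0 <= dotv x x.
Proof. by rewrite -sqr_norm2 sqr_ge0. Qed.

Lemma norm2_ge0 x : 0 <= norm2 x.
Proof. exact: sqrtr_ge0. Qed.

Lemma dotvv_eq0 x : dotv x x = 0 -> x = 0.
Proof.
move=> /eqP; rewrite psumr_eq0; last by move=> i _; rewrite -expr2 sqr_ge0.
move=> /allP x0; apply/rowP => i; rewrite mxE; apply/eqP.
by have := x0 i; rewrite mem_index_enum => /(_ isT) /=; rewrite -expr2 sqrf_eq0.
Qed.

Lemma norm2Z a x : norm2 (a *: x) = `|a| * norm2 x.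
Proof.
apply/eqP; rewrite -(@eqrXn2 _ 2) ?mulr_ge0 ?norm2_ge0 //.
by rewrite exprMn !sqr_norm2 real_normK ?num_real // dotvZl dotvZr mulrA expr2.
Qed.

Lemma dotv_cauchy_schwarz x y : dotv x y ^+ 2 <= dotv x x * dotv y y.
Proof.
have [y0|y0] := eqVneq (dotv y y) 0.
  by rewrite (dotvv_eq0 y0) !dotv0 expr0n mulr0.
have yp : 0 < dotv y y by rewrite lt_neqAle eq_sym y0 dotvv_ge0.
have := dotvv_ge0 (x - (dotv x y / dotv y y) *: y).
rewrite dotvBl !dotvBr !dotvZl !dotvZr (dotvC y x) divfK //.
rewrite -(pmulr_rge0 _ yp).
move: y0; move: (dotv x y) (dotv y y) (dotv x x) => A B C B0.
have -> : B * (C - A / B * A - (A / B * A - A / B * A)) = C * B - A ^+ 2.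
  by field.
by rewrite subr_ge0.
Qed.

End euclidean_theory.

(** [phi] minus its quadratic majorant has nonpositive derivative on the unit interval. Only the
    growth of [dphi] from its value at 0 is assumed, so the same lemma serves the smoothness of d^*
    and the descent inequality of a sample, where no second derivative exists. *)
Lemma quadratic_upper_bound (R : realType) (phi dphi : R -> R) (M : R) :
  (forall s : R, is_derive s 1 phi (dphi s)) ->
  (forall s : R, 0 <= s <= 1 -> dphi s <= dphi 0 + M * s) ->
  phi 1 <= phi 0 + dphi 0 + M / 2.
Proof.
move=> dp hM.
pose psi s := phi s - s * dphi 0 - s ^+ 2 * (M / 2).
have dpsi (s : R) : is_derive s 1 psi (dphi s - dphi 0 - M * s).
  by apply: is_derive_eq; rewrite /GRing.scale /=; field.
have : psi 1 <= psi 0.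
  apply: (@ler0_derive1_le_cc _ psi 0 1) => //.
  - move=> s; rewrite in_itv /= => /andP[s0 s1].
    rewrite derive1E; have -> := @derive_val _ _ _ _ _ _ _ (dpsi s).
    by have := hM s; rewrite (ltW s0) (ltW s1) => /(_ isT); lra.
  - apply: continuous_subspaceT => s.
    by apply: differentiable_continuous; apply/derivable1_diffP; case: (dpsi s).
  - by rewrite in_itv /= lexx ler01.
  - by rewrite in_itv /= lexx ler01.
rewrite /psi; lra.
Qed.

(** * Power norms and their conjugates *)

Section power_calculus.
Context {R : realType}.
Implicit Types (x y k r : R).

Lemma sqr_powR x k : (x `^ k) ^+ 2 = x `^ (k * 2).
Proof. by rewrite powRrM powR_mulrn // powR_ge0. Qed.

Lemma divr_powR x y k : 0 <= x -> 0 < y -> (x / y) `^ k = x `^ k / y `^ k.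
Proof.
move=> x0 y0; rewrite powRM ?invr_ge0 ?(ltW y0) //; congr (_ * _).
by rewrite -[in LHS]powR_inv1 ?(ltW y0) // -powRrM mulN1r powRN.
Qed.

Lemma near0_powR_lt k (e : R) : 0 < k -> 0 < e ->
  \forall y \near (0 : R), `|y| `^ k < e.
Proof.
move=> k0 e0; have ek0 : 0 < e `^ k^-1 by rewrite powR_gt0.
near=> y.
rewrite -[ltRHS](powRr1 (ltW e0)) -(@mulVf _ k) ?gt_eqF // powRrM.
apply: gt0_ltr_powR => //; rewrite ?nnegrE ?normr_ge0 ?powR_ge0 //.
Unshelve. all: by end_near. 
Qed.

(** Away from 0 the sign is locally constant. At 0 Caratheodory's criterion applies, with a slope
    function of size at most |y|^(r - 1), which tends to 0 because [r] exceeds 1. *)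
Lemma is_derive_abs_powR x r : 1 < r ->
  is_derive x 1 (fun y : R => `|y| `^ r) (r * (Num.sg x * `|x| `^ (r - 1))).
Proof.
move=> r1; have r10 : 0 < r - 1 by rewrite subr_gt0.
have r0 : 0 < r by rewrite (lt_trans ltr01).
have [x0|x0|->] := ltrgtP x 0.
- rewrite ltr0_sg // ltr0_norm //.
  have : is_derive x 1 ((fun z : R => z `^ r) \o -%R) (r * (- x) `^ (r - 1) * -1).
    apply: is_derive1_comp; apply: is_derive1_powR; by rewrite oppr_gt0.
  move=> h; apply: (@near_eq_is_derive _ _ _ ((fun z : R => z `^ r) \o -%R)).
    by near=> y => /=; rewrite ltr0_norm //; near: y; exact: lt_nbhsl.
  by apply: is_derive_eq h _; ring.
- rewrite gtr0_sg // gtr0_norm // mul1r.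
  apply: (@near_eq_is_derive _ _ _ (fun z : R => z `^ r)).
    by near=> y => /=; rewrite gtr0_norm //; near: y; exact: lt_nbhsr.
  exact: is_derive1_powR.
- rewrite sgr0 mul0r mulr0.
  apply/is_derive1_caratheodory; exists (fun y => Num.sg y * `|y| `^ (r - 1)).
  split.
  + move=> z; rewrite normr0 powR0 ?gt_eqF // !subr0.
    by rewrite mulrAC -normrEsg mulr_powRB1.
  + apply/cvgrPdist_lt => e e0; rewrite sgr0 mul0r; near=> y.
    rewrite sub0r normrN normrM [X in _ * X]ger0_norm ?powR_ge0 //.
    apply: (@le_lt_trans _ _ (`|y| `^ (r - 1))).
      by rewrite ler_piMl ?powR_ge0 // normr_sg lern1 leq_b1.
    by near: y; exact: near0_powR_lt.
  + by rewrite sgr0 mul0r.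
Unshelve. all: by end_near. Qed.

Lemma is_derive_sg_powR x k : 1 < k ->
  is_derive x 1 (fun y : R => Num.sg y * `|y| `^ k) (k * `|x| `^ (k - 1)).
Proof.
move=> k1; have k10 : 0 < k - 1 by rewrite subr_gt0.
have k0 : 0 < k by rewrite (lt_trans ltr01).
have [x0|x0|->] := ltrgtP x 0.
- apply: (@near_eq_is_derive _ _ _ (fun y : R => - `|y| `^ k)).
    by near=> y => /=; rewrite [Num.sg y]ltr0_sg ?mulN1r //; near: y; exact: lt_nbhsl.
  have h := is_derive_abs_powR x k1.
  by apply: is_derive_eq; rewrite ltr0_sg //; ring.
- apply: (@near_eq_is_derive _ _ _ (fun y : R => `|y| `^ k)).
    by near=> y => /=; rewrite [Num.sg y]gtr0_sg ?mul1r //; near: y; exact: lt_nbhsr.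
  have h := is_derive_abs_powR x k1.
  by apply: is_derive_eq h _; rewrite gtr0_sg // mul1r.
- rewrite normr0 powR0 ?gt_eqF // mulr0.
  apply/is_derive1_caratheodory; exists (fun y => `|y| `^ (k - 1)); split.
  + move=> z; rewrite sgr0 mul0r !subr0.
    by rewrite -(mulr_powRB1 (normr_ge0 z) k0) mulrA mulr_sg_norm mulrC.
  + apply/cvgrPdist_lt => e e0; rewrite normr0 powR0 ?gt_eqF //; near=> y.
    rewrite sub0r normrN ger0_norm ?powR_ge0 //.
    by near: y; exact: near0_powR_lt.
  + by rewrite normr0 powR0 ?gt_eqF.
Unshelve. all: by end_near. Qed.

End power_calculus.

Lemma derive_lineE (R : realType) (V W : normedModType R) (f : V -> W) (a v : V) :
  (fun h : R => h^-1 *: ((f \o shift a) (h *: v) - f a)) =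
  (fun h : R => h^-1 *: (((fun s : R => f (a + s *: v)) \o shift 0) (h *: 1)
                      - f (a + 0 *: v))).
Proof.
by apply/funext => h /=; rewrite addr0 scale0r addr0 [h *: 1]mulr1 [h *: v + a]addrC.
Qed.

Lemma derivable_line (R : realType) (V W : normedModType R) (f : V -> W) (a v : V) :
  derivable (fun s : R => f (a + s *: v)) 0 1 -> derivable f a v.
Proof. by rewrite /derivable (derive_lineE f a v). Qed.

Lemma derive_line (R : realType) (V W : normedModType R) (f : V -> W) (a v : V) :
  'D_v f a = 'D_1 (fun s : R => f (a + s *: v)) 0.
Proof. by rewrite /derive (derive_lineE f a v). Qed.

Section power_norms.
Context {R : realType} {n : nat}.
Implicit Types (x y z h : 'rV[R]_n) (c r q k : R).

Definition psum r x : R := \sum_i `|x 0 i| `^ r.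

(** [c / 2] times the squared [r]-norm, a family stable under Fenchel conjugation: the conjugate of
    [half_sqr c k] is [half_sqr c^-1 q] for conjugate exponents. *)
Definition half_sqr c r x : R := c / 2 * psum r x `^ (2 / r).

(* The gradient of [half_sqr c r], with the value 0 at the origin. *)
Definition duality_map c r x : 'rV[R]_n :=
  \row_i (c * psum r x `^ (2 / r - 1) * (Num.sg (x 0 i) * `|x 0 i| `^ (r - 1))).

Lemma psum_ge0 r x : 0 <= psum r x.
Proof. by apply: sumr_ge0 => i _; exact: powR_ge0. Qed.

Lemma psum_eq0 r x : psum r x = 0 -> x = 0.
Proof.
move=> /eqP; rewrite psumr_eq0; last by move=> i _; exact: powR_ge0.
move=> /allP x0; apply/rowP => i; rewrite mxE; apply/eqP.
have := x0 i; rewrite mem_index_enum => /(_ isT) /=.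
by rewrite powR_eq0 normr_eq0 => /andP[].
Qed.

Lemma psumZ r (a : R) x : psum r (a *: x) = `|a| `^ r * psum r x.
Proof.
rewrite /psum mulr_sumr; apply: eq_bigr => i _.
by rewrite mxE normrM powRM.
Qed.

Lemma dotv_duality_map c r x : 0 < r ->
  dotv (duality_map c r x) x = c * psum r x `^ (2 / r).
Proof.
move=> r0; rewrite -(mulr_powRB1 (psum_ge0 r x)) ?divr_gt0 //.
rewrite /dotv (mulrC (psum r x)) mulrA {2}/psum mulr_sumr.
apply: eq_bigr => i _; rewrite mxE -mulrA; congr (_ * _).
by rewrite mulrAC -normrEsg mulr_powRB1.
Qed.

Lemma half_sqrZ c r (a : R) x : 0 < r ->
  half_sqr c r (a *: x) = a ^+ 2 * half_sqr c r x.
Proof.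
move=> r0; rewrite /half_sqr psumZ powRM ?powR_ge0 ?psum_ge0 // -powRrM.
have -> : r * (2 / r) = 2%:R by field; rewrite gt_eqF.
by rewrite powR_mulrn // real_normK ?num_real // mulrCA.
Qed.

Section conjugate.
Variables (c k q : R).
Hypotheses (c0 : 0 < c) (k0 : 0 < k) (q0 : 0 < q) (kq : k^-1 + q^-1 = 1).

(** Young's inequality is applied to each pair of coordinates after division by the two norms [a]
    and [b]; the sum of the right-hand sides is then 1 / k + 1 / q = 1. *)
Lemma hoelder_dotv x y : dotv x y <= psum k x `^ k^-1 * psum q y `^ q^-1.
Proof.
have [/psum_eq0 ->|Sx] := eqVneq (psum k x) 0.
  by rewrite dot0v mulr_ge0 ?powR_ge0.
have [/psum_eq0 ->|Sy] := eqVneq (psum q y) 0.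
  by rewrite dotv0 mulr_ge0 ?powR_ge0.
have {Sx} Sx : 0 < psum k x by rewrite lt_neqAle eq_sym Sx psum_ge0.
have {Sy} Sy : 0 < psum q y by rewrite lt_neqAle eq_sym Sy psum_ge0.
set a := _ `^ k^-1; set b := _ `^ q^-1.
have a0 : 0 < a by rewrite powR_gt0.
have b0 : 0 < b by rewrite powR_gt0.
have ak : a `^ k = psum k x by rewrite -powRrM mulVf ?gt_eqF // powRr1 // ltW.
have bq : b `^ q = psum q y by rewrite -powRrM mulVf ?gt_eqF // powRr1 // ltW.
clearbody a b; rewrite mulrC -[leRHS]mulr1 -kq mulrDr.
apply: (@le_trans _ _ (\sum_i b * a * ((`|x 0 i| `^ k / psum k x) / k
                                     + (`|y 0 i| `^ q / psum q y) / q))).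
  apply: ler_sum => i _; apply: (le_trans (ler_norm _)); rewrite normrM.
  have := @conjugate_powR R (`|x 0 i| / a) (`|y 0 i| / b) k q.
  move=> /(_ (divr_ge0 (normr_ge0 _) (ltW a0)) (divr_ge0 (normr_ge0 _) (ltW b0)) k0 q0 kq).
  rewrite !divr_powR // ak bq => h.
  rewrite (_ : `|x 0 i| * `|y 0 i| = b * a * (`|x 0 i| / a * (`|y 0 i| / b))).
    by rewrite ler_pM2l // mulr_gt0.
  by field; rewrite (gt_eqF a0) (gt_eqF b0).
rewrite -mulr_sumr big_split /= -!mulr_suml -/(psum k x) -/(psum q y).
by rewrite !divff ?gt_eqF // !mul1r mulrDr.
Qed.

(** The Fenchel-Young inequality: after Hoelder, the defect is [c / 2] times a perfect square. *)
Lemma half_sqr_young x y : dotv x y <= half_sqr c k x + half_sqr c^-1 q y.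
Proof.
apply: (le_trans (hoelder_dotv x y)); rewrite /half_sqr.
rewrite ![2 / _]mulrC -!sqr_powR.
set a := _ `^ k^-1; set b := _ `^ q^-1.
rewrite -subr_ge0 (_ : _ - _ = c / 2 * (a - b / c) ^+ 2).
  by rewrite mulr_ge0 ?sqr_ge0 // divr_ge0 // ltW.
by field; rewrite gt_eqF.
Qed.

(** The equality case of Fenchel-Young, attained at the gradient of the conjugate. The identity (q -
    1) k = q turns the [k]-power sum of the duality map into a multiple of [psum q y]. *)
Lemma half_sqr_young_eq y :
  half_sqr c k (duality_map c^-1 q y) + half_sqr c^-1 q y =
  dotv (duality_map c^-1 q y) y.
Proof.
have qk : (q - 1) * k = q.
  have : (k^-1 + q^-1) * (k * q) = k * q by rewrite kq mul1r.
  rewrite (_ : (k^-1 + q^-1) * (k * q) = q + k).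
    by move=> h; rewrite mulrBl mul1r [q * k]mulrC -h addrK.
  by field; rewrite !gt_eqF.
rewrite dotv_duality_map //.
rewrite /half_sqr; suff -> : psum k (duality_map c^-1 q y) `^ (2 / k)
          = c ^- 2 * psum q y `^ (2 / q).
  by field; rewrite gt_eqF.
have -> : psum k (duality_map c^-1 q y) =
   (c^-1 * psum q y `^ (2 / q - 1)) `^ k * psum q y.
  rewrite /psum mulr_sumr; apply: eq_bigr => i _; rewrite mxE.
  rewrite normrM ger0_norm ?mulr_ge0 ?powR_ge0 ?invr_ge0 ?(ltW c0) //.
  rewrite powRM ?mulr_ge0 ?powR_ge0 ?invr_ge0 ?(ltW c0) //; congr (_ * _).
  rewrite normrM normr_sg [X in _ * X]ger0_norm ?powR_ge0 //.
  have [->|yi] := eqVneq (y 0 i) 0.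
    by rewrite normr0 mul0r !powR0 ?gt_eqF.
  by rewrite mul1r -powRrM qk.
have [->|Sy] := eqVneq (psum q y) 0.
  by rewrite mulr0 !powR0 ?mulr0 // ?mulf_neq0 ?invr_eq0 ?gt_eqF.
have {Sy} Sy : 0 < psum q y by rewrite lt_neqAle eq_sym Sy psum_ge0.
rewrite powRM ?powR_ge0 ?psum_ge0 // -powRrM.
have -> : k * (2 / k) = 2%:R by field; rewrite gt_eqF.
rewrite powRM ?powR_ge0 ?invr_ge0 ?(ltW c0) //.
rewrite -[(_ `^ _) `^ 2%:R]powRrM -mulrA -powRD; last first.
  by rewrite (gt_eqF Sy) implybT.
rewrite powR_mulrn ?invr_ge0 ?(ltW c0) // exprVn.
congr (_ * _ `^ _); have -> : k^-1 = 1 - q^-1 by rewrite -kq addrK.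
by ring.
Qed.

End conjugate.

Lemma is_derive_psum_line r x h (s : R) : 1 < r ->
  is_derive s 1 (fun t : R => psum r (x + t *: h))
   (\sum_i r * (Num.sg ((x + s *: h) 0 i) * `|(x + s *: h) 0 i| `^ (r - 1)) * h 0 i).
Proof.
move=> r1.
have -> : (fun t : R => psum r (x + t *: h)) =
    \sum_(i < n) (fun t : R => `|x 0 i + t * h 0 i| `^ r).
  apply/funext => t; rewrite fct_sumE; apply: eq_bigr => i _; by rewrite !mxE.
apply: is_derive_sum => i.
have g : is_derive s 1 (fun t : R => x 0 i + t * h 0 i) (h 0 i).
  by apply: is_derive_eq; rewrite /GRing.scale /=; ring.
have := @is_derive1_comp R (fun u : R => `|u| `^ r) (fun t : R => x 0 i + t * h 0 i).
move=> /(_ s _ _ (is_derive_abs_powR _ r1) g).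
by rewrite !mxE.
Qed.

End power_norms.

(** At a point of differentiability the derivative is the only supporting slope: the Caratheodory
    slope [g] of phi(t) - b t satisfies [g z * z >= 0], and a nonzero [g 0] would keep its sign near
    0, which fails on one of the two sides. It lets the gradient of the prox-function be read off
    the Fenchel inequality. *)
Lemma is_derive_subgradient (R : realType) (phi : R -> R) (D b : R) :
  is_derive (0 : R) 1 phi D -> (forall t, phi 0 + b * t <= phi t) -> D = b.
Proof.
move=> dphi hb; have db : is_derive (0 : R) 1 (fun t : R => phi t - b * t) (D - b).
  by apply: is_derive_eq; rewrite /GRing.scale /=; ring.
move/is_derive1_caratheodory : db => [g [gE gc g0]].
have gp z : 0 <= g z * z.
  have := gE z; rewrite !subr0 mulr0 subr0 => <-.
  by have := hb z; lra.
apply/eqP; rewrite -subr_eq0 -normr_eq0 -g0; apply/negPn/negP => Dn.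
have Dp : 0 < `|g 0| by rewrite lt_neqAle eq_sym Dn normr_ge0.
move/cvgrPdist_lt : gc => /(_ _ Dp) /nbhs_ballP [e /= e0 he].
have close z : `|z| < e -> `|g 0 - g z| < `|g 0|.
  by move=> ze; apply: he; rewrite /ball /= sub0r normrN.
have e2 : 0 < e / 2 by rewrite divr_gt0.
have e2e : e / 2 < e by lra.
have [gp0|gn0|g00] := ltrgtP (g 0) 0; last by rewrite g00 normr0 ltxx in Dp.
- have := close (e / 2); rewrite (gtr0_norm e2) => /(_ e2e).
  rewrite (ltr0_norm gp0) ltr_norml opprK => /andP[h _].
  have := gp (e / 2); rewrite pmulr_lge0 //; lra.
- have := close (- (e / 2)); rewrite normrN (gtr0_norm e2) => /(_ e2e).
  rewrite (gtr0_norm gn0) ltr_norml => /andP[_ h].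
  have := gp (- (e / 2)); rewrite mulrN oppr_ge0 pmulr_lle0 //; lra.
Qed.

Section power_norm_smoothness.
Context {R : realType} {n : nat}.
Implicit Types (x y z h : 'rV[R]_n) (c r q k : R).

Lemma is_derive_half_sqr_line c r x h (s : R) : 1 < r ->
  0 < psum r (x + s *: h) ->
  is_derive s 1 (fun t : R => half_sqr c r (x + t *: h))
    (dotv (duality_map c r (x + s *: h)) h).
Proof.
move=> r1 S0; have dS := is_derive_psum_line x h s r1.
have r0 : r != 0 by rewrite gt_eqF // (lt_trans ltr01).
have := @is_derive1_comp R (fun u : R => u `^ (2 / r)) (fun t => psum r (x + t *: h)) s.
move=> /(_ _ _ (is_derive1_powR _ S0) dS) dP.
have -> : (fun t : R => half_sqr c r (x + t *: h)) =
  (fun t : R => c / 2 * ((fun u : R => u `^ (2 / r)) \o (fun t => psum r (x + t *: h))) t).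
  by [].
apply: is_derive_eq; rewrite /GRing.scale /=.
rewrite /dotv !mulr_sumr; apply: eq_bigr => i _; rewrite [in RHS]mxE.
by field.
Qed.

Lemma derivable_half_sqr c r x h : 1 < r -> derivable (half_sqr c r) x h.
Proof.
move=> r1; apply: derivable_line.
have r0 : 0 < r by rewrite (lt_trans ltr01).
(* The chain rule fails at the origin, where the outer power is singular; there homogeneity makes
   the restriction to a line a pure quadratic. *)
have [/psum_eq0 ->|Sx] := eqVneq (psum r x) 0.
  rewrite (_ : (fun s : R => _) = (fun s : R => s ^+ 2 * half_sqr c r h)) //.
  by apply/funext => s; rewrite add0r half_sqrZ.
have [] // := @is_derive_half_sqr_line c r x h 0 r1.
by rewrite scale0r addr0 lt_neqAle eq_sym Sx psum_ge0.
Qed.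

(** The second derivative of [half_sqr c r] along a line. The condition [2 < r] makes the exponent
    [r - 1] exceed 1, so that the signed powers are differentiable even where a coordinate
    vanishes. *)
Lemma is_derive_duality_line c r x h (s : R) : 2 < r ->
  0 < psum r (x + s *: h) ->
  let U := \sum_i Num.sg ((x + s *: h) 0 i) * `|(x + s *: h) 0 i| `^ (r - 1) * h 0 i in
  is_derive s 1 (fun t : R => dotv (duality_map c r (x + t *: h)) h)
    (c * (psum r (x + s *: h) `^ (2 / r - 1)
            * ((r - 1) * \sum_i `|(x + s *: h) 0 i| `^ (r - 2) * h 0 i ^+ 2)
          - (r - 2) * psum r (x + s *: h) `^ (2 / r - 1 - 1) * U ^+ 2)).
Proof.
move=> r2 S0 U; have r1 : 1 < r by lra.
have r0 : r != 0 by rewrite gt_eqF // (lt_trans ltr01).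
have dS := is_derive_psum_line x h s r1.
have := @is_derive1_comp R (fun u : R => u `^ (2 / r - 1)) (fun t => psum r (x + t *: h)) s.
move=> /(_ _ _ (is_derive1_powR _ S0) dS).
set P := (fun _ : R => _ `^ _) \o _ => dP.
pose V (t : R) := \sum_i Num.sg (x 0 i + t * h 0 i) * `|x 0 i + t * h 0 i| `^ (r - 1) * h 0 i.
have dV : is_derive s 1 V
    ((r - 1) * \sum_i `|(x + s *: h) 0 i| `^ (r - 2) * h 0 i ^+ 2).
  have -> : V = \sum_(i < n) (fun t : R =>
      (Num.sg (x 0 i + t * h 0 i) * `|x 0 i + t * h 0 i| `^ (r - 1)) * h 0 i).
    by apply/funext => t; rewrite fct_sumE.
  rewrite mulr_sumr; apply: is_derive_sum => i.
  have g : is_derive s 1 (fun t : R => x 0 i + t * h 0 i) (h 0 i).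
    by apply: is_derive_eq; rewrite /GRing.scale /=; ring.
  have r11 : 1 < r - 1 by lra.
  have := @is_derive1_comp R (fun u : R => Num.sg u * `|u| `^ (r - 1)) _ s _ _
    (is_derive_sg_powR _ r11) g.
  set W := _ \o _ => dW.
  have dWh : is_derive s 1 (fun t => W t * h 0 i)
    ((r - 1) * `|x 0 i + s * h 0 i| `^ (r - 1 - 1) * h 0 i * h 0 i).
    by apply: is_derive_eq; rewrite /GRing.scale /=; ring.
  apply: is_derive_eq dWh _; rewrite !mxE -!mulrA -expr2.
  by do 2 congr (_ * _); congr (_ `^ _); lra.
have -> : (fun t : R => dotv (duality_map c r (x + t *: h)) h) =
    (fun t : R => c * (P t * V t)).
  apply/funext => t; rewrite /dotv /V !mulr_sumr; apply: eq_bigr => i _.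
  by rewrite /P /= !mxE !mulrA.
have sE (u v : R) : u *: (v : R^o) = u * v by [].
apply: is_derive_eq; rewrite !sE.
congr (_ * _).
have -> : V s = U.
  by apply: eq_bigr => i _; rewrite !mxE.
have -> : \sum_i r * (Num.sg ((x + s *: h) 0 i) * `|(x + s *: h) 0 i| `^ (r - 1)) * h 0 i
   = r * U.
  by rewrite mulr_sumr; apply: eq_bigr => i _; rewrite !mulrA.
rewrite /P /=; set A := \sum_i _; set B := psum _ _ `^ _; set C := psum _ _ `^ _.
by field.
Qed.

(** A power-mean inequality. With [a] the [r]-power mean of the coordinates, Young's inequality with
    exponents r / (r - 2) and r / 2 bounds each (|x_i| / a)^(r - 2) by (r - 2) / r times (|x_i| /
    a)^r plus 2 / r, and these bounds sum to n. *)
Lemma psum_power_mean r x : 2 < r -> 0 < psum r x ->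
  psum r x `^ (2 / r - 1) * psum (r - 2) x <= n%:R `^ (2 / r).
Proof.
move=> r2 S0; have r0 : 0 < r by lra.
have n0 : 0 < n%:R :> R.
  rewrite ltr0n lt0n; apply/eqP => n0; move: S0.
  by rewrite /psum big1 ?ltxx // => i; have := ltn_ord i; rewrite {2}n0.
set a := (psum r x / n%:R) `^ r^-1.
have a0 : 0 < a by rewrite powR_gt0 // divr_gt0.
have ar : a `^ r = psum r x / n%:R.
  by rewrite -powRrM mulVf ?gt_eqF // powRr1 // divr_ge0 // ltW.
have key : psum (r - 2) x / a `^ (r - 2) <= n%:R.
  rewrite /psum mulr_suml.
  have -> : n%:R = \sum_(i < n) ((`|x 0 i| `^ r / a `^ r) * ((r - 2) / r) + 2 / r).
    rewrite big_split /= -!mulr_suml sumr_const card_ord ar -/(psum r x).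
    by rewrite -mulr_natl; field; rewrite !gt_eqF.
  apply: ler_sum => i _; rewrite -!divr_powR // .
  have r20 : 0 < r - 2 by rewrite subr_gt0.
  have := @conjugate_powR R ((`|x 0 i| / a) `^ (r - 2)) 1 (r / (r - 2)) (r / 2).
  move=> /(_ (powR_ge0 _ _) ler01 (divr_gt0 r0 r20) (divr_gt0 r0 (ltr0n _ 2))).
  rewrite mulr1 -powRrM powR1 !invf_div mul1r.
  have -> : (r - 2) * (r / (r - 2)) = r by field; rewrite gt_eqF.
  by apply; field; rewrite gt_eqF.
have -> : psum r x `^ (2 / r - 1) = n%:R `^ (2 / r - 1) / a `^ (r - 2).
  rewrite -[in RHS]powRrM divr_powR ?(ltW S0) //.
  have -> : psum r x `^ (2 / r - 1) = (psum r x `^ (r^-1 * (r - 2)))^-1.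
    by rewrite -powRN; congr (_ `^ _); field; rewrite gt_eqF.
  have -> : n%:R `^ (2 / r - 1) = (n%:R `^ (r^-1 * (r - 2)))^-1 :> R.
    by rewrite -powRN; congr (_ `^ _); field; rewrite gt_eqF.
  have P1 : 0 < psum r x `^ (r^-1 * (r - 2)) by rewrite powR_gt0.
  have P2 : 0 < n%:R `^ (r^-1 * (r - 2)) :> R by rewrite powR_gt0.
  by field; rewrite !gt_eqF.
rewrite -mulrA (mulrC _ (psum _ _)).
apply: (@le_trans _ _ (n%:R `^ (2 / r - 1) * n%:R)); first by rewrite ler_wpM2l ?powR_ge0.
by rewrite mulrC -[X in X * _](powRr1 (ltW n0)) -powRD ?(gt_eqF n0) ?implybT //
  addrC subrK.
Qed.

(* The Hessian of [half_sqr c r] is degenerate at the origin: if the segment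
   from x to x + h meets it, then x and h are collinear. *)
Lemma half_sqr_smooth c r x h : 0 <= c -> 2 < r ->
  c * (r - 1) * n%:R `^ (2 / r) <= 1 ->
  half_sqr c r (x + h) <=
    half_sqr c r x + dotv (duality_map c r x) h + `|h| ^+ 2 / 2.
Proof.
move=> c0 r2 cr; have r0 : 0 < r by lra.
have le_norm (y : 'rV[R]_n) i : `|y 0 i| <= `|y|.
  rewrite /Num.norm /= mx_normrE; apply: (le_trans _ (le_bigmax _ _ (0, i))).
  by [].
have [S0|] := pselect (forall s : R, 0 < psum r (x + s *: h)).
  have M0 : 0 <= `|h| ^+ 2 by rewrite sqr_ge0.
  have := @quadratic_upper_bound R (fun t => half_sqr c r (x + t *: h))
    (fun t => dotv (duality_map c r (x + t *: h)) h) (`|h| ^+ 2).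
  rewrite !scale0r !addr0 scale1r; apply.
    by move=> s; apply: is_derive_half_sqr_line => //; lra.
  move=> s /andP[s0 _].
  have dd t := @is_derive_duality_line c r x h t r2 (S0 t).
  have [|t _] := @MVT_segment R _ _ 0 s s0 (fun t _ => dd t).
    apply: continuous_subspaceT => t.
    by apply: differentiable_continuous; apply/derivable1_diffP; case: (dd t).
  rewrite subr0 scale0r addr0 => /(canRL (subrK _)) ->.
  rewrite addrC lerD2l ler_wpM2r //.
  have Q0 : 0 < psum r (x + t *: h) by exact: S0.
  apply: (@le_trans _ _ (c * (r - 1) * (psum r (x + t *: h) `^ (2 / r - 1)
     * psum (r - 2) (x + t *: h)) * `|h| ^+ 2)); last first.
    rewrite -[leRHS]mul1r ler_wpM2r // (le_trans _ cr) // ler_wpM2l //.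
      by rewrite mulr_ge0 // subr_ge0; lra.
    exact: psum_power_mean.
  rewrite -!mulrA ler_wpM2l // lerBlDr.
  apply: ler_wpDr.
    apply: mulr_ge0; first by rewrite subr_ge0 ltW.
    by apply: mulr_ge0; [exact: powR_ge0|exact: sqr_ge0].
  have r10 : 0 <= r - 1 by lra.
  rewrite mulrCA; apply: (ler_wpM2l r10); apply: ler_wpM2l; first exact: powR_ge0.
  rewrite /psum mulr_suml; apply: ler_sum => i _.
  rewrite ler_wpM2l ?powR_ge0 // -[leLHS]real_normK ?num_real //.
  by rewrite ler_pXn2r ?nnegrE ?normr_ge0.
move/existsNP => [s /negP]; rewrite -leNgt => Ss.
have {Ss} /psum_eq0 /eqP : psum r (x + s *: h) = 0.
  by apply/eqP; rewrite eq_le Ss psum_ge0.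
rewrite addr_eq0 -scaleNr => /eqP ->; move: (- s) => l.
have -> : l *: h + h = (l + 1) *: h by rewrite scalerDl scale1r.
rewrite !half_sqrZ //.
have -> : dotv (duality_map c r (l *: h)) h = 2 * l * half_sqr c r h.
  have [->|l0] := eqVneq l 0.
    rewrite mulr0 mul0r scale0r /dotv big1 // => i _.
    by rewrite !mxE sgr0 mul0r mulr0 mul0r.
  apply: (mulfI l0); rewrite -dotvZr dotv_duality_map //.
  have := half_sqrZ c l h r0; rewrite {1}/half_sqr => E.
  have -> : l * (2 * l * half_sqr c r h) = 2 * (l ^+ 2 * half_sqr c r h) by ring.
  by rewrite -E; field.
(* By homogeneity the three terms are (l + 1)^2, l^2 and 2 l times [half_sqr c r h], so only one
   copy of it is left over. It is bounded through [psum r h], a sum of n terms each at most the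
   [r]-th power of the sup norm. *)
suff : half_sqr c r h <= `|h| ^+ 2 / 2 by lra.
rewrite /half_sqr mulrAC ler_wpM2r ?invr_ge0 //.
have cn : c * n%:R `^ (2 / r) <= 1.
  apply: le_trans cr; rewrite mulrAC ler_peMr ?mulr_ge0 ?powR_ge0 //; lra.
rewrite -[leRHS]mul1r; apply: (@le_trans _ _ (c * n%:R `^ (2 / r) * `|h| ^+ 2)).
  rewrite -mulrA ler_wpM2l //.
  have -> : `|h| ^+ 2 = (`|h| `^ r) `^ (2 / r).
    rewrite -powRrM (_ : r * (2 / r) = 2%:R) ?powR_mulrn //.
    by field; rewrite gt_eqF.
  rewrite -powRM ?powR_ge0 //; apply: ge0_ler_powR.
  - by rewrite divr_ge0 // ltW.
  - by rewrite nnegrE psum_ge0.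
  - by rewrite nnegrE mulr_ge0 ?powR_ge0.
  - rewrite mulr_natl -[X in _ *+ X]card_ord -sumr_const; apply: ler_sum => i _.
    by apply: ge0_ler_powR; rewrite ?nnegrE // ltW.
by rewrite ler_wpM2r // sqr_ge0.
Qed.

End power_norm_smoothness.

(** * The mirror map *)

Section mirror_setup.
Context {R : realType}.
Variables (p n : nat).
Hypotheses (n8 : (8 <= n)%N) (p12 : p = 1%N \/ p = 2%N).
Implicit Types (x z u s h : 'rV[R]_n).

Let lnn : R := ln n%:R.

Definition prox_coef : R :=
  if p == 1%N then
    expR 1 * n%:R `^ ((kappa n - 1) * (2 - kappa n) / kappa n) * ln n%:R
  else 1.

Definition prox_exp : R := if p == 1%N then kappa n else 2.

(** The Hoelder conjugate of [prox_exp]: [1 + ln n] is conjugate to [kappa]. *)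
Definition dual_exp : R := if p == 1%N then 1 + ln n%:R else 2.

(** The Fenchel conjugate d^* of [prox]; [mirror] below is its gradient. *)
Definition dual_prox s : R := half_sqr prox_coef^-1 dual_exp s.

Definition mirror s : 'rV[R]_n := duality_map prox_coef^-1 dual_exp s.

Definition sqr_dual_norm h : R := if p == 1%N then `|h| ^+ 2 else dotv h h.

Definition fenchel_gap u s : R := prox p u + dual_prox s - dotv u s.

(** From ln 8 = 3 ln 2 and ln (1 / 2) <= - 1 / 2. For [p = 1] it makes the dual exponent exceed 2,
    which the second-order argument of [half_sqr_smooth] requires. *)
Lemma ln_ge32 : 3 / 2 <= lnn.
Proof.
apply: (@le_trans _ _ (ln (8 : R))); last by rewrite ler_ln ?posrE ?ltr0n ?ler_nat // (leq_trans _ n8).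
have -> : 8 = 2 ^+ 3 :> R by rewrite -natrX.
rewrite lnXn // -mulr_natl.
have h : ln (2^-1 : R) <= - 2^-1.
  rewrite (_ : ln _ = ln (1 + - 2^-1)); first by apply: le_ln1Dx; lra.
  by congr (ln _); field.
rewrite lnV ?posrE // in h; lra.
Qed.

Let n0 : 0 < n%:R :> R.
Proof. by rewrite ltr0n (leq_trans _ n8). Qed.

Let lnn0 : 0 < lnn.
Proof. by have := ln_ge32; lra. Qed.

Lemma prox_coef_gt0 : 0 < prox_coef.
Proof. by rewrite /prox_coef; case: ifP => // _; rewrite !mulr_gt0 ?expR_gt0 ?powR_gt0. Qed.

Lemma prox_exp_gt1 : 1 < prox_exp.
Proof.
rewrite /prox_exp; case: ifP => _; last by rewrite ltr1n.
by rewrite /kappa ltrDl divr_gt0.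
Qed.

Lemma dual_exp_ge2 : 2 <= dual_exp.
Proof.
rewrite /dual_exp; case: ifP => // _; have := ln_ge32; rewrite /lnn; lra.
Qed.

Lemma prox_exp_conj : prox_exp^-1 + dual_exp^-1 = 1.
Proof.
rewrite /prox_exp /dual_exp /kappa -/lnn; case: ifP => _; last by field.
have l0 := lnn0; have l1 : 0 < 1 + lnn by lra.
by field; rewrite !gt_eqF // addrC.
Qed.

Let k0 : 0 < prox_exp. Proof. by rewrite (lt_trans ltr01) // prox_exp_gt1. Qed.
Let q0 : 0 < dual_exp. Proof. by rewrite (lt_le_trans _ dual_exp_ge2). Qed.
Let c0 := prox_coef_gt0.

Lemma psum2 x : psum 2 x = dotv x x.
Proof.
apply: eq_bigr => i _; rewrite -expr2 powR_mulrn //.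
by rewrite real_normK ?num_real.
Qed.

Lemma proxE x : prox p x = half_sqr prox_coef prox_exp x.
Proof.
rewrite /prox /half_sqr /prox_coef /prox_exp; case: ifP => _.
  rewrite /normp sqr_powR (mulrC _ 2) -/(psum _ x).
  move: (_ `^ _) (_ `^ _) (ln _) => a b l; by field.
by rewrite div1r divff // powRr1 ?psum_ge0 // sqr_norm2 psum2.
Qed.

Lemma fenchel_gap_ge0 u s : 0 <= fenchel_gap u s.
Proof. by rewrite subr_ge0 proxE half_sqr_young // prox_exp_conj. Qed.

Lemma fenchel_gap_mirror s : fenchel_gap (mirror s) s = 0.
Proof.
by rewrite /fenchel_gap proxE half_sqr_young_eq ?subrr // prox_exp_conj.
Qed.

Lemma sqr_dual_norm_ge0 h : 0 <= sqr_dual_norm h.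
Proof. by rewrite /sqr_dual_norm; case: ifP => _; rewrite ?sqr_ge0 ?dotvv_ge0. Qed.

Lemma sqr_dual_normZ (a : R) h : sqr_dual_norm (a *: h) = a ^+ 2 * sqr_dual_norm h.
Proof.
rewrite /sqr_dual_norm; case: ifP => _; last by rewrite dotvZl dotvZr mulrA.
by rewrite normrZ exprMn real_normK ?num_real.
Qed.

Lemma sqr_dual_norm_le h : sqr_dual_norm h <= dotv h h.
Proof.
rewrite /sqr_dual_norm; case: ifP => _ //.
have [->|/mx_norm_neq0 [[i j] /= ij]] := eqVneq `|h| 0.
  by rewrite expr0n dotvv_ge0.
rewrite [`|h|]ij ord1 real_normK ?num_real // /dotv (bigD1 j) //= -expr2 lerDl.
by apply: sumr_ge0 => k _; rewrite -expr2 sqr_ge0.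
Qed.

Lemma dual_prox_smooth s h :
  dual_prox (s + h) <= dual_prox s + dotv (mirror s) h + sqr_dual_norm h / 2.
Proof.
have l32 := ln_ge32; have l0 := lnn0.
rewrite /dual_prox /mirror /sqr_dual_norm /dual_exp /prox_coef; case: ifP => _.
  apply: half_sqr_smooth.
  - by rewrite invr_ge0 !mulr_ge0 ?expR_ge0 ?powR_ge0 // ltW.
  - by rewrite -/lnn; lra.
  have powE (a : R) : n%:R `^ a = expR (a * lnn) by rewrite /powR gt_eqF.
  rewrite -/lnn !powE -expRD.
  (* The normalisation of the prox-function makes the condition of [half_sqr_smooth] an equality:
     the factor [ln n] cancels [dual_exp - 1], and e times the power of n cancels n^(2 / (1 + ln
     n)). *)
  have -> : 1 + (kappa n - 1) * (2 - kappa n) / kappa n * lnn = 2 / (1 + lnn) * lnn.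
    rewrite /kappa -/lnn; field; rewrite !gt_eqF //; lra.
  rewrite (_ : _ * _ = 1) //; field.
  by rewrite !gt_eqF ?expR_gt0.
have hE x : half_sqr 1 2 x = 2^-1 * dotv x x.
  by rewrite /half_sqr div1r divff // powRr1 ?psum_ge0 // psum2.
have -> : duality_map 1^-1 2 s = s.
  apply/rowP => i; rewrite mxE divff // subrr powRr0 invr1 !mul1r.
  rewrite (_ : 2 - 1 = 1 :> R); last by ring.
  by rewrite powRr1 // mulr_sg_norm.
rewrite invr1 !hE dotvDl !dotvDr (dotvC h s); lra.
Qed.

(** Smoothness of d^* yields strong convexity of d: the nonnegative gap at the shifted dual point
    [s + h], with [h = u - mirror s], is bounded above by the smoothness inequality. The Euclidean
    norm suffices, since the error terms of the direction involve only the Euclidean distance to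
    [xstar]. *)
Lemma fenchel_gap_strong u s :
  dotv (u - mirror s) (u - mirror s) / 2 <= fenchel_gap u s.
Proof.
set h := u - mirror s.
have := fenchel_gap_ge0 u (s + h); have := dual_prox_smooth s h.
have := sqr_dual_norm_le h; rewrite /fenchel_gap dotvDr.
have -> : dotv u h = dotv h h + dotv (mirror s) h.
  by rewrite -dotvDl /h subrK.
move: (dotv h h) (dotv _ h) (dual_prox _) (dual_prox _) (prox _ _) (dotv _ _).
move=> *; lra.
Qed.

Lemma fenchel_gap_eq0 u s : fenchel_gap u s = 0 -> u = mirror s.
Proof.
move=> g0; apply/eqP; rewrite -subr_eq0; apply/eqP/dotvv_eq0.
by apply/eqP; rewrite eq_le dotvv_ge0 andbT; have := fenchel_gap_strong u s; rewrite g0; lra.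
Qed.

(** The preimage is the gradient of d at [x]; the equality case of Fenchel-Young with the two
    exponents exchanged gives a zero gap. This provides the dual starting point. *)
Lemma mirror_surj x : exists s, mirror s = x.
Proof.
exists (duality_map prox_coef prox_exp x); apply/esym/fenchel_gap_eq0.
have ci : 0 < prox_coef^-1 by rewrite invr_gt0.
have qk : dual_exp^-1 + prox_exp^-1 = 1 by rewrite addrC prox_exp_conj.
have := half_sqr_young_eq ci q0 k0 qk x.
rewrite invrK -proxE => E.
by apply/eqP; rewrite subr_eq0 dotvC -E addrC.
Qed.

(** The gap is nonnegative and vanishes at [mirror s], so [s] supports [prox] at that point;
    derivability along coordinates then forces it to be the gradient. *)
Lemma grad_prox_mirror s : grad (@prox R p n) (mirror s) = s.
Proof.
apply/rowP => i; rewrite mxE derive_line -(dotv_delta s i) dotvC.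
set v := delta_mx _ _; set z := mirror s.
have proxF : half_sqr prox_coef prox_exp = @prox R p n.
  by apply/funext => x; rewrite proxE.
have dz := @derivable_half_sqr R n prox_coef prox_exp z v prox_exp_gt1.
apply: (@is_derive_subgradient _ (fun t : R => prox p (z + t *: v))).
  split; last reflexivity.
  by move: dz; rewrite proxF /derivable derive_lineE.
move=> t; have := fenchel_gap_ge0 (z + t *: v) s; have := fenchel_gap_mirror s.
rewrite /fenchel_gap -/z scale0r addr0 dotvDl dotvZl; lra.
Qed.

Lemma bregman_mirror s u : bregman p (mirror s) u = fenchel_gap u s.
Proof.
have := fenchel_gap_mirror s; rewrite /fenchel_gap /bregman grad_prox_mirror.
rewrite dotvBr !(dotvC s); lra.
Qed.

(** Up to a constant the objective is the Fenchel gap at the dual point [s - a *: v]. Since [argmin]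
    picks an unspecified minimizer, uniqueness ([fenchel_gap_eq0]) is what identifies it. *)
Lemma argmin_mirror s (a : R) (v : 'rV[R]_n) :
  argmin (fun z' => a * dotv v (z' - mirror s) + bregman p (mirror s) z') =
  mirror (s - a *: v).
Proof.
set h := fun z' => _.
have hE z' : h z' = fenchel_gap z' (s - a *: v)
    + (dual_prox s - dual_prox (s - a *: v) - a * dotv v (mirror s)).
  rewrite /h bregman_mirror /fenchel_gap !dotvBr dotvZr (dotvC v z').
  move: (dotv _ _) (dotv _ _) (dotv _ _) (dual_prox _) (dual_prox _) (prox _ _).
  by move=> *; ring.
have mm : minimizer h (mirror (s - a *: v)).
  by move=> z'; rewrite !hE fenchel_gap_mirror lerD2r fenchel_gap_ge0.
apply: fenchel_gap_eq0; apply/eqP; rewrite eq_le fenchel_gap_ge0 andbT.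
have : minimizer h (argmin h) by apply: (@getPex _ (minimizer h)); exists (mirror (s - a *: v)).
by move=> /(_ (mirror (s - a *: v))); rewrite !hE fenchel_gap_mirror lerD2r.
Qed.

End mirror_setup.

(** * Means and independence *)

Section rVborel_theory.
Context {R : realType} {n : nat}.
Implicit Types (d : measure_display).

Lemma continuous_rVborel (f : 'rV[R]_n -> R) : continuous f ->
  measurable_fun setT (f : rVborel R n -> R).
Proof.
move=> /continuousP cf; apply: (measurability _ (RGenOpens.measurableE R)).
move=> _ [_ [a [b ->]] <-]; rewrite setTI.
by apply: sub_sigma_algebra; apply: cf; exact: interval_open.
Qed.

Lemma measurable_coord (i : 'I_n) :
  measurable_fun setT (fun x : rVborel R n => (x : 'rV[R]_n) 0 i).
Proof. by apply: continuous_rVborel; exact: coord_continuous. Qed.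

Lemma measurable_ball d (T : measurableType d) (h : T -> 'rV[R]_n) c r :
  0 < r -> (forall i, measurable_fun setT (fun w => h w 0 i)) ->
  measurable (h @^-1` ball c r).
Proof.
move=> r0 mh.
rewrite (_ : _ @^-1` _ = \bigcap_(i in [set: 'I_n]) ((fun w => h w 0 i) @^-1` ball (c 0 i) r)).
  apply: fin_bigcap_measurable => // i _; rewrite -[X in measurable X]setTI.
  by apply: mh => //; apply: open_measurable; exact: ball_open.
apply/seteqP; split => w /=.
  by move=> [_ hw] i _; exact: hw.
by move=> hw; split => // i j; rewrite ord1; exact: hw.
Qed.

(** The sigma-algebra is generated by all open sets, and second countability reduces these to
    coordinates: an open set is a countable union of balls with rational centres and radii 1 / (k +
    1), and a sup-norm ball is a finite intersection of coordinate conditions. *)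
Lemma measurable_rV d (T : measurableType d) (h : T -> 'rV[R]_n) :
  (forall i, measurable_fun setT (fun w => h w 0 i)) ->
  measurable_fun setT (h : T -> rVborel R n).
Proof.
move=> mh; apply: (@measurability _ _ T (rVborel R n) setT h (@open 'rV[R]_n)) => //.
move=> _ [U oU <-]; rewrite setTI.
pose ctr (q : 'rV[rat]_n) : 'rV[R]_n := \row_i ratr (q 0 i).
pose S := [set qk : 'rV[rat]_n * nat | ball (ctr qk.1) qk.2.+1%:R^-1 `<=` U].
have -> : h @^-1` U = \bigcup_qk
    (if qk \in S then h @^-1` ball (ctr qk.1) qk.2.+1%:R^-1 else set0).
  apply/seteqP; split => w /=; last first.
    by move=> [qk _]; case: ifPn => // /set_mem Sqk /= /Sqk.
  move=> Uw; have /nbhs_ballP[e /= e0 eU] : nbhs (h w) U by exact: open_nbhs_nbhs.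
  have [k ke] : exists k, k.+1%:R^-1 < e / 2.
    have e2 : 0 < e / 2 by rewrite divr_gt0.
    exists (Num.truncn (e / 2)^-1); rewrite invf_plt ?posrE //.
    exact: truncnS_gt.
  set r := k.+1%:R^-1 in ke; have r0 : 0 < r by rewrite invr_gt0.
  have qi i : exists q : rat, ball (ratr q : R) r (h w 0 i).
    have [q] : exists q, ratr q \in `]h w 0 i - r, h w 0 i + r[%R.
      by apply: rat_in_itvoo; lra.
    rewrite in_itv /= => /andP[q1 q2]; exists q.
    by rewrite /ball /= ltr_norml; apply/andP; split; lra.
  pose q : 'rV[rat]_n := \row_i projT1 (cid (qi i)).
  have bq : ball (ctr q) r (h w).
    by split => // i j; rewrite ord1 !mxE; case: cid.
  exists (q, k) => //; rewrite mem_set // => z bz; apply: eU.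
  apply: (@le_ball _ _ _ (r + r)); first lra.
  exact: ball_triangle (ball_sym bq) bz.
apply: countable_bigcupT_measurable => // qk.
by case: ifP => // _; exact: measurable_ball.
Qed.

End rVborel_theory.

Section mean.
Context {R : realType} {d} {T : measurableType d} (P : probability T R).
Implicit Types (X Y : T -> R) (a r s : R).

(** Integrability is bundled with the value, here and in [mean_le], so that expectations can be
    added and scaled as reals without finiteness conditions. *)
Definition mean_eq X r : Prop :=
  P.-integrable setT (EFin \o X) /\ (\int[P]_w (X w)%:E = r%:E)%E.

Definition mean_le X r : Prop :=
  P.-integrable setT (EFin \o X) /\ (\int[P]_w (X w)%:E <= r%:E)%E.

Lemma mean_eq_le X r : mean_eq X r -> mean_le X r.
Proof. by case=> iX eX; split; rewrite // eX. Qed.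

Lemma mean_eq_measurable X r : mean_eq X r -> measurable_fun setT X.
Proof. by case=> /measurable_int /measurable_EFinP. Qed.

Lemma mean_le_measurable X r : mean_le X r -> measurable_fun setT X.
Proof. by case=> /measurable_int /measurable_EFinP. Qed.

Lemma mean_eq_cst a : mean_eq (cst a) a.
Proof.
split; first exact: finite_measure_integrable_cst.
by have := expectation_cst P a; rewrite unlock.
Qed.

Lemma mean_eqD X Y r s : mean_eq X r -> mean_eq Y s ->
  mean_eq (fun w => X w + Y w) (r + s).
Proof.
move=> [iX eX] [iY eY]; split; first exact: (integrableD _ iX iY).
have := integralD_EFin measurableT iX iY; by rewrite eX eY EFinD.
Qed.

Lemma mean_leD X Y r s : mean_le X r -> mean_le Y s ->
  mean_le (fun w => X w + Y w) (r + s).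
Proof.
move=> [iX eX] [iY eY]; split; first exact: (integrableD _ iX iY).
have := integralD_EFin measurableT iX iY => /= ->.
by rewrite EFinD; exact: leeD.
Qed.

Lemma mean_eqZ a X r : mean_eq X r -> mean_eq (fun w => a * X w) (a * r).
Proof.
move=> [iX eX]; split; first exact: (integrableZl _ a iX).
by have := integralZl measurableT iX a; rewrite eX EFinM.
Qed.

Lemma mean_leZ a X r : 0 <= a -> mean_le X r -> mean_le (fun w => a * X w) (a * r).
Proof.
move=> a0 [iX eX]; split; first exact: (integrableZl _ a iX).
have := integralZl measurableT iX a => /= ->.
by rewrite EFinM lee_wpmul2l.
Qed.

Lemma mean_le_trans X r s : r <= s -> mean_le X r -> mean_le X s.
Proof. by move=> rs [iX eX]; split; rewrite // (le_trans eX) ?lee_fin. Qed.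

Lemma mean_eq_sum (I : Type) (l : seq I) (X : I -> T -> R) (r : I -> R) :
  (forall i, mean_eq (X i) (r i)) ->
  mean_eq (fun w => \sum_(i <- l) X i w) (\sum_(i <- l) r i).
Proof.
move=> h; elim: l => [|i l ih].
  rewrite big_nil (_ : (fun _ => _) = cst 0); first exact: mean_eq_cst.
  by apply/funext => w; rewrite big_nil.
rewrite big_cons (_ : (fun _ => _) = (fun w => X i w + \sum_(j <- l) X j w)).
  exact: mean_eqD.
by apply/funext => w; rewrite big_cons.
Qed.

Lemma mean_le_sum (I : Type) (l : seq I) (X : I -> T -> R) (r : I -> R) :
  (forall i, mean_le (X i) (r i)) ->
  mean_le (fun w => \sum_(i <- l) X i w) (\sum_(i <- l) r i).
Proof.
move=> h; elim: l => [|i l ih].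
  rewrite big_nil (_ : (fun _ => _) = cst 0); first exact/mean_eq_le/mean_eq_cst.
  by apply/funext => w; rewrite big_nil.
rewrite big_cons (_ : (fun _ => _) = (fun w => X i w + \sum_(j <- l) X j w)).
  exact: mean_leD.
by apply/funext => w; rewrite big_cons.
Qed.

Lemma mean_eq_ae X Y r : measurable_fun setT X ->
  {ae P, forall w, X w = Y w} -> mean_eq Y r -> mean_eq X r.
Proof.
move=> mX XY [iY eY].
have mX' : measurable_fun setT (EFin \o X) by exact/measurable_EFinP.
have /integrableP[mY fY] := iY.
have mA (Z : T -> R) : measurable_fun setT (EFin \o Z) ->
  measurable_fun setT (fun w => `|(Z w)%:E|)%E by move=> mZ; exact: measurableT_comp.
split.
  apply/integrableP; split => //; apply: le_lt_trans fY.
  rewrite le_eqVlt; apply/orP; left; apply/eqP; apply: ae_eq_integral => //.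
  - exact: mA.
  - exact: mA.
  - by apply: filterS XY => w /= ->.
rewrite -eY; apply: ae_eq_integral => //.
by apply: filterS XY => w /= ->.
Qed.

Lemma ge0_mean_le X r : measurable_fun setT X -> (forall w, 0 <= X w) ->
  (\int[P]_w (X w)%:E <= r%:E)%E -> mean_le X r.
Proof.
move=> mX X0 eX; split => //; apply/integrableP; split; first exact/measurable_EFinP.
under eq_integral => w _ do rewrite /= ger0_norm //.
exact: le_lt_trans eX (ltry _).
Qed.

Lemma mean_le_ge0 X r : (forall w, 0 <= X w) -> mean_le X r -> 0 <= r.
Proof.
move=> X0 [_ h]; rewrite -lee_fin; apply: le_trans h.
by apply: integral_ge0 => w _; rewrite lee_fin.
Qed.

Lemma ae_mean_le X Y r : measurable_fun setT X -> (forall w, 0 <= X w) ->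
  {ae P, forall w, X w <= Y w} -> mean_le Y r -> mean_le X r.
Proof.
move=> mX X0 XY [iY eY]; apply: ge0_mean_le => //.
have mY : measurable_fun setT Y by move/measurable_int/measurable_EFinP : iY.
(* [Y] dominates a nonnegative function only almost surely, so it may be negative on a null set; its
   positive part has the same integral and is nonnegative everywhere. *)
have mY' : measurable_fun setT (fun w => Num.max (Y w) 0).
  exact: measurable_maxr.
apply: le_trans eY; apply: (@le_trans _ _ (\int[P]_w (Num.max (Y w) 0)%:E)%E).
  apply: ae_ge0_le_integral => //.
  - by move=> w _; rewrite lee_fin.
  - exact/measurable_EFinP.
  - by move=> w _; rewrite lee_fin le_max lexx orbT.
  - exact/measurable_EFinP.
  - by apply: filterS XY => w Xw _; rewrite lee_fin le_max Xw.
rewrite le_eqVlt; apply/orP; left; apply/eqP; apply: ae_eq_integral => //.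
- exact/measurable_EFinP.
- exact/measurable_EFinP.
- by apply: filterS XY => w Xw _ /=; rewrite max_l // (le_trans (X0 w)).
Qed.

Lemma ae_mean_eq_le X Y r s : {ae P, forall w, X w <= Y w} ->
  mean_eq X r -> mean_le Y s -> r <= s.
Proof.
move=> XY mX mY.
have h : mean_le (fun w => Y w + -1 * X w) (s + -1 * r).
  by apply: mean_leD => //; apply/mean_eq_le/mean_eqZ.
have : mean_le (fun w => Num.max (Y w + -1 * X w) 0) (s + -1 * r).
  apply: (ae_mean_le _ _ _ h).
  - by apply: measurable_maxr => //; exact: mean_le_measurable h.
  - by move=> w; rewrite le_max lexx orbT.
  - by apply: filterS XY => w Xw; rewrite max_l //; lra.
move=> /mean_le_ge0 h0; suff : 0 <= s + -1 * r by lra.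
by apply: h0 => w; rewrite le_max lexx orbT.
Qed.

Lemma ae_mean_abs_le X Y r s : {ae P, forall w, `|X w| <= Y w} ->
  mean_eq X r -> mean_le Y s -> `|r| <= s.
Proof.
move=> XY mX mY; rewrite ler_norml; apply/andP; split; last first.
  by apply: ae_mean_eq_le mX mY; apply: filterS XY => w; exact: le_trans (ler_norm _).
have := ae_mean_eq_le _ (mean_eqZ (-1) mX) mY; rewrite mulN1r lerNl; apply.
apply: filterS XY => w; apply: le_trans; rewrite mulN1r -normrN; exact: ler_norm.
Qed.

Lemma mean_eq_unique X r s : mean_eq X r -> mean_eq X s -> r = s.
Proof. by move=> [_ e1] [_]; rewrite e1 => -[]. Qed.

Lemma mean_le_eq X Y r : X =1 Y -> mean_le X r -> mean_le Y r.
Proof. by move=> /funext ->. Qed.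

Lemma mean_eq_eq X Y r : X =1 Y -> mean_eq X r -> mean_eq Y r.
Proof. by move=> /funext ->. Qed.

(* 2 |X Y| <= X^2 + Y^2 *)
Lemma integrable_prod X Y r s : measurable_fun setT X -> measurable_fun setT Y ->
  mean_le (fun w => X w ^+ 2) r -> mean_le (fun w => Y w ^+ 2) s ->
  P.-integrable setT (EFin \o (fun w => X w * Y w)).
Proof.
move=> mX mY hX hY; have [iS _] := mean_leD hX hY.
apply: le_integrable iS => //.
  by apply/measurable_EFinP; exact: measurable_funM.
move=> w _ /=; rewrite lee_fin normrM [leRHS]ger0_norm ?addr_ge0 ?sqr_ge0 //.
rewrite -(real_normK (num_real (X w))) -(real_normK (num_real (Y w))).
have := sqr_ge0 (`|X w| - `|Y w|); have := normr_ge0 (X w); have := normr_ge0 (Y w).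
move: `|X w| `|Y w| => a b; nra.
Qed.

Lemma integrable_mean X : P.-integrable setT (EFin \o X) -> exists r, mean_eq X r.
Proof.
move=> iX; exists (fine (\int[P]_w (X w)%:E)%E); split => //.
by rewrite fineK //; exact: integrable_fin_num iX.
Qed.

Lemma bounded_mean X M : measurable_fun setT X ->
  {ae P, forall w, `|X w| <= M} -> exists r, mean_eq X r.
Proof.
move=> mX XM; apply: integrable_mean; apply/integrableP; split.
  exact/measurable_EFinP.
have [iA _] : mean_le (fun w => `|X w|) M.
  apply: (@ae_mean_le _ (cst M)) => //; last exact/mean_eq_le/mean_eq_cst.
  by apply: measurableT_comp.
by case/integrableP : iA => _; under eq_integral do rewrite /= normr_id.
Qed.

End mean.

Section image_law.
Context {R : realType} {d d'} {T : measurableType d} {T' : measurableType d'}.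
Variables (P : probability T R) (P' : probability T' R) (V : T -> T').
Hypotheses (mV : measurable_fun setT V)
  (lawV : forall B, measurable B -> pushforward P V B = P' B).

Lemma ge0_integral_law (f : T' -> \bar R) : measurable_fun setT f ->
  (forall x, 0 <= f x)%E -> (\int[P]_w f (V w) = \int[P']_x f x)%E.
Proof.
move=> mf f0; transitivity (\int[pushforward P V]_x f x)%E.
  by rewrite (ge0_integral_pushforward mV).
by apply: eq_measure_integral => A mA _; exact: lawV.
Qed.

Lemma mean_eq_law (X : T' -> R) r : mean_eq P' X r -> mean_eq P (X \o V) r.
Proof.
move=> [iX eX]; have /integrableP[mX fX] := iX.
have iXV : P.-integrable setT (EFin \o (X \o V)).
  apply/integrableP; split; first exact: measurableT_comp mX mV.
  rewrite -(@ge0_integral_law (fun x => `|(X x)%:E|)%E) in fX => //.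
  exact: measurableT_comp.
split => //; rewrite -eX.
transitivity (\int[pushforward P V]_x (X x)%:E)%E.
  by rewrite (integral_pushforward mV).
by apply: eq_measure_integral => A mA _; exact: lawV.
Qed.

Lemma law_mean_eq (X : T' -> R) r : measurable_fun setT X ->
  mean_eq P (X \o V) r -> mean_eq P' X r.
Proof.
move=> mX [iX eX]; have /integrableP[_ fX] := iX.
have iX' : P'.-integrable setT (EFin \o X).
  apply/integrableP; split; first exact/measurable_EFinP.
  rewrite -(@ge0_integral_law (fun x => `|(X x)%:E|)%E) //.
  by apply: measurableT_comp => //; exact/measurable_EFinP.
have [s hs] := integrable_mean iX'.
by rewrite (mean_eq_unique (conj iX eX) (mean_eq_law hs)).
Qed.

Lemma mean_le_law (X : T' -> R) r : mean_le P' X r -> mean_le P (X \o V) r.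
Proof.
move=> [iX eX]; have [s hs] := integrable_mean iX.
apply: (@mean_le_trans _ _ _ _ _ s); last exact/mean_eq_le/mean_eq_law.
by case: hs => _ hs; rewrite -lee_fin -hs.
Qed.

Lemma ae_law (Q : T' -> Prop) : {ae P', forall x, Q x} -> {ae P, forall w, Q (V w)}.
Proof.
move=> [A [mA A0 QA]]; exists (V @^-1` A); split.
- by rewrite -[X in measurable X]setTI; exact: mV.
- by have := lawV mA; rewrite /pushforward A0.
- by move=> w /= /QA.
Qed.

End image_law.

Section independence.
Context {R : realType} {d} {Omega : measurableType d} (Pr : probability Omega R).

(** The joint law of [(U, V)] agrees with the product of the marginals on rectangles, hence
    everywhere; Tonelli's theorem is then pulled back to [Omega], where the inner integral freezes
    [U w] and averages over a fresh outcome. *)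
Lemma independent_tonelli d1 d2 (T1 : measurableType d1) (T2 : measurableType d2)
    (U : Omega -> T1) (V : Omega -> T2) (phi : T1 * T2 -> \bar R) :
  measurable_fun setT U -> measurable_fun setT V ->
  (forall A B, measurable A -> measurable B ->
    Pr (U @^-1` A `&` V @^-1` B) = Pr (U @^-1` A) * Pr (V @^-1` B))%E ->
  measurable_fun setT phi -> (forall z, 0 <= phi z)%E ->
  (\int[Pr]_w phi (U w, V w) = \int[Pr]_w \int[Pr]_w' phi (U w, V w'))%E.
Proof.
move=> mU mV UV mphi phi0.
pose U' : {mfun Omega >-> T1} :=
  HB.pack_for {mfun Omega >-> T1} U (isMeasurableFun.Build _ _ _ _ U mU).
pose V' : {mfun Omega >-> T2} :=
  HB.pack_for {mfun Omega >-> T2} V (isMeasurableFun.Build _ _ _ _ V mV).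
pose W w := (U w, V w).
have mW : measurable_fun setT W by exact: measurable_fun_pair.
pose W' : {mfun Omega >-> (T1 * T2)%type} :=
  HB.pack_for {mfun Omega >-> (T1 * T2)%type} W (isMeasurableFun.Build _ _ _ _ W mW).
pose m1 : probability T1 R := distribution Pr U'.
pose m2 : probability T2 R := distribution Pr V'.
have mE X : measurable X -> (m1 \x m2)%E X = distribution Pr W' X.
  apply: product_measure_unique => A B mA mB.
  exact: UV.
transitivity (\int[distribution Pr W']_z phi z)%E.
  by rewrite ge0_integral_distribution.
transitivity (\int[m1 \x m2]_z phi z)%E.
  by apply: eq_measure_integral => A mA _; apply/esym/mE.
rewrite fubini_tonelli1 //.
have mF : measurable_fun setT (fubini_F m2 phi).
  exact: measurable_fun_fubini_tonelli_F.
rewrite ge0_integral_distribution //; last first.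
  by move=> x; apply: integral_ge0.
apply: eq_integral => w _; rewrite /= /fubini_F.
by rewrite ge0_integral_distribution //; exact: measurableT_comp.
Qed.

Definition independent_systems (G1 G2 : set (set Omega)) : Prop :=
  forall A B, G1 A -> G2 B -> Pr (A `&` B) = (Pr A * Pr B)%E.

Lemma independent_systemsC G1 G2 : independent_systems G1 G2 -> independent_systems G2 G1.
Proof. by move=> h A B GA GB; rewrite setIC h // muleC. Qed.

(** For fixed [B], the finite measures Pr(A & B) and Pr(A) Pr(B) of the argument [A] agree on the
    pi-system [G1], hence on the sigma-algebra it generates. *)
Lemma independent_sigma_l (G1 G2 : set (set Omega)) :
  G1 `<=` measurable -> setI_closed G1 -> G1 setT -> G2 `<=` measurable ->
  independent_systems G1 G2 -> independent_systems <<s G1>> G2.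
Proof.
move=> mG1 IG1 TG1 mG2 G12 A B sA GB.
have PB0 : (0 <= fine (Pr B))%R by rewrite fine_ge0.
have PBf : Pr B = (fine (Pr B))%:E.
  by rewrite fineK // fin_num_measure //; exact: mG2.
have h E : <<s G1>> E -> mrestr Pr (mG2 _ GB) E = mscale (NngNum PB0) Pr E.
  apply: (@g_sigma_algebra_measure_unique _ R Omega G1 mG1 (fun _ => setT)) => //.
  - by rewrite bigcup_const.
  - by move=> X GX; rewrite /= /mrestr /mscale /= G12 // -PBf muleC.
  - by move=> _; rewrite /= /mrestr setTI PBf ltry.
by have := h _ sA; rewrite /mrestr /mscale /= -PBf muleC.
Qed.

Lemma independent_sigma (G1 G2 : set (set Omega)) :
  G1 `<=` measurable -> setI_closed G1 -> G1 setT ->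
  G2 `<=` measurable -> setI_closed G2 -> G2 setT ->
  independent_systems G1 G2 -> independent_systems <<s G1>> <<s G2>>.
Proof.
move=> m1 I1 T1 m2 I2 T2 G12; apply: independent_sigma_l => //.
  exact: (smallest_sub (@sigma_algebra_measurable _ Omega) m2).
apply: independent_systemsC; apply: independent_sigma_l => //.
exact: independent_systemsC.
Qed.

(** The two independent variables are both the identity of [Omega], seen with two generated
    sigma-algebras. A random quantity is then split by measurability alone, and the draws need not
    be packed into tuples. *)
Lemma sigma_tonelli (G1 G2 : set (set Omega))
    (phi : g_sigma_algebraType G1 * g_sigma_algebraType G2 -> \bar R) :
  G1 `<=` measurable -> setI_closed G1 -> G1 setT ->
  G2 `<=` measurable -> setI_closed G2 -> G2 setT ->
  independent_systems G1 G2 ->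
  measurable_fun setT phi -> (forall z, 0 <= phi z)%E ->
  (\int[Pr]_w phi (w, w) = \int[Pr]_w \int[Pr]_w' phi (w, w'))%E.
Proof.
move=> m1 I1 T1 m2 I2 T2 G12 mphi phi0.
have sub (G : set (set Omega)) : G `<=` measurable ->
    measurable_fun setT (fun w : Omega => w : g_sigma_algebraType G).
  move=> mG _ A mA; rewrite setTI.
  exact: (smallest_sub (@sigma_algebra_measurable _ Omega) mG).
apply: (@independent_tonelli _ _ (g_sigma_algebraType G1) (g_sigma_algebraType G2)
  (fun w => w) (fun w => w)) => //.
- exact: sub.
- exact: sub.
- by move=> A B mA mB; exact: (independent_sigma m1 I1 T1 m2 I2 T2 G12).
Qed.

Section product_system.
Context {I : finType} (G : I -> set (set Omega)).
Hypotheses (mG : forall i, G i `<=` measurable) (IG : forall i, setI_closed (G i))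
  (TG : forall i, G i setT).

(** The pi-system of cylinder events, which generates the sigma-algebra of the draws indexed by
    [J]. *)
Definition product_system (J : {set I}) : set (set Omega) :=
  [set S | exists A : I -> set Omega,
     (forall i, i \in J -> G i (A i)) /\ S = \bigcap_(i in [set` J]) A i].

Lemma product_system_measurable J : product_system J `<=` measurable.
Proof.
move=> _ [A [GA ->]]; apply: fin_bigcap_measurable => // i /= iJ.
by apply: mG; exact: GA.
Qed.

Lemma product_systemI J : setI_closed (product_system J).
Proof.
move=> _ _ [A [GA ->]] [B [GB ->]]; exists (fun i => A i `&` B i); split.
  by move=> i iJ; apply: IG; [exact: GA|exact: GB].
by rewrite bigcapI.
Qed.

Lemma product_systemT J : product_system J setT.
Proof.
exists (fun=> setT); split => //.
by apply/seteqP; split.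
Qed.

Lemma product_system_sub i (J : {set I}) : i \in J -> G i `<=` product_system J.
Proof.
move=> iJ A GA; exists (fun j => if j == i then A else setT); split.
  by move=> j jJ; case: eqP => [->|_].
apply/seteqP; split=> [w Aw j jJ|w /(_ i iJ)]; rewrite ?eqxx //.
by case: eqP.
Qed.

(** The two families are merged into a single family [C] on the disjoint union, where mutual
    independence gives one product that splits. *)
Lemma product_system_independent (J1 J2 : {set I}) :
  mutually_independent Pr G -> (forall i, i \in J1 -> i \notin J2) ->
  independent_systems (product_system J1) (product_system J2).
Proof.
move=> indep J12 _ _ [A [GA ->]] [B [GB ->]].
pose C i := if i \in J1 then A i else B i.
have CA i : i \in J1 -> C i = A i by rewrite /C => ->.
have CB i : i \in J2 -> C i = B i.
  by move=> iJ2; rewrite /C ifN //; apply/negP => /J12; rewrite iJ2.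
have CAE : \bigcap_(i in [set` J1]) A i = \bigcap_(i in [set` J1]) C i.
  by apply: eq_bigcapr => i iJ; rewrite CA.
have CBE : \bigcap_(i in [set` J2]) B i = \bigcap_(i in [set` J2]) C i.
  by apply: eq_bigcapr => i iJ; rewrite CB.
have GC1 i : i \in J1 -> G i (C i) by move=> iJ; rewrite CA //; exact: GA.
have GC2 i : i \in J2 -> G i (C i) by move=> iJ; rewrite CB //; exact: GB.
rewrite CAE CBE -bigcap_setU.
have -> : [set` J1] `|` [set` J2] = [set` J1 :|: J2].
  by apply/seteqP; split=> i /=; rewrite inE => /orP.
rewrite !indep //; last by move=> i; rewrite inE => /orP[/GC1|/GC2].
rewrite (eq_bigl [predU J1 & J2]) ?bigU //=.
  by rewrite fintype.disjoint_subset; apply/fintype.subsetP => i /J12; rewrite inE.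
by move=> i; rewrite !inE.
Qed.

End product_system.

End independence.

(** * Moments of the uniform direction *)

(** The natural numbers below the size of [p - q] are distinct, which makes too many roots for a
    nonzero polynomial. *)
Lemma poly_eq_horner (R : numDomainType) (p q : {poly R}) :
  (forall b, p.[b] = q.[b]) -> p = q.
Proof.
move=> pq; apply/eqP; rewrite -subr_eq0; apply/negPn/negP => npq.
set l := [seq k%:R : R | k <- iota 0 (size (p - q))].
have ul : uniq l.
  by rewrite map_inj_uniq ?iota_uniq // => i j /eqP; rewrite eqr_nat => /eqP.
have rl : all (root (p - q)) l.
  by apply/allP => b _; rewrite /root !hornerE pq subrr.
by have := max_poly_roots npq rl ul; rewrite size_map size_iota ltnn.
Qed.

Lemma coef_quadratic_exp (R : comRingType) (a b : R) k :
  [/\ ((1 + a *: 'X + b *: 'X^2) ^+ k)`_0 = 1,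
      ((1 + a *: 'X + b *: 'X^2) ^+ k)`_1 = a *+ k
    & ((1 + a *: 'X + b *: 'X^2) ^+ k)`_2 = b *+ k + a ^+ 2 *+ 'C(k, 2)].
Proof.
elim: k => [|k [ih0 ih1 ih2]].
  by rewrite expr0 !coef1 !mulr0n addr0.
rewrite exprS; split; rewrite !coefM !big_ord_recr big_ord0 /= add0r.
- by rewrite ih0 !coefE /= !mulr0 !addr0 mulr1.
- by rewrite ih0 ih1 !coefE /= !mulr0 !mulr1 !addr0 !add0r mul1r mulrSr.
- rewrite ih0 ih1 ih2 !coefE /= !mulr0 !mulr1 !addr0 !add0r mul1r.
  by rewrite binS bin1 mulrnDr mulrSr mulrnAr -expr2; ring.
Qed.

Section householder.
Context {R : realType} {n : nat}.

Lemma dotv_mulmx (x y : 'rV[R]_n) : x *m y^T = (dotv x y)%:M.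
Proof.
apply/rowP => j; rewrite ord1 !mxE eqxx mulr1n; apply: eq_bigr => i _.
by rewrite mxE.
Qed.

Definition reflection (v : 'rV[R]_n) : 'M[R]_n :=
  1%:M - (2 / dotv v v) *: (v^T *m v).

Lemma mul_reflection v (x : 'rV_n) :
  x *m reflection v = x - (2 / dotv v v * dotv x v) *: v.
Proof.
rewrite /reflection mulmxBr mulmx1 -scalemxAr mulmxA dotv_mulmx mul_scalar_mx.
by rewrite scalerA.
Qed.

Lemma reflection_orthogonal v : dotv v v != 0 ->
  reflection v *m (reflection v)^T = 1%:M.
Proof.
move=> v0; have -> : (reflection v)^T = reflection v.
  by rewrite /reflection linearB /= trmx1 linearZ /= trmx_mul trmxK.
apply/row_matrixP => j; rewrite !rowE mulmxA !mul_reflection mulmx1.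
rewrite dotvBl dotvZl -addrA -opprD -scalerDl.
rewrite (_ : _ * _ + _ * _ = 0) ?scale0r ?subr0 //.
by move: v0; move: (dotv v v) => B; move: (dotv _ v) => A B0; field.
Qed.

(** The Householder reflection along u - e_i exchanges the unit vectors u and e_i, and it is
    symmetric. When the two coincide the reflection is undefined and the identity serves. *)
Lemma reflection_to_coordinate (u : 'rV[R]_n) (i : 'I_n) : dotv u u = 1 ->
  exists Q : 'M[R]_n, Q *m Q^T = 1%:M /\ forall x : 'rV_n, (x *m Q) 0 i = dotv x u.
Proof.
move=> u1.
have [v0|v0] := eqVneq (dotv (u - delta_mx 0 i) (u - delta_mx 0 i)) 0.
  have ui : u = delta_mx 0 i by apply/eqP; rewrite -subr_eq0; apply/eqP/dotvv_eq0.
  exists 1%:M; split; first by rewrite trmx1 mulmx1.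
  by move=> x; rewrite mulmx1 ui dotv_delta.
exists (reflection (u - delta_mx 0 i)); split; first exact: reflection_orthogonal.
move=> x; rewrite mul_reflection 3!mxE.
have vi : (u - delta_mx 0 i) 0 i = u 0 i - 1 by rewrite !mxE !eqxx.
have vv : dotv (u - delta_mx 0 i) (u - delta_mx 0 i) = 2 - 2 * u 0 i.
  rewrite dotvBl !dotvBr u1 (dotvC (delta_mx 0 i)) !dotv_delta mxE !eqxx.
  by rewrite /=; move: (u 0 i) => c; ring.
have xv : dotv x (u - delta_mx 0 i) = dotv x u - x 0 i by rewrite dotvBr dotv_delta.
rewrite vv in v0; rewrite vi vv xv.
by move: (x 0 i) (dotv x u) (u 0 i) v0 => a b c c0; field.
Qed.

End householder.

Section measurable_euclidean.
Context {R : realType} {n : nat} {d} {T : measurableType d}.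
Implicit Types (h g : T -> 'rV[R]_n).

Lemma measurable_coord_comp h i :
  measurable_fun setT (h : T -> rVborel R n) -> measurable_fun setT (fun w => h w 0 i).
Proof. by move=> mh; exact: measurableT_comp (measurable_coord i) mh. Qed.

Lemma measurable_dotv h g :
  measurable_fun setT (h : T -> rVborel R n) ->
  measurable_fun setT (g : T -> rVborel R n) ->
  measurable_fun setT (fun w => dotv (h w) (g w)).
Proof.
move=> mh mg; apply: measurable_sum => i.
by apply: measurable_funM; exact: measurable_coord_comp.
Qed.

End measurable_euclidean.

Section sphere_moments.
Context {R : realType} {n : nat} {d} {Omega : measurableType d}.
Variables (Pr : probability Omega R) (e : Omega -> 'rV[R]_n).
Hypothesis me : measurable_fun setT (e : Omega -> rVborel R n).
Hypothesis law_e : uniform_on_sphere (pushforward Pr (e : Omega -> rVborel R n)).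
Implicit Types (s a b : 'rV[R]_n) (i j : 'I_n).

Lemma measurable_dotvr d' (T : measurableType d') (h : T -> 'rV[R]_n) s :
  measurable_fun setT (h : T -> rVborel R n) ->
  measurable_fun setT (fun w => dotv s (h w)).
Proof. by move=> mh; apply: measurable_dotv => //; exact: measurable_cst. Qed.

Lemma ae_unit : {ae Pr, forall w, dotv (e w) (e w) = 1}.
Proof.
have m1 : measurable [set x : rVborel R n | norm2 (x : 'rV[R]_n) = 1].
  have mN : measurable_fun setT (fun x : rVborel R n => dotv (x : 'rV[R]_n) x).
    by apply: measurable_dotv; exact: measurable_id.
  rewrite (_ : [set x | _] = (fun x : rVborel R n => dotv (x : 'rV[R]_n) x) @^-1` [set 1]).
    by rewrite -[X in measurable X]setTI; exact: mN.
  apply/seteqP; split => x /=; first by rewrite -sqr_norm2 => ->; rewrite expr1n.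
  rewrite -sqr_norm2 => /eqP; rewrite sqrf_eq1 => /orP[/eqP //|/eqP h].
  by have := norm2_ge0 (x : 'rV[R]_n); rewrite h; lra.
have mE : measurable (e @^-1` [set x | norm2 x = 1]).
  by rewrite -[X in measurable X]setTI; exact: me.
exists (~` (e @^-1` [set x | norm2 x = 1])); split.
- exact: measurableC.
- by rewrite probability_setC // [X in (1 - X)%E](_ : _ = 1%E) ?subee //; case: law_e.
- by move=> w /= h h1; apply: h; rewrite -sqr_norm2 h1 expr1n.
Qed.

Lemma mean_eq_rotate (Q : 'M[R]_n) (X : 'rV[R]_n -> R) r :
  Q *m Q^T = 1%:M -> measurable_fun setT (X : rVborel R n -> R) ->
  mean_eq Pr (X \o e) r -> mean_eq Pr (fun w => X (e w *m Q)) r.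
Proof.
move=> QQ mX hX; case: law_e => _ inv.
pose e' : {mfun Omega >-> rVborel R n} :=
  HB.pack_for {mfun Omega >-> rVborel R n} (e : Omega -> rVborel R n)
   (isMeasurableFun.Build _ _ _ _ (e : Omega -> rVborel R n) me).
have h : mean_eq (distribution Pr e') X r by apply: (law_mean_eq me).
pose V w : rVborel R n := e w *m Q.
have mV : measurable_fun setT V.
  apply: measurable_rV => i; rewrite (_ : (fun w => _) = (fun w => \sum_j e w 0 j * Q j i)).
    apply: measurable_sum => j; apply: measurable_funM; last exact: measurable_cst.
    exact: measurable_coord_comp.
  by apply/funext => w; rewrite mxE.
apply: (@mean_eq_law _ _ _ _ _ Pr (distribution Pr e') V mV _ X r h) => B mB.
by have := inv Q B QQ mB; rewrite /pushforward.
Qed.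

Lemma ae_coord_le1 : {ae Pr, forall w, forall i, `|e w 0 i| <= 1}.
Proof.
apply: filterS ae_unit => w h i; rewrite -(@ler_pXn2r _ 2) ?nnegrE //.
rewrite real_normK ?num_real // expr1n -h /dotv (bigD1 i) //= -expr2 lerDl.
by apply: sumr_ge0 => j _; rewrite -expr2 sqr_ge0.
Qed.

Lemma ae_dotv_le s : {ae Pr, forall w, `|dotv s (e w)| <= norm2 s}.
Proof.
apply: filterS ae_unit => w h; rewrite -(@ler_pXn2r _ 2) ?nnegrE ?norm2_ge0 //.
rewrite real_normK ?num_real // sqr_norm2.
by have := dotv_cauchy_schwarz s (e w); rewrite h mulr1.
Qed.

Variable i0 : 'I_n.

Definition moment k : R := fine (\int[Pr]_w (e w 0 i0 ^+ (2 * k))%:E)%E.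

Lemma mean_moment k : mean_eq Pr (fun w => e w 0 i0 ^+ (2 * k)) (moment k).
Proof.
have mX : measurable_fun setT (fun w => e w 0 i0 ^+ (2 * k)).
  by apply: measurable_funX; exact: measurable_coord_comp.
have [r hr] : exists r, mean_eq Pr (fun w => e w 0 i0 ^+ (2 * k)) r.
  apply: (bounded_mean (M := 1) mX).
  by apply: filterS ae_coord_le1 => w h; rewrite normrX exprn_ile1.
by rewrite /moment; case: (hr) => _ ->.
Qed.

(** Rotation invariance sends the direction of [s] to the coordinate [i0], and homogeneity restores
    the length. The zero vector cannot be normalised; there the case [k = 0] relies on 0^0 = 1. *)
Lemma mean_dotv_exp s k :
  mean_eq Pr (fun w => dotv s (e w) ^+ (2 * k)) (dotv s s ^+ k * moment k).
Proof.
have mD v : measurable_fun setT (fun x : rVborel R n => dotv v (x : 'rV[R]_n) ^+ (2 * k)).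
  by apply: measurable_funX; apply: measurable_dotvr; exact: measurable_id.
have unit u : dotv u u = 1 ->
    mean_eq Pr (fun w => dotv u (e w) ^+ (2 * k)) (moment k).
  move=> u1; have [Q [QQ Qu]] := reflection_to_coordinate i0 u1.
  have mX : measurable_fun setT (fun x : rVborel R n => (x : 'rV[R]_n) 0 i0 ^+ (2 * k)).
    by apply: measurable_funX; exact: measurable_coord.
  have := mean_eq_rotate QQ mX (mean_moment k).
  by apply: mean_eq_eq => w; rewrite Qu dotvC.
have [s0|s0] := eqVneq (dotv s s) 0.
  rewrite (dotvv_eq0 s0) (dot0v 0).
  case: k mD unit => [|k] mD unit.
    by rewrite expr0 mul1r; apply: mean_eq_eq (mean_moment 0) => w; rewrite muln0 !expr0.
  rewrite expr0n mul0r; apply: mean_eq_eq (mean_eq_cst Pr 0) => w.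
  by rewrite dot0v expr0n muln_eq0.
have n0 : norm2 s != 0 by rewrite -sqrf_eq0 sqr_norm2.
have u1 : dotv ((norm2 s)^-1 *: s) ((norm2 s)^-1 *: s) = 1.
  by rewrite dotvZl dotvZr -sqr_norm2; field.
apply: mean_eq_eq (mean_eqZ (dotv s s ^+ k) (unit _ u1)) => w.
by rewrite dotvZl exprMn -sqr_norm2 -exprM mulrA -exprMn mulfV // expr1n mul1r.
Qed.

Lemma mean_bounded_exp s i k l : exists r,
  mean_eq Pr (fun w => e w 0 i ^+ k * dotv s (e w) ^+ l) r.
Proof.
apply: (bounded_mean (M := norm2 s ^+ l)).
  apply: measurable_funM; apply: measurable_funX; first exact: measurable_coord_comp.
  exact: measurable_dotvr.
apply: filterS2 ae_coord_le1 (ae_dotv_le s) => w h1 h2.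
rewrite normrM !normrX -[leRHS]mul1r ler_pM ?exprn_ge0 ?exprn_ile1 //.
by rewrite lerXn2r ?nnegrE ?norm2_ge0.
Qed.

(* The coefficient of b^2 in E (e_i + b <s, e>)^(2k) = |delta_i + b s|^(2k) E e_i^(2k). *)
Lemma mean_coord_exp_dotv2 s i k :
  mean_eq Pr (fun w => e w 0 i ^+ (2 * k) * dotv s (e w) ^+ 2)
    (moment k.+1 * (dotv s s + 2 * k%:R * s 0 i ^+ 2) / (2 * k%:R + 1)).
Proof.
pose m l := projT1 (cid (mean_bounded_exp s i (2 * k.+1 - l) l)).
have hm l : mean_eq Pr (fun w => e w 0 i ^+ (2 * k.+1 - l) * dotv s (e w) ^+ l) (m l).
  by rewrite /m; case: cid.
(* [p] collects the means of the binomial expansion in powers of [b], and [q] is the closed form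
   given by [mean_dotv_exp]. They agree at every real [b], hence coefficientwise. *)
pose p := \poly_(l < (2 * k.+1).+1) (m l *+ 'C(2 * k.+1, l)).
pose q := (1 + (2 * s 0 i) *: 'X + (dotv s s) *: 'X^2) ^+ k.+1 * (moment k.+1)%:P.
have pq : p = q.
  apply: poly_eq_horner => b; rewrite horner_poly.
  have h1 := mean_dotv_exp (delta_mx 0 i + b *: s) k.+1.
  have -> : q.[b] = dotv (delta_mx 0 i + b *: s) (delta_mx 0 i + b *: s) ^+ k.+1 * moment k.+1.
    rewrite !hornerE; congr (_ ^+ _ * _).
    rewrite dotvDl !dotvDr !dotvZl !dotvZr (dotvC (delta_mx 0 i) s) !dotv_delta mxE !eqxx /=.
    by move: (dotv s s) (s 0 i) => A B; ring.
  apply: mean_eq_unique h1.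
  apply: (@mean_eq_eq _ _ _ _ (fun w => \sum_(l < (2 * k.+1).+1)
     (b ^+ l *+ 'C(2 * k.+1, l)) * (e w 0 i ^+ (2 * k.+1 - l) * dotv s (e w) ^+ l))).
    move=> w; rewrite dotvDl (dotvC (delta_mx 0 i)) dotv_delta dotvZl exprDn; apply: eq_bigr => l _.
    by rewrite exprMn mulrnAl; congr (_ *+ _); ring.
  have -> : \sum_(l < (2 * k.+1).+1) m l *+ 'C(2 * k.+1, l) * b ^+ l =
    \sum_(l < (2 * k.+1).+1) (b ^+ l *+ 'C(2 * k.+1, l)) * m l.
    by apply: eq_bigr => l _; rewrite mulrC mulrnAr mulrnAl.
  by apply: mean_eq_sum => l; apply: mean_eqZ.
have := congr1 (fun u : {poly R} => u`_2) pq; rewrite coef_poly coefMC.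
have [_ _ ->] := coef_quadratic_exp (2 * s 0 i) (dotv s s) k.+1.
rewrite ifT; last by lia.
move=> E; have := hm 2%N; have -> : (2 * k.+1 - 2 = 2 * k)%N by lia.
have binE : 'C(2 * k.+1, 2)%:R = (k%:R + 1) * (2 * k%:R + 1) :> R.
  rewrite bin2 (_ : (2 * k.+1 * (2 * k.+1).-1 = (k.+1 * (2 * k + 1)).*2)%N) ?doubleK; last first.
    by rewrite -mul2n -mulnA; do 2 congr (_ * _)%N; lia.
  by rewrite natrM natrD natrM mulrS addrC.
have binE2 : 'C(k.+1, 2)%:R * 2 = (k%:R + 1) * k%:R :> R.
  rewrite -natrM bin2 muln2 halfK /= oddM /= andNb subn0.
  by rewrite natrM mulrS addrC.
have -> // : m 2%N = moment k.+1 * (dotv s s + 2 * k%:R * s 0 i ^+ 2) / (2 * k%:R + 1).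
move: E; rewrite -(mulr_natr (m 2%N)) binE -(mulr_natr (_ ^+ 2)) -(mulr_natr (dotv s s)).
rewrite exprMn (_ : 2 ^+ 2 * _ * _ = 2 * s 0 i ^+ 2 * ('C(k.+1, 2)%:R * 2)); last by ring.
rewrite binE2 -[k.+1%:R]natr1 => E.
have k0 : 0 <= k%:R :> R by [].
have k1 : k%:R + 1 != 0 :> R by rewrite gt_eqF //; lra.
have k2 : 2 * k%:R + 1 != 0 :> R by rewrite gt_eqF //; lra.
apply: (mulIf k2); apply: (mulIf k1); rewrite divfK // -mulrA [_ * (k%:R + 1)]mulrC E.
by move: (moment _) (dotv _ _) (s 0 i) (k%:R) => *; ring.
Qed.

Lemma moment_ge0 k : 0 <= moment k.
Proof.
apply: mean_le_ge0 (mean_eq_le (mean_moment k)) => w.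
by rewrite exprM exprn_ge0 // sqr_ge0.
Qed.

Lemma moment0 : moment 0 = 1.
Proof.
apply: mean_eq_unique (mean_moment 0) _.
by apply: mean_eq_eq (mean_eq_cst Pr 1) => w; rewrite muln0 expr0.
Qed.

(** [mean_coord_exp_dotv2] is summed over the coordinate vectors: the squared coordinates of the
    direction add up to 1 almost surely, and 1 + 2 k [j = i0] adds up to n + 2 k. The recursion
    gives all even moments without a density on the sphere. *)
Lemma momentS k : moment k.+1 * (n%:R + 2 * k%:R) = (2 * k%:R + 1) * moment k.
Proof.
have k0 : 0 <= k%:R :> R by [].
have k2 : 2 * k%:R + 1 != 0 :> R by rewrite gt_eqF //; lra.
have := mean_eq_sum (index_enum 'I_n) (fun j => mean_coord_exp_dotv2 (delta_mx 0 j) i0 k).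
set S := \sum_(j <- _) _ => hS.
have SE : S = moment k.+1 * (n%:R + 2 * k%:R) / (2 * k%:R + 1).
  rewrite /S -mulr_suml -mulr_sumr big_split /=; congr (_ * (_ + _) / _).
    rewrite (eq_bigr (fun=> 1)) ?sumr_const ?card_ord // => j _.
    by rewrite dotv_delta mxE !eqxx.
  rewrite -mulr_sumr (bigD1 i0) //= big1 => [|j ji].
    by rewrite mxE !eqxx expr1n addr0 mulr1.
  by rewrite mxE eqxx eq_sym (negbTE ji) expr0n.
have : S = moment k.
  apply: (mean_eq_unique hS); apply: mean_eq_ae (mean_moment k).
    exact: mean_eq_measurable hS.
  apply: filterS ae_unit => w h; rewrite -mulr_sumr -[RHS]mulr1 -h; congr (_ * _).
  by apply: eq_bigr => j _; rewrite dotvC dotv_delta expr2.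
by rewrite SE => <-; rewrite [RHS]mulrC divfK.
Qed.

Hypothesis n0 : (0 < n)%N.

Lemma moment1 : moment 1 = n%:R^-1.
Proof.
have n0' : n%:R != 0 :> R by rewrite pnatr_eq0 -lt0n.
apply: (mulIf n0'); rewrite mulVf //.
by have := momentS 0; rewrite mulr0 addr0 add0r mul1r moment0.
Qed.

Lemma momentS_le k : moment k.+1 <= (2 * k%:R + 1) / n%:R * moment k.
Proof.
have n0' : 0 < n%:R :> R by rewrite ltr0n.
rewrite mulrAC ler_pdivlMr // -momentS ler_wpM2l ?moment_ge0 //.
by rewrite lerDl mulr_ge0.
Qed.

Lemma moment_le k r : (k <= r)%N -> moment k <= (2 * r%:R / n%:R) ^+ k.
Proof.
have n0' : 0 < n%:R :> R by rewrite ltr0n.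
elim: k => [|k ih] kr; first by rewrite moment0 expr0.
apply: (le_trans (momentS_le k)); rewrite exprS.
apply: ler_pM; rewrite ?moment_ge0 ?ih // ?(ltnW kr) //.
rewrite ler_pM2r ?invr_gt0 // -natrM natr1 -natrM ler_nat; lia.
Qed.

Lemma mean_dotv2 s : mean_eq Pr (fun w => dotv s (e w) ^+ 2) (dotv s s / n%:R).
Proof. by have := mean_dotv_exp s 1; rewrite expr1 moment1. Qed.

(** Polarisation of [mean_dotv2]. *)
Lemma mean_dotvM a b :
  mean_eq Pr (fun w => dotv a (e w) * dotv b (e w)) (dotv a b / n%:R).
Proof.
have h := mean_eqD (mean_eqZ 4^-1 (mean_dotv2 (a + b)))
                   (mean_eqZ (- 4^-1) (mean_dotv2 (a - b))).
have -> : dotv a b / n%:R = 4^-1 * (dotv (a + b) (a + b) / n%:R)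
     + - 4^-1 * (dotv (a - b) (a - b) / n%:R).
  rewrite !dotvDl !dotvDr !dotvNl !dotvNr (dotvC b a).
  by move: (dotv a b) (dotv a a) (dotv b b) (n%:R^-1) => A B C D; field.
apply: mean_eq_eq h => w; rewrite !dotvDl dotvNl.
by move: (dotv a _) (dotv b _) => A B; field.
Qed.

End sphere_moments.

Section dual_norm_moments.
Context {R : realType} {n : nat} (p : nat).
Hypotheses (n8 : (8 <= n)%N) (p12 : p = 1%N \/ p = 2%N).

Lemma rho1 : rho 1 n = (16 * ln n%:R - 8) / n%:R :> R.
Proof. by rewrite /rho /qexp hoelder_conjugate1 powR_inv1. Qed.

Lemma rho2 : rho 2 n = 1 :> R.
Proof.
rewrite /rho /qexp hoelder_conjugate2 divff // subrr powRr0 mulr1.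
rewrite (_ : 2 - 1 = 1 :> R); last by ring.
apply/min_idPl; have := ln_ge32 (R := R) n8; lra.
Qed.

Lemma rho_gt0 : 0 < rho p n :> R.
Proof.
case: p12 => ->; last by rewrite rho2.
rewrite rho1 divr_gt0 ?ltr0n ?(leq_trans _ n8) //.
by have := ln_ge32 (R := R) n8; lra.
Qed.

(** [r] is the least exponent with n <= 2^r, so 4^r >= 8 n as r >= 3. The threshold [c] is four
    times the ratio 2 r / n that controls the moments in [moment_le]; the resulting decay 4^(-r)
    absorbs the n terms of the sum in [dual_weight]. *)
Let r := up_log 2 n.
Let c : R := 8 * r%:R / n%:R.

(* For p = 1, a bound of the form x <= c + x^r / c^(r-1) applied to
   x = |e|_oo^2, with r about log2 n; the maximum is then bounded by a sum. *)
Definition dual_weight (e : 'rV[R]_n) : R :=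
  if p == 1%N then c + (c ^+ r.-1)^-1 * \sum_i e 0 i ^+ (2 * r) else dotv e e.

Let n0 : 0 < n%:R :> R. Proof. by rewrite ltr0n (leq_trans _ n8). Qed.

Let r3 : (3 <= r)%N.
Proof.
have [_ h] := andP (up_log_bounds (isT : (1 < 2)%N) (leq_trans (isT : (1 < 8)%N) n8)).
rewrite -(ltn_exp2l 2 r (isT : (1 < 2)%N)).
by apply: leq_trans h; apply: leq_trans n8.
Qed.

Let c0 : 0 < c.
Proof. by rewrite /c divr_gt0 // mulr_gt0 // ltr0n (leq_trans _ r3). Qed.

Lemma dual_weight_ge0 e : 0 <= dual_weight e.
Proof.
rewrite /dual_weight; case: ifP => _; last exact: dotvv_ge0.
rewrite addr_ge0 ?(ltW c0) // mulr_ge0 ?invr_ge0 ?exprn_ge0 ?(ltW c0) //.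
by apply: sumr_ge0 => i _; rewrite exprM exprn_ge0 // sqr_ge0.
Qed.

Lemma sqr_dual_norm_weight e : sqr_dual_norm p e <= dual_weight e.
Proof.
rewrite /sqr_dual_norm /dual_weight; case: ifP => // _.
set x := `|e| ^+ 2; have x0 : 0 <= x by rewrite sqr_ge0.
have cr0 : 0 < c ^+ r.-1 by rewrite exprn_gt0.
have xS : x ^+ r <= \sum_i e 0 i ^+ (2 * r).
  have pos i : 0 <= e 0 i ^+ (2 * r) by rewrite exprM exprn_ge0 // sqr_ge0.
  rewrite /x -exprM; have [->|/mx_norm_neq0 [[i j] /= ij]] := eqVneq `|e| 0.
    by rewrite expr0n muln_eq0 /= gtn_eqF ?(leq_trans _ r3) // sumr_ge0.
  rewrite [`|e|]ij ord1 (bigD1 j) //= exprM real_normK ?num_real // -exprM lerDl.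
  by apply: sumr_ge0.
apply: (@le_trans _ _ (c + (c ^+ r.-1)^-1 * x ^+ r)); last first.
  by rewrite lerD2l ler_wpM2l // invr_ge0 ltW.
have [xc|cx] := leP x c.
  by rewrite (le_trans xc) // lerDl mulr_ge0 ?exprn_ge0 // invr_ge0 ltW.
apply: (@le_trans _ _ ((c ^+ r.-1)^-1 * x ^+ r)); last by rewrite lerDr ltW.
rewrite mulrC ler_pdivlMr // -[X in x ^+ X](@prednK r) ?(leq_trans _ r3) // exprS.
by rewrite ler_wpM2l // lerXn2r ?nnegrE ?(ltW c0) // ltW.
Qed.

Let r_le : r%:R <= 2 * ln n%:R + 1 :> R.
Proof.
have [h _] := andP (up_log_bounds (isT : (1 < 2)%N) (leq_trans (isT : (1 < 8)%N) n8)).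
have ln2 : 2^-1 <= ln (2 : R).
  have h2 : ln (2^-1 : R) <= - 2^-1.
    rewrite (_ : ln _ = ln (1 + - 2^-1)); first by apply: le_ln1Dx; lra.
    by congr (ln _); field.
  by rewrite lnV ?posrE // in h2; lra.
have : ln ((2 : R) ^+ r.-1) <= ln n%:R.
  by rewrite ler_ln ?posrE ?exprn_gt0 // -natrX ler_nat ltnW.
rewrite lnXn // -[_ *+ r.-1]mulr_natl => h3.
have r1 : r%:R = r.-1%:R + 1 :> R by rewrite natr1 prednK // (leq_trans _ r3).
rewrite r1 lerD2r.
have : r.-1%:R * 2^-1 <= r.-1%:R * ln 2 :> R by rewrite ler_wpM2l.
lra.
Qed.

Let r_le_n : (r <= n)%N.
Proof.
have [h _] := andP (up_log_bounds (isT : (1 < 2)%N) (leq_trans (isT : (1 < 8)%N) n8)).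
apply: leq_trans h; rewrite -[X in (X <= _)%N](@prednK r) ?(leq_trans _ r3) //.
by rewrite ltnS ltnW // ltn_expl.
Qed.

Section random_direction.
Context {d} {Omega : measurableType d}.
Variables (Pr : probability Omega R) (e : Omega -> 'rV[R]_n).
Hypothesis me : measurable_fun setT (e : Omega -> rVborel R n).
Hypothesis law_e : uniform_on_sphere (pushforward Pr (e : Omega -> rVborel R n)).
Implicit Types (s : 'rV[R]_n).

Let i0 : 'I_n := Ordinal (leq_trans (isT : (0 < 8)%N) n8).

Lemma measurable_dual_weight : measurable_fun setT (fun w => dual_weight (e w)).
Proof.
rewrite /dual_weight; case: (p == 1%N); last exact: measurable_dotv.
apply: measurable_funD; first exact: measurable_cst.
apply: measurable_funM; first exact: measurable_cst.
by apply: measurable_sum => i; apply: measurable_funX; exact: measurable_coord_comp.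
Qed.

(** For [p = 1] the weight is polynomial in the direction, so its mean against the squared inner
    product is exact by [mean_coord_exp_dotv2]. For [p = 2] the weight is 1 almost surely and the
    factor 6 is slack. *)
Lemma mean_dual_weight_dotv2 s :
  mean_le Pr (fun w => dotv s (e w) ^+ 2 * dual_weight (e w))
    (6 * rho p n / n%:R * dotv s s).
Proof.
have ss0 := dotvv_ge0 s.
have n8R : 8 <= n%:R :> R by rewrite ler_nat.
have mX : measurable_fun setT (fun w => dotv s (e w) ^+ 2 * dual_weight (e w)).
  apply: measurable_funM; last exact: measurable_dual_weight.
  by apply: measurable_funX; exact: measurable_dotvr.
case: p12 => p_; last first.
  apply: (@mean_le_trans _ _ _ _ _ (dotv s s / n%:R)).
    rewrite p_ rho2 mulr1 [leRHS]mulrAC ler_wpM2r ?invr_ge0 ?(ltW n0) //.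
    by rewrite ler_peMl // ler1n.
  apply: (ae_mean_le mX _ _ (mean_eq_le (mean_dotv2 me law_e i0 (leq_trans (isT : (0 < 8)%N) n8) s))).
    by move=> w; rewrite mulr_ge0 ?sqr_ge0 ?dual_weight_ge0.
  apply: filterS (ae_unit me law_e) => w h.
  by rewrite /dual_weight p_ /= h mulr1.
have hm := mean_eqD
  (mean_eqZ c (mean_dotv2 me law_e i0 (leq_trans (isT : (0 < 8)%N) n8) s))
  (mean_eqZ (c ^+ r.-1)^-1 (mean_eq_sum (index_enum 'I_n)
     (fun i => mean_coord_exp_dotv2 me law_e i0 s i r))).
apply: mean_le_trans (mean_le_eq _ (mean_eq_le hm)); last first.
  move=> w; rewrite /dual_weight p_ eqxx -mulr_suml.
  by move: (dotv _ _) (\sum_i _) => A B; ring.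
have -> : \sum_(i < n) moment Pr e i0 r.+1 * (dotv s s + 2 * r%:R * s 0 i ^+ 2)
     / (2 * r%:R + 1) = (n%:R + 2 * r%:R) / (2 * r%:R + 1) * moment Pr e i0 r.+1 * dotv s s.
  rewrite -mulr_suml -mulr_sumr big_split /= sumr_const card_ord -mulr_sumr.
  rewrite (_ : \sum_(i < n) s 0 i ^+ 2 = dotv s s).
    rewrite -[dotv s s *+ n]mulr_natl.
    by move: (moment _ _ _ _) (dotv s s) (n%:R) ((2 * r%:R + 1)^-1) => A B C D; ring.
  by apply: eq_bigr => i _; rewrite expr2.
rewrite p_ rho1; set M := moment _ _ _ _.
have r0 : 0 < r%:R :> R by rewrite ltr0n (leq_trans _ r3).
pose x : R := 2 * r%:R / n%:R.
have x0 : 0 < x by rewrite divr_gt0 ?mulr_gt0.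
have cx : c = 4 * x by rewrite /c /x; move: (r%:R) (n%:R) n0 => A B B0; field; rewrite gt_eqF.
have hM : M <= (2 * r%:R + 1) / n%:R * x ^+ r.
  apply: (le_trans (momentS_le me law_e i0 (leq_trans (isT : (0 < 8)%N) n8) r)).
  rewrite ler_wpM2l ?divr_ge0 ?addr_ge0 ?mulr_ge0 ?(ltW n0) ?(ltW r0) //.
  exact: (moment_le me law_e i0 (leq_trans (isT : (0 < 8)%N) n8) (leqnn r)).
have xE : x = 2 * r%:R / n%:R by [].
clearbody x; have rn : r%:R <= n%:R :> R by rewrite ler_nat.
have four : 8 * n%:R <= 4 ^+ r :> R.
  rewrite (_ : 4 = 2 * 2 :> R) ?exprMn; last by ring.
  have [_ h] := andP (up_log_bounds (isT : (1 < 2)%N) (leq_trans (isT : (1 < 8)%N) n8)).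
  apply: ler_pM => //; last by rewrite -natrX ler_nat.
  have -> : 8 = 2 ^+ 3 :> R by rewrite -natrX.
  by rewrite ler_eXn2l // ltr1n.
have -> : (c ^+ r.-1)^-1 * ((n%:R + 2 * r%:R) / (2 * r%:R + 1) * M * dotv s s) =
   ((n%:R + 2 * r%:R) / (2 * r%:R + 1) * (M / c ^+ r.-1)) * dotv s s.
  by move: (dotv s s) (n%:R) (c ^+ _)^-1 ((2 * r%:R + 1)^-1) => A B C D; ring.
(* With c = 4 x, the quotient of x^r by c^(r - 1) is x / 4^(r - 1), and 4^(r - 1) >= 2 n leaves at
   most r / n^2. *)
have hA : M / c ^+ r.-1 <= (2 * r%:R + 1) / n%:R * (r%:R / n%:R ^+ 2).
  have cr0 : 0 < c ^+ r.-1 by rewrite exprn_gt0.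
  rewrite ler_pdivrMr // (le_trans hM) // -[leRHS]mulrA ler_wpM2l //.
  rewrite -[X in x ^+ X](@prednK r) ?(leq_trans _ r3) // exprS cx exprMn mulrA.
  rewrite ler_wpM2r ?exprn_ge0 ?(ltW x0) //.
  have -> : x = r%:R / n%:R ^+ 2 * (2 * n%:R).
    by rewrite xE; move: (r%:R) (n%:R) n0 => A B B0; field; rewrite gt_eqF.
  rewrite ler_wpM2l ?divr_ge0 ?exprn_ge0 ?(ltW n0) ?(ltW r0) //.
  move: four; rewrite -[X in 4 ^+ X](@prednK r) ?(leq_trans _ r3) // exprS.
  by move: (4 ^+ r.-1) (n%:R) => A B; lra.
have hB : (n%:R + 2 * r%:R) / (2 * r%:R + 1) * (M / c ^+ r.-1) <= 3 * r%:R / n%:R ^+ 2.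
  apply: (@le_trans _ _ ((n%:R + 2 * r%:R) / (2 * r%:R + 1)
      * ((2 * r%:R + 1) / n%:R * (r%:R / n%:R ^+ 2)))).
    by rewrite ler_wpM2l // divr_ge0 ?addr_ge0 ?mulr_ge0 ?(ltW n0) ?(ltW r0).
  have -> : (n%:R + 2 * r%:R) / (2 * r%:R + 1) * ((2 * r%:R + 1) / n%:R * (r%:R / n%:R ^+ 2))
     = (n%:R + 2 * r%:R) * (r%:R / n%:R ^+ 3) :> R.
    move: (r%:R) (n%:R) n0 r0 => A B B0 A0; field; rewrite !gt_eqF //; lra.
  have -> : 3 * r%:R / n%:R ^+ 2 = (3 * n%:R) * (r%:R / n%:R ^+ 3) :> R.
    by move: (r%:R) (n%:R) n0 => A B B0; field; rewrite gt_eqF.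
  rewrite ler_wpM2r ?divr_ge0 ?exprn_ge0 ?(ltW n0) ?(ltW r0) //.
  by move: (r%:R) (n%:R) rn => A B; lra.
rewrite [c * _]mulrCA [dotv s s * _]mulrC -mulrDl ler_wpM2r //.
apply: (le_trans (lerD (lexx _) hB)).
(* The total 11 r / n^2 is compared with 6 (16 ln n - 8) / n^2 by means of r <= 2 ln n + 1 and ln n
   >= 3 / 2. *)
have -> : c / n%:R + 3 * r%:R / n%:R ^+ 2 = 11 * r%:R / n%:R ^+ 2.
  by rewrite /c; move: (r%:R) (n%:R) n0 => A B B0; field; rewrite gt_eqF.
have -> : 6 * ((16 * ln n%:R - 8) / n%:R) / n%:R = (6 * (16 * ln n%:R - 8)) / n%:R ^+ 2 :> R.
  by move: (n%:R) n0 => B B0; field; rewrite gt_eqF.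
rewrite ler_wpM2r ?invr_ge0 ?exprn_ge0 ?(ltW n0) //.
have := ln_ge32 (R := R) n8; move: r_le; move: (r%:R) (ln _) => A B; lra.
Qed.

(** The previous bound, summed over the coordinate vectors: their squared inner products with a unit
    direction add up to 1. *)
Lemma mean_dual_weight : mean_le Pr (fun w => dual_weight (e w)) (6 * rho p n).
Proof.
have h := mean_le_sum (index_enum 'I_n) (fun j => mean_dual_weight_dotv2 (delta_mx 0 j)).
apply: (@mean_le_trans _ _ _ _ _ (\sum_(j < n) 6 * rho p n / n%:R
    * dotv (delta_mx 0 j) (delta_mx 0 j : 'rV[R]_n))).
  rewrite -mulr_sumr (eq_bigr (fun=> 1)) ?sumr_const ?card_ord.
    by rewrite divfK // gt_eqF.
  by move=> j _; rewrite dotv_delta mxE !eqxx.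
apply: (ae_mean_le measurable_dual_weight _ _ h).
  by move=> w; exact: dual_weight_ge0.
apply: filterS (ae_unit me law_e) => w h1; rewrite -mulr_suml.
rewrite (_ : \sum_(i < n) _ = 1) ?mul1r // -h1.
by apply: eq_bigr => j _; rewrite dotvC dotv_delta expr2.
Qed.

End random_direction.

End dual_norm_moments.

(** * The stochastic problem *)

Lemma is_derive_line_diff (R : realType) (n : nat) (h : 'rV[R]_n -> R)
    (x y v : 'rV[R]_n) (s : R) :
  is_gradient h (x + s *: y) v ->
  is_derive s 1 (fun t : R => h (x + t *: y)) (dotv v y).
Proof.
rewrite /is_gradient => hv; case: (hv) => hd hval.
have hD : is_derive (x + s *: y) y h (dotv v y).
  by apply: DeriveDef; [exact: diff_derivable | rewrite deriveE // hval].
have E : (fun t : R => t^-1 *: (((fun t : R => h (x + t *: y)) \o shift s) (t *: 1)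
                      - h (x + s *: y))) =
    (fun t : R => t^-1 *: ((h \o shift (x + s *: y)) (t *: y) - h (x + s *: y))).
  apply/funext => t /=; do 3 congr (_ _).
  by rewrite [t *: 1]mulr1 scalerDl addrCA addrA [t *: y + x]addrC.
case: hD => h1 h2; split; first by rewrite /derivable E.
by rewrite /derive E.
Qed.

Lemma is_derive_quadratic_error (R : realType) (phi : R -> R) (D C : R) :
  (forall t, `|phi t - phi 0 - t * D| <= C * t ^+ 2) -> is_derive (0 : R) 1 phi D.
Proof.
move=> h; have C0 : 0 <= C.
  by have := h 1; rewrite expr1n mulr1; apply: le_trans.
apply/is_derive1_caratheodory.
exists (fun t => if t == 0 then D else (phi t - phi 0) / t); split.
- move=> t; rewrite subr0; have [->|t0] := eqVneq t 0; first by rewrite subrr mulr0.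
  by rewrite divfK.
- apply/cvgrPdist_lt => e e0; rewrite eqxx.
  have d0 : 0 < e / (C + 1) by rewrite divr_gt0 // ltr_wpDl.
  near=> t; have [_|t0] := eqVneq t 0; first by rewrite subrr normr0.
  have te : `|t| < e / (C + 1) by near: t; exact: (@nbhs0_lt R R^o).
  have tp : 0 < `|t| by rewrite normr_gt0.
  rewrite distrC -(ltr_pM2r tp) -normrM mulrBl divfK // [D * t]mulrC.
  apply: (le_lt_trans (h t)); rewrite -real_normK ?num_real // expr2 mulrA ltr_pM2r //.
  rewrite ltr_pdivlMr in te; last by rewrite ltr_wpDl.
  apply: le_lt_trans te; rewrite mulrC ler_wpM2l // lerDl //.
- by rewrite eqxx.
Unshelve. all: by end_near. Qed.

Section stochastic.
Context {R : realType} {n : nat} {dX : measure_display} {X : measurableType dX}.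
Variables (P : probability X R) (F : 'rV[R]_n -> X -> R) (g : 'rV[R]_n -> X -> 'rV[R]_n)
    (L : X -> R) (f : 'rV[R]_n -> R) (L2 sigma : R).
Hypothesis sp : stochastic_problem P F g L f L2 sigma.
Implicit Types (x y v : 'rV[R]_n).

Let L2p : 0 < L2. Proof. by case: sp. Qed.

Lemma measurable_gradient_at x : measurable_fun setT (g x : X -> rVborel R n).
Proof.
have := measurable_gradient sp => mg.
have mp : measurable_fun setT (fun xi : X => ((x : rVborel R n), xi)).
  by apply: measurable_fun_pair; [exact: measurable_cst | exact: measurable_id].
exact: measurableT_comp mg mp.
Qed.

Lemma measurable_obj_at x : measurable_fun setT (F x).
Proof.
have := measurable_obj sp => mF.
have mp : measurable_fun setT (fun xi : X => ((x : rVborel R n), xi)).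
  by apply: measurable_fun_pair; [exact: measurable_cst | exact: measurable_id].
exact: measurableT_comp mF mp.
Qed.

(** Integrability is extracted from the finiteness of the expectation: if the positive or the
    negative part had infinite integral, their difference would be infinite under the conventions of
    the extended reals. *)
Lemma mean_obj x : mean_eq P (F x) (f x).
Proof.
have := expected_obj sp x; rewrite unlock => eF; split => //.
have mF : measurable_fun setT (EFin \o F x) by apply/measurable_EFinP; exact: measurable_obj_at.
rewrite integralE in eF.
apply/integrableP; split => //.
have ps : (\int[P]_w (EFin \o F x)^\+ w < +oo)%E.
  rewrite ltey; apply/eqP => e1; move: eF; rewrite e1.
  by case: (\int[P]_w _)%E.
have ns : (\int[P]_w (EFin \o F x)^\- w < +oo)%E.
  rewrite ltey; apply/eqP => e1; move: eF; rewrite e1.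
  by case: (\int[P]_w _)%E.
rewrite (_ : (fun w => _) = (fun w => (EFin \o F x)^\+ w + (EFin \o F x)^\- w)%E); last first.
  by have := fune_abse (EFin \o F x).
rewrite ge0_integralD //.
- exact: lte_add_pinfty.
- exact: measurable_funepos.
- exact: measurable_funeneg.
Qed.

Lemma mean_lip_sqr : mean_le P (fun xi => L xi ^+ 2) (L2 ^+ 2).
Proof.
apply: ge0_mean_le.
- by apply: measurable_funX; exact: measurable_lip sp.
- by move=> xi; exact: sqr_ge0.
have := lip_moment sp; rewrite unlock.
set I := (\int[P]_w _)%E => h.
have I0 : (0 <= I)%E by apply: integral_ge0 => w _; rewrite lee_fin sqr_ge0.
rewrite -(sqr_sqrte I0) expe2 expr2 EFinM.
by apply: lee_pmul; rewrite ?sqrte_ge0.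
Qed.

Definition lip xi := Num.max (L xi) 0.

Lemma lip_ge0 xi : 0 <= lip xi.
Proof. by rewrite le_max lexx orbT. Qed.

Lemma measurable_lip_pos : measurable_fun setT lip.
Proof. by apply: measurable_maxr; [exact: measurable_lip sp | exact: measurable_cst]. Qed.

Lemma lip_sqr_le xi : lip xi ^+ 2 <= L xi ^+ 2.
Proof.
by rewrite /lip; have [h|h] := leP (L xi) 0; rewrite ?expr0n ?sqr_ge0.
Qed.

Lemma mean_lip_pos_sqr : mean_le P (fun xi => lip xi ^+ 2) (L2 ^+ 2).
Proof.
apply: (ae_mean_le _ _ _ mean_lip_sqr).
- by apply: measurable_funX; exact: measurable_lip_pos.
- by move=> xi; exact: sqr_ge0.
- by apply: aeW => xi; exact: lip_sqr_le.
Qed.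

(** By the pointwise bound l <= L2 / 2 + l^2 / (2 L2), which replaces the Cauchy-Schwarz inequality
    for expectations. *)
Lemma mean_lip_pos : mean_le P lip L2.
Proof.
have h := mean_leD (mean_eq_le (mean_eq_cst P (L2 / 2)))
  (mean_leZ (_ : 0 <= (2 * L2)^-1) mean_lip_pos_sqr).
have L2i : 0 <= (2 * L2)^-1 by rewrite invr_ge0 mulr_ge0 // ltW.
apply: (ae_mean_le measurable_lip_pos lip_ge0 _ (mean_le_trans _ (h L2i))).
  apply: aeW => xi /=; rewrite -subr_ge0.
  rewrite (_ : _ - _ = (lip xi - L2) ^+ 2 / (2 * L2)).
    by rewrite divr_ge0 ?sqr_ge0 // mulr_ge0 // ltW.
  by field; rewrite gt_eqF.
by rewrite le_eqVlt; apply/orP; left; apply/eqP; field; rewrite gt_eqF.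
Qed.

(** [quadratic_upper_bound] along the segment, applied to [F] and to [- F]: the samples need not be
    convex, so both signs come from the Lipschitz gradient. *)
Lemma descent_sample : {ae P, forall xi, forall x y,
  `|F y xi - F x xi - dotv (g x xi) (y - x)| <= lip xi / 2 * dotv (y - x) (y - x)}.
Proof.
apply: filterS2 (gradientP sp) (gradient_lip sp) => xi hg hL x y.
set h := y - x.
have dphi (s : R) := is_derive_line_diff (hg (x + s *: h)).
have bound (s : R) : 0 <= s -> `|dotv (g (x + s *: h) xi) h - dotv (g x xi) h|
    <= lip xi * dotv h h * s.
  move=> s0; rewrite -dotvBl.
  have cs := dotv_cauchy_schwarz (g (x + s *: h) xi - g x xi) h.
  rewrite -(@ler_pXn2r _ 2) ?nnegrE ?mulr_ge0 ?lip_ge0 ?dotvv_ge0 //.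
  rewrite real_normK ?num_real // (le_trans cs) //.
  rewrite -!sqr_norm2 -exprMn; have hl := hL (x + s *: h) x.
  rewrite addrAC subrr add0r norm2Z ger0_norm // in hl.
  rewrite ler_pXn2r ?nnegrE ?mulr_ge0 ?norm2_ge0 ?lip_ge0 //.
  apply: (@le_trans _ _ (L xi * (s * norm2 h) * norm2 h)).
    by rewrite ler_wpM2r ?norm2_ge0.
  rewrite [leRHS](_ : _ = lip xi * (s * norm2 h) * norm2 h); last by ring.
  by rewrite !ler_wpM2r ?norm2_ge0 ?mulr_ge0 ?norm2_ge0 // le_max lexx.
have up := @quadratic_upper_bound R (fun s => F (x + s *: h) xi)
  (fun s => dotv (g (x + s *: h) xi) h) (lip xi * dotv h h) dphi.
have dphiN (s : R) : is_derive s 1 (fun s : R => - F (x + s *: h) xi)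
   (- dotv (g (x + s *: h) xi) h).
  by have := dphi s => d; apply: is_deriveN.
have dn := @quadratic_upper_bound R (fun s => - F (x + s *: h) xi)
  (fun s => - dotv (g (x + s *: h) xi) h) (lip xi * dotv h h) dphiN.
rewrite !scale0r !addr0 scale1r in up dn.
have yE : x + h = y by rewrite /h addrC subrK.
rewrite yE in up dn.
rewrite ler_norml; apply/andP; split.
  have : - F y xi <= - F x xi - dotv (g x xi) h + lip xi * dotv h h / 2.
    apply: dn => s /andP[s0 _]; have := bound s s0; rewrite ler_norml.
    by move: (dotv _ h) (dotv _ h) (_ * s) => A B C; lra.
  by move: (F _ _) (F _ _) (lip _) (dotv h h) (dotv _ h) => A B C D E; lra.
have : F y xi <= F x xi + dotv (g x xi) h + lip xi * dotv h h / 2.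
  apply: up => s /andP[s0 _]; have := bound s s0; rewrite ler_norml.
  by move: (dotv _ h) (dotv _ h) (_ * s) => A B C; lra.
by move: (F _ _) (F _ _) (lip _) (dotv h h) (dotv _ h) => A B C D E; lra.
Qed.

Lemma mean_gradient_deviation x :
  mean_le P (fun xi => dotv (g x xi - grad f x) (g x xi - grad f x)) (sigma ^+ 2).
Proof.
have mD : measurable_fun setT (fun xi => g x xi - grad f x : rVborel R n).
  apply: measurable_rV => i.
  rewrite (_ : (fun xi => _) = (fun xi => g x xi 0 i - grad f x 0 i)).
    apply: measurable_funB; last exact: measurable_cst.
    exact: measurable_coord_comp (measurable_gradient_at x).
  by apply/funext => xi; rewrite !mxE.
apply: ge0_mean_le.
- exact: measurable_dotv.
- by move=> xi; exact: dotvv_ge0.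
have := gradient_variance sp x; rewrite unlock.
by under eq_integral => xi _ do rewrite sqr_norm2.
Qed.

(** The variance bound is centred at [grad f x], whose link with the mean of [g] is not yet known;
    for integrability any fixed centre would do. *)
Lemma mean_dotv_gradient_ex v x : exists r, mean_eq P (fun xi => dotv v (g x xi)) r.
Proof.
suff i1 : P.-integrable setT (EFin \o (fun xi => dotv v (g x xi - grad f x) * 1)).
  have [r hr] := integrable_mean i1; exists (r + dotv v (grad f x)).
  apply: mean_eq_eq (mean_eqD hr (mean_eq_cst P (dotv v (grad f x)))) => xi /=.
  by rewrite mulr1 dotvBr subrK.
have mD : measurable_fun setT (fun xi => dotv v (g x xi - grad f x)).
  rewrite (_ : (fun xi => _) = (fun xi => dotv v (g x xi) - dotv v (grad f x))).
    apply: measurable_funB; last exact: measurable_cst.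
    apply: measurable_dotv; [exact: measurable_cst | exact: measurable_gradient_at].
  by apply/funext => xi; rewrite dotvBr.
apply: (@integrable_prod _ _ _ P _ (cst 1) (dotv v v * sigma ^+ 2) 1) => //.
- apply: (ae_mean_le _ _ _ (mean_leZ (dotvv_ge0 v) (mean_gradient_deviation x))).
  + exact: measurable_funX.
  + by move=> xi; exact: sqr_ge0.
  + by apply: aeW => xi; exact: dotv_cauchy_schwarz.
- apply: mean_le_eq (mean_eq_le (mean_eq_cst P 1)) => xi.
  by rewrite expr1n.
Qed.

Let Eg x : 'rV[R]_n :=
  \row_i projT1 (cid (mean_dotv_gradient_ex (delta_mx 0 i) x)).

Let mean_Eg v x : mean_eq P (fun xi => dotv v (g x xi)) (dotv v (Eg x)).
Proof.
have h i : mean_eq P (fun xi => v 0 i * dotv (delta_mx 0 i) (g x xi)) (v 0 i * Eg x 0 i).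
  by apply: mean_eqZ; rewrite mxE; case: cid.
apply: mean_eq_eq (mean_eq_sum (index_enum 'I_n) h) => xi.
by apply: eq_bigr => i _; rewrite dotvC dotv_delta.
Qed.

(** The mean of [descent_sample]. The quadratic error shows in [gradE] that the vector of means is
    the row of partial derivatives of [f], a differentiation under the expectation. *)
Let quad_Eg x y : `|f y - f x - dotv (Eg x) (y - x)| <= L2 / 2 * dotv (y - x) (y - x).
Proof.
have h1 := mean_eqD (mean_eqD (mean_obj y) (mean_eqZ (-1) (mean_obj x)))
   (mean_eqZ (-1) (mean_Eg (y - x) x)).
have D0 : 0 <= dotv (y - x) (y - x) / 2 by rewrite divr_ge0 ?dotvv_ge0.
have h2 := mean_leZ D0 mean_lip_pos.
have -> : L2 / 2 * dotv (y - x) (y - x) = dotv (y - x) (y - x) / 2 * L2.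
  by move: (dotv _ _) => D; field.
have -> : f y - f x - dotv (Eg x) (y - x) = f y + -1 * f x + -1 * dotv (y - x) (Eg x).
  by rewrite (dotvC (Eg x)) !mulN1r.
apply: (ae_mean_abs_le _ h1 h2); apply: filterS descent_sample => xi h.
rewrite !mulN1r (dotvC (y - x) (g x xi)); apply: (le_trans (h x y)).
by rewrite le_eqVlt; apply/orP; left; apply/eqP; move: (dotv _ _) => D; field.
Qed.

Lemma gradE x : grad f x = Eg x.
Proof.
apply/rowP => i; rewrite mxE derive_line.
have -> : Eg x 0 i = dotv (Eg x) (delta_mx 0 i) by rewrite dotv_delta.
apply: (@derive_val _ _ _ _ _ _ _ _).
apply: (@is_derive_quadratic_error _ _ _ (L2 / 2)) => t.
have := quad_Eg x (x + t *: delta_mx 0 i).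
rewrite [x + _ - x]addrAC subrr add0r scale0r addr0.
rewrite dotvZr dotvZl dotvZr [dotv (delta_mx 0 i) _]dotv_delta mxE !eqxx /= mulr1.
by rewrite -expr2.
Qed.

Lemma mean_dotv_gradient v x : mean_eq P (fun xi => dotv v (g x xi)) (dotv v (grad f x)).
Proof. by rewrite gradE. Qed.

Lemma descent x y : f y <= f x + dotv (grad f x) (y - x) + L2 / 2 * dotv (y - x) (y - x).
Proof.
have := quad_Eg x y; rewrite gradE ler_norml.
by move: (dotv _ _) (_ * dotv _ _) (f y) (f x) => A B C D; lra.
Qed.

(** Convexity on the segment from [x] to [y], together with the quadratic expansion at [x], gives
    the inequality up to an error linear in the parameter [t]. *)
Lemma gradient_inequality x y : f x + dotv (grad f x) (y - x) <= f y.
Proof.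
have cf t : 0 < t <= 1 -> dotv (Eg x) (y - x) - L2 / 2 * dotv (y - x) (y - x) * t
   <= f y - f x.
  move=> /andP[t0 t1].
  have h1 : f (t *: y + (1 - t) *: x) <= t * f y + (1 - t) * f x.
    exact: (@convex_obj _ _ _ _ _ _ _ _ _ _ _ sp (Itv01 (ltW t0) t1) y x (mem_set I) (mem_set I)).
  have E : t *: y + (1 - t) *: x = x + t *: (y - x).
    by rewrite scalerBl scale1r scalerBr addrCA.
  rewrite E in h1.
  have := quad_Eg x (x + t *: (y - x)); rewrite [x + _ - x]addrAC subrr add0r.
  rewrite dotvZr dotvZl dotvZr ler_norml => /andP[h2 _].
  rewrite -(ler_pM2l t0).
  move: h1 h2; move: (f (x + _)) (dotv (Eg x) _) (dotv _ _) => A B C; lra.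
rewrite gradE -lerBrDl leNgt; apply/negP => lt.
set B := dotv (Eg x) (y - x) in lt cf; set C := L2 / 2 * _ in cf.
have C0 : 0 <= C by rewrite mulr_ge0 ?dotvv_ge0 // divr_ge0 // ltW.
have d0 : 0 < B - (f y - f x) by rewrite subr_gt0.
have C1 : 0 < 2 * (C + 1) by rewrite mulr_gt0 // ltr_wpDl.
(* In place of a limit, an explicit [t] so small that the error [C * t] cannot make up for the
   supposed strict defect. *)
pose t := Num.min 1 ((B - (f y - f x)) / (2 * (C + 1))).
have t0 : 0 < t by rewrite lt_min ltr01 divr_gt0.
have t1 : t <= 1 by rewrite ge_min lexx.
have tC : t * (2 * (C + 1)) <= B - (f y - f x).
  by rewrite -ler_pdivlMr // ge_min lexx orbT.
have h := cf t; rewrite t0 t1 in h; have {}h := h isT.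
clear -tC d0 t0 C0 h; move: (f y) (f x) B C t tC d0 t0 C0 h => A D B C t *; nra.
Qed.

(** The epigraph is closed, so the sublevel sets are closed and the strict superlevel sets, which
    generate the Borel sets, are open. *)
Lemma measurable_objective : measurable_fun setT (f : rVborel R n -> R).
Proof.
apply: (measurability _ (RGenOInfty.measurableE R)).
move=> _ [_ [c ->] <-]; rewrite setTI; apply: sub_sigma_algebra.
have cl : closed [set x | f x <= c].
  rewrite (_ : [set x | _] = (fun x : 'rV[R]_n => (x, c)) @^-1` [set xt | f xt.1 <= xt.2]) //.
  apply: closed_comp; last exact: closed_obj sp.
  move=> x _.
  exact: (@cvg_pair _ _ _ (nbhs x) (nbhs x) (nbhs c) _ _ _ id (cst c) cvg_id (cvg_cst c)).
rewrite (_ : f @^-1` _ = ~` [set x | f x <= c]); first exact: closed_openC.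
apply/seteqP; split => x /=; rewrite in_itv /= andbT.
  by move=> h; apply/negP; rewrite -ltNge.
by move=> /negP; rewrite -ltNge.
Qed.

End stochastic.

(** * The iteration in dual variables *)

Section dual_iteration.
Context {R : realType} {n : nat} {X : Type}.
Variables (F eta : 'rV[R]_n -> X -> R) (p m : nat) (L2 t : R).
Implicit Types (x y s e : 'rV[R]_n) (xs : nat -> X).

(* The common factor of all the summands of [grad_approx]. *)
Definition slope x e xs : R :=
  m%:R^-1 * \sum_(0 <= i < m)
    ((noisy_value F eta (x + t *: e) (xs i) - noisy_value F eta x (xs i)) / t).

Lemma grad_approxE x e xs :
  grad_approx t e (oracle_answers F eta t x e (mkseq xs m)) = slope x e xs *: e.
Proof.
rewrite /grad_approx /oracle_answers size_map size_mkseq !big_map /slope /index_iota subn0.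
by rewrite -scaler_suml scalerA.
Qed.

Definition query_point k (ys : 'rV[R]_n * 'rV[R]_n) : 'rV[R]_n :=
  (2 / k.+2%:R) *: mirror p ys.2 + (1 - 2 / k.+2%:R) *: ys.1.

(* One iteration in terms of y and of the dual variable s, where z = mirror s. *)
Definition dual_step k e xs (ys : 'rV[R]_n * 'rV[R]_n) : 'rV[R]_n * 'rV[R]_n :=
  let x := query_point k ys in
  (x - ((2 * L2)^-1 * slope x e xs) *: e,
   ys.2 - (alpha p n L2 k.+1 * n%:R * slope x e xs) *: e).

Fixpoint dual_iter (e : nat -> 'rV[R]_n) (xi : nat -> nat -> X) ys0 k :=
  if k is k'.+1 then dual_step k' (e k') (xi k') (dual_iter e xi ys0 k') else ys0.

Lemma ardfds_dual (e : nat -> 'rV[R]_n) (xi : nat -> nat -> X) x0 s0 k : (8 <= n)%N ->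
  mirror p s0 = x0 ->
  ardfds F eta p m L2 t x0 e xi k =
    State (dual_iter e xi (x0, s0) k).1 (mirror p (dual_iter e xi (x0, s0) k).2) (k * m).
Proof.
move=> n8 s0x0; elim: k => [|k ih] /=; first by rewrite s0x0.
rewrite ih /ardfds_step grad_approxE size_map size_mkseq /dual_step /query_point /=.
rewrite argmin_mirror // !scalerA mulSn addnC; congr State.
Qed.

End dual_iteration.

Section measurable_dual.
Context {R : realType} {n : nat} {dX : measure_display} {X : measurableType dX}.
Variables (F eta : 'rV[R]_n -> X -> R) (p m : nat) (L2 t : R).
Hypothesis mF : measurable_fun setT (fun z : rVborel R n * X => F z.1 z.2).
Hypothesis meta : measurable_fun setT (fun z : rVborel R n * X => eta z.1 z.2).
Context {d : measure_display} {T : measurableType d}.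

Lemma measurable_rVD (h1 h2 : T -> 'rV[R]_n) :
  measurable_fun setT (h1 : T -> rVborel R n) ->
  measurable_fun setT (h2 : T -> rVborel R n) ->
  measurable_fun setT (fun w => h1 w + h2 w : rVborel R n).
Proof.
move=> m1 m2; apply: measurable_rV => i.
rewrite (_ : (fun w => _) = (fun w => h1 w 0 i + h2 w 0 i)).
  by apply: measurable_funD; exact: measurable_coord_comp.
by apply/funext => w; rewrite mxE.
Qed.

Lemma measurable_rVZ (a : T -> R) (h : T -> 'rV[R]_n) :
  measurable_fun setT a ->
  measurable_fun setT (h : T -> rVborel R n) ->
  measurable_fun setT (fun w => a w *: h w : rVborel R n).
Proof.
move=> ma mh; apply: measurable_rV => i.
rewrite (_ : (fun w => _) = (fun w => a w * h w 0 i)).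
  by apply: measurable_funM => //; exact: measurable_coord_comp.
by apply/funext => w; rewrite mxE.
Qed.

Lemma measurable_rVB (h1 h2 : T -> 'rV[R]_n) :
  measurable_fun setT (h1 : T -> rVborel R n) ->
  measurable_fun setT (h2 : T -> rVborel R n) ->
  measurable_fun setT (fun w => h1 w - h2 w : rVborel R n).
Proof.
move=> m1 m2; apply: measurable_rVD => //.
rewrite (_ : (fun w => - h2 w) = (fun w => -1 *: h2 w)).
  by apply: measurable_rVZ => //; exact: measurable_cst.
by apply/funext => w; rewrite scaleN1r.
Qed.

Lemma measurable_psum (r : R) (h : T -> 'rV[R]_n) :
  measurable_fun setT (h : T -> rVborel R n) ->
  measurable_fun setT (fun w => psum r (h w)).
Proof.
move=> mh; apply: measurable_sum => i.
apply: (measurableT_comp (measurable_powR r)).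
by apply: measurableT_comp => //; exact: measurable_coord_comp.
Qed.

Lemma measurable_half_sqr (c r : R) (h : T -> 'rV[R]_n) :
  measurable_fun setT (h : T -> rVborel R n) ->
  measurable_fun setT (fun w => half_sqr c r (h w)).
Proof.
move=> mh; apply: measurable_funM; first exact: measurable_cst.
by apply: (measurableT_comp (measurable_powR _)); exact: measurable_psum.
Qed.

Lemma measurable_sg : measurable_fun setT (fun u : R => Num.sg u).
Proof.
rewrite (_ : (fun u => _) = (fun u : R => \1_`]0, +oo[%classic u - \1_`]-oo, 0[%classic u)).
  by apply: measurable_funB; apply: measurable_indic; exact: measurable_itv.
apply/funext => u; rewrite !indicE !mem_setE !in_itv /= andbT.
have [u0|u0|->] := ltrgtP u 0; rewrite ?subr0 ?sub0r ?sgr0 //.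
  by rewrite ltr0_sg.
by rewrite gtr0_sg.
Qed.

Lemma measurable_mirror (h : T -> 'rV[R]_n) :
  measurable_fun setT (h : T -> rVborel R n) ->
  measurable_fun setT (fun w => mirror p (h w) : rVborel R n).
Proof.
move=> mh; apply: measurable_rV => i.
rewrite /mirror /duality_map.
under [X in measurable_fun _ X]eq_fun do rewrite mxE.
have mi := measurable_coord_comp i mh.
apply: measurable_funM.
  apply: measurable_funM; first exact: measurable_cst.
  by apply: (measurableT_comp (measurable_powR _)); exact: measurable_psum.
apply: measurable_funM.
  exact: measurableT_comp measurable_sg mi.
apply: (measurableT_comp (measurable_powR _)).
exact: measurableT_comp.
Qed.

Lemma measurable_dual_step (k : nat) (e y s : T -> 'rV[R]_n) (xs : nat -> T -> X) :
  measurable_fun setT (e : T -> rVborel R n) ->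
  measurable_fun setT (y : T -> rVborel R n) ->
  measurable_fun setT (s : T -> rVborel R n) ->
  (forall i, (i < m)%N -> measurable_fun setT (xs i)) ->
  let st w := dual_step F eta p m L2 t k (e w) (xs ^~ w) (y w, s w) in
  measurable_fun setT (fun w => (st w).1 : rVborel R n) /\
  measurable_fun setT (fun w => (st w).2 : rVborel R n).
Proof.
move=> me my ms mxs st.
have mx : measurable_fun setT (fun w => query_point p k (y w, s w) : rVborel R n).
  by apply: measurable_rVD; apply: measurable_rVZ => //; exact: measurable_mirror.
have mnoisy i (x' : T -> 'rV[R]_n) : (i < m)%N ->
    measurable_fun setT (x' : T -> rVborel R n) ->
    measurable_fun setT (fun w => noisy_value F eta (x' w) (xs i w)).
  move=> im mx'.
  have mp : measurable_fun setT (fun w => ((x' w : rVborel R n), xs i w)).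
    by apply: measurable_fun_pair => //; exact: mxs.
  apply: measurable_funD.
    exact: measurableT_comp mF mp.
  exact: measurableT_comp meta mp.
have msl : measurable_fun setT
    (fun w => slope F eta m t (query_point p k (y w, s w)) (e w) (xs ^~ w)).
  apply: measurable_funM; first exact: measurable_cst.
  under [X in measurable_fun _ X]eq_fun do rewrite big_mkord.
  apply: measurable_sum => i; apply: measurable_funM; last exact: measurable_cst.
  apply: measurable_funB; apply: mnoisy => //.
  by apply: measurable_rVD => //; apply: measurable_rVZ.
split.
  apply: measurable_rVB => //; apply: measurable_rVZ => //.
  by apply: measurable_funM.
apply: measurable_rVB => //; apply: measurable_rVZ => //.
by apply: measurable_funM.
Qed.

End measurable_dual.

(** * One-step estimates for a fixed direction and batch *)

Section one_step.
Context {R : realType} {n : nat} {dX : measure_display} {X : measurableType dX}.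
Variables (P : probability X R) (F : 'rV[R]_n -> X -> R) (g : 'rV[R]_n -> X -> 'rV[R]_n)
    (L : X -> R) (f : 'rV[R]_n -> R) (eta : 'rV[R]_n -> X -> R)
    (L2 sigma Delta t : R) (p m : nat).
Hypotheses (n8 : (8 <= n)%N) (p12 : p = 1%N \/ p = 2%N).
Hypothesis sp : stochastic_problem P F g L f L2 sigma.
Hypotheses (t0 : 0 < t) (m0 : (0 < m)%N).
Implicit Types (x y s e h w : 'rV[R]_n).

Let L2p : 0 < L2. Proof. by case: sp. Qed.

Definition good_sample (xi : X) : Prop :=
  (forall x y, `|F y xi - F x xi - dotv (g x xi) (y - x)|
      <= lip L xi / 2 * dotv (y - x) (y - x)) /\
  (forall x, `|eta x xi| <= Delta).

Definition batch_gradient x (xs : nat -> X) : 'rV[R]_n :=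
  m%:R^-1 *: \sum_(i < m) g x (xs i).

Definition slope_error (xs : nat -> X) : R :=
  m%:R^-1 * \sum_(i < m) (t / 2 * lip L (xs i) + 2 * Delta / t).

Lemma slope_error_bound x e xs : dotv e e = 1 ->
  (forall i, (i < m)%N -> good_sample (xs i)) ->
  `|slope F eta m t x e xs - dotv (batch_gradient x xs) e| <= slope_error xs.
Proof.
move=> e1 good; rewrite /slope big_mkord /batch_gradient dotvZl dotv_suml -mulrBr.
rewrite normrM ger0_norm ?invr_ge0 // ler_wpM2l ?invr_ge0 //.
rewrite -sumrB (le_trans (ler_norm_sum _ _ _)) //; apply: ler_sum => i _.
have [hF hN] := good i (ltn_ord i).
have := hF x (x + t *: e); have := hN x; have := hN (x + t *: e).
rewrite [x + _ - x]addrAC subrr add0r dotvZr dotvZl dotvZr e1 mulr1.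
rewrite /noisy_value.
move: (F (x + t *: e) _) (F x _) (eta (x + t *: e) _) (eta x _) (dotv _ _) (lip _ _).
move=> A B C D E G hC hD hE.
have -> : (A + C - (B + D)) / t - E = (A - B - t * E + (C - D)) / t.
  by field; rewrite gt_eqF.
rewrite normrM [X in _ * X]ger0_norm ?invr_ge0 ?(ltW t0) // ler_pdivrMr //.
have -> : (t / 2 * G + 2 * Delta / t) * t = G / 2 * (t * t) + (Delta + Delta).
  by field; rewrite gt_eqF.
apply: (le_trans (ler_normD _ _)); rewrite lerD //.
by apply: (le_trans (ler_normB _ _)); rewrite lerD.
Qed.

Lemma gradient_step x e (b Z : R) h : dotv e e = 1 -> `|b - dotv h e| <= Z ->
  f (x - ((2 * L2)^-1 * b) *: e) <= f x - (2 * L2)^-1 * (dotv (grad f x) e * dotv h e)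
    + (8 * L2)^-1 * dotv (grad f x) e ^+ 2 + (4 * L2)^-1 * dotv h e ^+ 2
    + 3 / (4 * L2) * Z ^+ 2.
Proof.
move=> e1 bZ; apply: (le_trans (descent sp x _)).
rewrite [x - _ - x]addrAC subrr add0r dotvNr dotvNl dotvNr opprK !dotvZl !dotvZr e1 mulr1.
move: (f x) (dotv (grad f x) e) (dotv h e) bZ => A v u bZ.
have bZ2 : (b - u) ^+ 2 <= Z ^+ 2.
  by rewrite -(real_normK (num_real (b - u))) lerXn2r ?nnegrE // (le_trans _ bZ).
rewrite -subr_ge0.
(* The defect is 1 / (8 L2) times squares, with [b - u] the error of the slope: the weights 1/8, 1/4
   and 3/4 of the statement are those for which this decomposition closes. *)
have -> : A - (2 * L2)^-1 * (v * u) + (8 * L2)^-1 * v ^+ 2 + (4 * L2)^-1 * u ^+ 2 +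
   3 / (4 * L2) * Z ^+ 2 -
   (A - (2 * L2)^-1 * b * v + L2 / 2 * ((2 * L2)^-1 * b * ((2 * L2)^-1 * b)))
  = (8 * L2)^-1 * (6 * (Z ^+ 2 - (b - u) ^+ 2) + (v + 2 * (b - u)) ^+ 2 + (u - (b - u)) ^+ 2).
  by field; rewrite gt_eqF.
rewrite mulr_ge0 ?invr_ge0 ?mulr_ge0 ?(ltW L2p) // !addr_ge0 ?sqr_ge0 // mulr_ge0 //.
by rewrite subr_ge0.
Qed.

(** Smoothness of d^* is applied to the update of the dual variable. The second-order term uses b^2
    <= 2 (u^2 + Z^2), with u the exact slope [dotv h e]. The product of the slope error with
    [dotv (mirror p s - xstar) e] has no sign and is split by Young's inequality with weight
    [mu]. *)
Lemma mirror_step s xstar e (b Z a mu : R) h : 0 <= a -> 0 < mu ->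
  `|b - dotv h e| <= Z ->
  fenchel_gap p xstar (s - (a * b) *: e) <= fenchel_gap p xstar s
    - a * (dotv h e * dotv (mirror p s - xstar) e)
    + a * mu / 2 * Z ^+ 2 + a / (2 * mu) * dotv (mirror p s - xstar) e ^+ 2
    + a ^+ 2 * (dotv h e ^+ 2 + Z ^+ 2) * dual_weight p e.
Proof.
move=> a0 mu0 bZ; have := dual_prox_smooth p n8 s (- ((a * b) *: e)).
have wE : dotv (mirror p s - xstar) e = dotv (mirror p s) e - dotv xstar e.
  by rewrite dotvBl.
rewrite -scaleNr sqr_dual_normZ dotvZr sqrrN.
have := sqr_dual_norm_weight p n8 e.
have := sqr_dual_norm_ge0 p e.
rewrite wE /fenchel_gap dotvDr dotvZr.
move: (dual_prox _ (s + _)) (dual_prox _ s) (prox _ _) (dotv xstar s) => S2 S1 Pr C.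
move: (sqr_dual_norm _ _) (dual_weight _ _) => Nq W.
move: (dotv (mirror p s) e) (dotv xstar e) (dotv h e) bZ => z xs u bZ Nq0 NW hS.
have bZ2 : (b - u) ^+ 2 <= Z ^+ 2.
  by rewrite -(real_normK (num_real (b - u))) lerXn2r ?nnegrE // (le_trans _ bZ).
have b2 : b ^+ 2 <= 2 * (u ^+ 2 + Z ^+ 2).
  have := sqr_ge0 (u - (b - u)); have : b ^+ 2 = (u + (b - u)) ^+ 2 by congr (_ ^+ 2); ring.
  by move: bZ2; move: (b - u) => c hc -> h2; lra.
have q1 : (a * b) ^+ 2 * Nq / 2 <= a ^+ 2 * (u ^+ 2 + Z ^+ 2) * W.
  rewrite exprMn; apply: (@le_trans _ _ (a ^+ 2 * (u ^+ 2 + Z ^+ 2) * Nq)).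
    have -> : a ^+ 2 * b ^+ 2 * Nq / 2 = a ^+ 2 * (b ^+ 2 / 2) * Nq by field.
    by rewrite ler_wpM2r // ler_wpM2l ?sqr_ge0 // ler_pdivrMr // mulrC.
  by rewrite ler_wpM2l // mulr_ge0 ?sqr_ge0 // addr_ge0 ?sqr_ge0.
have q2 : - (a * (b - u) * (z - xs)) <= a * mu / 2 * Z ^+ 2 + a / (2 * mu) * (z - xs) ^+ 2.
  apply: (@le_trans _ _ (a * mu / 2 * (b - u) ^+ 2 + a / (2 * mu) * (z - xs) ^+ 2)).
    rewrite -subr_ge0 opprK.
    have -> : a * mu / 2 * (b - u) ^+ 2 + a / (2 * mu) * (z - xs) ^+ 2 + a * (b - u) * (z - xs)
       = a / (2 * mu) * (mu * (b - u) + (z - xs)) ^+ 2.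
      by field; rewrite gt_eqF.
    by rewrite mulr_ge0 ?sqr_ge0 // divr_ge0 // mulr_ge0 // ltW.
  rewrite lerD2r ler_wpM2l //; by rewrite divr_ge0 // mulr_ge0 // ltW.
move: q1 q2 hS; set A1 := _ / 2; set A2 := _ * W; set A3 := _ * Z ^+ 2; set A4 := _ * _ ^+ 2.
clearbody A1 A2 A3 A4 => q1 q2 hS.
have e1 : a * (b - u) * (z - xs) = a * b * z - a * b * xs - a * (u * (z - xs)) by ring.
move: q2 hS; rewrite e1 !mulNr.
move: (a * b * z) (a * b * xs) (a * (u * (z - xs))) => B1 B2 B3 q2 hS; lra.
Qed.

End one_step.

Lemma sqr_mean_le (R : realType) (m : nat) (a : 'I_m -> R) : (0 < m)%N ->
  (m%:R^-1 * \sum_(i < m) a i) ^+ 2 <= m%:R^-1 * \sum_(i < m) a i ^+ 2.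
Proof.
move=> m0; have mp : 0 < m%:R :> R by rewrite ltr0n.
have := dotv_cauchy_schwarz (\row_(i < m) a i) (const_mx 1).
have -> : dotv (\row_(i < m) a i) (const_mx 1) = \sum_(i < m) a i.
  by apply: eq_bigr => i _; rewrite !mxE mulr1.
have -> : dotv (\row_(i < m) a i) (\row_(i < m) a i) = \sum_(i < m) a i ^+ 2.
  by apply: eq_bigr => i _; rewrite !mxE expr2.
have -> : dotv (const_mx 1) (const_mx 1 : 'rV[R]_m) = m%:R.
  rewrite /dotv (eq_bigr (fun=> 1)) ?sumr_const ?card_ord // => i _.
  by rewrite !mxE mulr1.
move=> h; rewrite exprMn expr2 -mulrA ler_wpM2l ?invr_ge0 ?(ltW mp) //.
by rewrite mulrC ler_pdivrMr.
Qed.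

(** * Moments of a batch of independent samples *)

Section batch_means.
Context {R : realType} {n : nat} {dX : measure_display} {X : measurableType dX}.
Variables (P : probability X R) (F : 'rV[R]_n -> X -> R) (g : 'rV[R]_n -> X -> 'rV[R]_n)
    (L : X -> R) (f : 'rV[R]_n -> R) (L2 sigma Delta t : R) (m : nat).
Hypothesis sp : stochastic_problem P F g L f L2 sigma.
Hypotheses (t0 : 0 < t) (m0 : (0 < m)%N).
Context {d} {Omega : measurableType d}.
Variables (Pr : probability Omega R) (xs : nat -> Omega -> X).
Hypothesis mxs : forall i, (i < m)%N -> measurable_fun setT (xs i).
Hypothesis law_xs : forall i B, (i < m)%N -> measurable B -> pushforward Pr (xs i) B = P B.
Hypothesis indep_xs : forall i j A B, (i < m)%N -> (j < m)%N -> i != j ->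
  measurable A -> measurable B ->
  (Pr (xs i @^-1` A `&` xs j @^-1` B) = Pr (xs i @^-1` A) * Pr (xs j @^-1` B))%E.
Implicit Types (x v : 'rV[R]_n).

Let mp : 0 < m%:R :> R. Proof. by rewrite ltr0n. Qed.

Let mean_eq_xs (i : 'I_m) (Y : X -> R) r : mean_eq P Y r -> mean_eq Pr (Y \o xs i) r.
Proof. by apply: mean_eq_law; [exact: mxs | move=> B; exact: law_xs]. Qed.

Let mean_le_xs (i : 'I_m) (Y : X -> R) r : mean_le P Y r -> mean_le Pr (Y \o xs i) r.
Proof. by apply: mean_le_law; [exact: mxs | move=> B; exact: law_xs]. Qed.

Lemma mean_batch_dotv v x :
  mean_eq Pr (fun w => dotv v (batch_gradient g m x (xs ^~ w))) (dotv v (grad f x)).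
Proof.
have h := mean_eqZ m%:R^-1 (mean_eq_sum (index_enum 'I_m)
  (fun i => mean_eq_xs i (mean_dotv_gradient sp v x))).
rewrite sumr_const card_ord -[dotv _ _ *+ m]mulr_natl mulrA mulVf ?gt_eqF // mul1r in h.
by apply: mean_eq_eq h => w; rewrite /batch_gradient dotvZr dotv_sumr.
Qed.

Let dev x xi : 'rV[R]_n := g x xi - grad f x.

Let measurable_dev x : measurable_fun setT (dev x : X -> rVborel R n).
Proof.
apply: measurable_rVB; last exact: measurable_cst.
exact: measurable_gradient_at sp x.
Qed.

(* For independent centred vectors a and b, E |a + b|^2 = E |a|^2 + E |b|^2. *)
Let mean_dev_cross x (i j : 'I_m) : i != j ->
  mean_eq Pr (fun w => dotv (dev x (xs i w)) (dev x (xs j w))) 0.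
Proof.
move=> ij; have [iv _] := mean_gradient_deviation sp x.
have [v hv] : exists v : R, mean_eq P (fun xi => dotv (dev x xi) (dev x xi)) v.
  exact: integrable_mean iv.
have v0 : 0 <= v by apply: mean_le_ge0 (mean_eq_le hv) => xi; exact: dotvv_ge0.
have hvi k := mean_eq_xs k hv.
have mD2 : measurable_fun setT (fun z : X * X => dotv (dev x z.1 + dev x z.2) (dev x z.1 + dev x z.2)).
  have m12 : measurable_fun setT (fun z : X * X => dev x z.1 + dev x z.2 : rVborel R n).
    by apply: measurable_rVD; apply: measurableT_comp (measurable_dev x) _.
  exact: measurable_dotv.
have inner a : mean_eq Pr (fun w => dotv (a + dev x (xs j w)) (a + dev x (xs j w)))
    (dotv a a + v).
  have h0 : mean_eq P (fun xi => dotv a (dev x xi)) 0.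
    have := mean_eqD (mean_dotv_gradient sp a x) (mean_eq_cst P (- dotv a (grad f x))).
    by rewrite subrr; apply: mean_eq_eq => xi; rewrite /dev dotvBr.
  have := mean_eqD (mean_eqD (mean_eq_cst Pr (dotv a a)) (mean_eqZ 2 (mean_eq_xs j h0))) (hvi j).
  rewrite mulr0 addr0; apply: mean_eq_eq => w /=.
  move: (dev x (xs j w)) => b; rewrite !dotvDl !dotvDr (dotvC b a).
  by move: (dotv a a) (dotv a b) (dotv b b) => A B C; ring.
(* The inner product has no sign, so Tonelli's theorem is applied to the squared norm of the sum;
   the cross term is recovered by subtracting the two squares. *)
have outer : mean_eq Pr (fun w => dotv (dev x (xs i w) + dev x (xs j w))
    (dev x (xs i w) + dev x (xs j w))) (v + v).
  have e1 : (\int[Pr]_w (dotv (dev x (xs i w) + dev x (xs j w))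
      (dev x (xs i w) + dev x (xs j w)))%:E = (v + v)%:E)%E.
    rewrite (@independent_tonelli _ _ _ Pr _ _ X X (xs i) (xs j)
      (fun z => (dotv (dev x z.1 + dev x z.2) (dev x z.1 + dev x z.2))%:E)).
    - under eq_integral => w _ do rewrite /= (proj2 (inner (dev x (xs i w)))).
      by case: (mean_eqD (hvi i) (mean_eq_cst Pr v)).
    - exact: mxs.
    - exact: mxs.
    - by move=> A B mA mB; apply: indep_xs.
    - exact/measurable_EFinP.
    - by move=> z; rewrite lee_fin dotvv_ge0.
  have [|||i1 _] := @ge0_mean_le _ _ _ Pr (fun w => dotv (dev x (xs i w) + dev x (xs j w))
      (dev x (xs i w) + dev x (xs j w))) (v + v).
  - have mij : measurable_fun setT (fun w => (xs i w, xs j w)).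
      by apply: measurable_fun_pair; exact: mxs.
    exact: measurableT_comp mD2 mij.
  - by move=> w; exact: dotvv_ge0.
  - by rewrite e1.
  - by split.
have := mean_eqZ 2^-1 (mean_eqD outer (mean_eqD (mean_eqZ (-1) (hvi i)) (mean_eqZ (-1) (hvi j)))).
have -> : 2^-1 * (v + v + (-1 * v + -1 * v)) = 0 by ring.
apply: mean_eq_eq => w /=; move: (dev x (xs i w)) (dev x (xs j w)) => a b.
rewrite !dotvDl !dotvDr (dotvC b a).
by move: (dotv a a) (dotv a b) (dotv b b) => A B C; field.
Qed.

Let mean_batch_dev x :
  mean_le Pr (fun w => dotv (batch_gradient g m x (xs ^~ w) - grad f x)
     (batch_gradient g m x (xs ^~ w) - grad f x)) (sigma ^+ 2 / m%:R).
Proof.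
have h (i j : 'I_m) : mean_le Pr (fun w => dotv (dev x (xs i w)) (dev x (xs j w)))
    (if i == j then sigma ^+ 2 else 0).
  case: eqVneq => [->|ij]; last exact/mean_eq_le/mean_dev_cross.
  exact: mean_le_xs (mean_gradient_deviation sp x).
have m2 : 0 <= m%:R^-1 ^+ 2 :> R by rewrite sqr_ge0.
have := mean_leZ m2 (mean_le_sum (index_enum 'I_m) (fun i =>
  mean_le_sum (index_enum 'I_m) (fun j => h i j))).
have -> : m%:R^-1 ^+ 2 * (\sum_(i < m) \sum_(j < m) if i == j then sigma ^+ 2 else 0)
   = sigma ^+ 2 / m%:R.
  rewrite (eq_bigr (fun=> sigma ^+ 2)); last first.
    by move=> i _; rewrite -big_mkcond (big_pred1 i).
  rewrite sumr_const card_ord -[sigma ^+ 2 *+ m]mulr_natl; field; by rewrite gt_eqF.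
apply: mean_le_eq => w.
have -> : batch_gradient g m x (xs ^~ w) - grad f x = m%:R^-1 *: \sum_(i < m) dev x (xs i w).
  rewrite /batch_gradient /dev sumrB scalerBr; congr (_ - _).
  by rewrite sumr_const card_ord -[grad f x *+ m]scaler_nat scalerA mulVf ?scale1r // gt_eqF.
rewrite dotvZl dotvZr mulrA -expr2; congr (_ * _).
by rewrite dotv_suml; apply: eq_bigr => i _; rewrite dotv_sumr.
Qed.

(** From |h|^2 = 2 <G, h> - |G|^2 + |h - G|^2, where [h] is the batch gradient with mean [G]. *)
Lemma mean_batch_sqr x :
  mean_le Pr (fun w => dotv (batch_gradient g m x (xs ^~ w)) (batch_gradient g m x (xs ^~ w)))
   (dotv (grad f x) (grad f x) + sigma ^+ 2 / m%:R).
Proof.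
have := mean_leD (mean_leD (mean_eq_le (mean_eqZ 2 (mean_batch_dotv (grad f x) x)))
   (mean_eq_le (mean_eq_cst Pr (- dotv (grad f x) (grad f x))))) (mean_batch_dev x).
have -> : 2 * dotv (grad f x) (grad f x) + - dotv (grad f x) (grad f x) =
  dotv (grad f x) (grad f x) by ring.
apply: mean_le_eq => w /=.
move: (batch_gradient _ _ _ _) (grad f x) => a b; rewrite !dotvBl !dotvBr (dotvC b a).
by move: (dotv a a) (dotv a b) (dotv b b) => A B C; ring.
Qed.

Lemma mean_slope_error_sqr :
  mean_le Pr (fun w => slope_error L Delta t m (xs ^~ w) ^+ 2)
    (t ^+ 2 * L2 ^+ 2 / 2 + 8 * Delta ^+ 2 / t ^+ 2).
Proof.
have tt : 0 <= t ^+ 2 / 2 by rewrite divr_ge0 // sqr_ge0.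
have mi : 0 <= m%:R^-1 :> R by rewrite invr_ge0 ltW.
have h (i : 'I_m) := mean_leD (mean_leZ tt (mean_le_xs i (mean_lip_pos_sqr sp)))
   (mean_eq_le (mean_eq_cst Pr (8 * Delta ^+ 2 / t ^+ 2))).
have hs := mean_leZ mi (mean_le_sum (index_enum 'I_m) h).
rewrite sumr_const card_ord -[(_ + _) *+ m]mulr_natl mulrA mulVf ?gt_eqF // mul1r in hs.
rewrite [t ^+ 2 * L2 ^+ 2 / 2]mulrAC.
apply: (ae_mean_le _ _ _ hs).
- apply: measurable_funX; apply: measurable_funM; first exact: measurable_cst.
  apply: measurable_sum => i; apply: measurable_funD; last exact: measurable_cst.
  apply: measurable_funM; first exact: measurable_cst.
  by apply: measurableT_comp (measurable_lip_pos sp) _; exact: mxs.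
- by move=> w; exact: sqr_ge0.
(* Jensen's inequality for the average, then (a + b)^2 <= 2 a^2 + 2 b^2 for the smoothing and noise
   parts. No independence is used here. *)
- apply: aeW => w; apply: (le_trans (sqr_mean_le _ m0)); rewrite ler_wpM2l //.
  apply: ler_sum => i _ /=; rewrite -subr_ge0.
  have -> : t ^+ 2 / 2 * lip L (xs i w) ^+ 2 + 8 * Delta ^+ 2 / t ^+ 2 -
     (t / 2 * lip L (xs i w) + 2 * Delta / t) ^+ 2 =
     (t / 2 * lip L (xs i w) - 2 * Delta / t) ^+ 2.
    by field; rewrite gt_eqF.
  exact: sqr_ge0.
Qed.

End batch_means.

(** * Expected decrease of the potential *)

Section conditional_bound.
Context {R : realType} {d} {Omega : measurableType d} (Pr : probability Omega R).

Lemma measurable_partial_integral d1 d2 (T1 : measurableType d1) (T2 : measurableType d2)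
    (U : Omega -> T1) (V : Omega -> T2) (phi : T1 * T2 -> \bar R) :
  measurable_fun setT U -> measurable_fun setT V ->
  measurable_fun setT phi -> (forall z, 0 <= phi z)%E ->
  measurable_fun setT (fun w => \int[Pr]_w' phi (U w, V w'))%E.
Proof.
move=> mU mV mphi phi0.
pose V' : {mfun Omega >-> T2} :=
  HB.pack_for {mfun Omega >-> T2} V (isMeasurableFun.Build _ _ _ _ V mV).
pose m2 : probability T2 R := distribution Pr V'.
have mF : measurable_fun setT (fubini_F m2 phi).
  exact: measurable_fun_fubini_tonelli_F.
rewrite (_ : (fun w => _) = fubini_F m2 phi \o U); first exact: measurableT_comp mF mU.
apply/funext => w; rewrite /= /fubini_F ge0_integral_distribution //.
by apply: measurableT_comp.
Qed.

Lemma ae_integral_mean_le (h : Omega -> \bar R) (Y : Omega -> R) r :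
  measurable_fun setT h -> (forall w, 0 <= h w)%E ->
  {ae Pr, forall w, (h w <= (Y w)%:E)%E} -> mean_le Pr Y r ->
  (\int[Pr]_w h w <= r%:E)%E.
Proof.
move=> mh h0 hY mY; have mY0 := mean_le_measurable mY.
have mY' : measurable_fun setT (fun w => Num.max (Y w) 0).
  by apply: measurable_maxr => //; exact: measurable_cst.
apply: (@le_trans _ _ (\int[Pr]_w (Num.max (Y w) 0)%:E)%E).
  apply: ae_ge0_le_integral => //.
  - by move=> w _; rewrite lee_fin le_max lexx orbT.
  - exact/measurable_EFinP.
  - apply: filterS hY => w hw _; apply: (le_trans hw).
    by rewrite lee_fin le_max lexx.
have [_ eY] := mY; apply: le_trans eY.
rewrite le_eqVlt; apply/orP; left; apply/eqP; apply: ae_eq_integral => //.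
- exact/measurable_EFinP.
- exact/measurable_EFinP.
- apply: filterS hY => w hw _ /=; rewrite max_l //.
  by rewrite -lee_fin (le_trans (h0 w)).
Qed.

Lemma sigma_tonelli_le (G1 G2 : set (set Omega))
    (phi : g_sigma_algebraType G1 * g_sigma_algebraType G2 -> \bar R)
    (Y : Omega -> R) r :
  G1 `<=` measurable -> setI_closed G1 -> G1 setT ->
  G2 `<=` measurable -> setI_closed G2 -> G2 setT ->
  independent_systems Pr G1 G2 ->
  measurable_fun setT phi -> (forall z, 0 <= phi z)%E ->
  {ae Pr, forall w, (\int[Pr]_w' phi (w, w') <= (Y w)%:E)%E} -> mean_le Pr Y r ->
  (\int[Pr]_w phi (w, w) <= r%:E)%E.
Proof.
move=> m1 I1 T1 m2 I2 T2 G12 mphi phi0 hY mY.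
rewrite sigma_tonelli //; apply: ae_integral_mean_le hY mY.
  apply: (@measurable_partial_integral _ _ (g_sigma_algebraType G1)
    (g_sigma_algebraType G2) (fun w => w) (fun w => w)) => //.
  - move=> _ A mA; rewrite setTI.
    exact: (smallest_sub (@sigma_algebra_measurable _ Omega) m1).
  - move=> _ A mA; rewrite setTI.
    exact: (smallest_sub (@sigma_algebra_measurable _ Omega) m2).
by move=> w; apply: integral_ge0.
Qed.

End conditional_bound.

Section expected_step.
Context {R : realType} {n : nat} {dX : measure_display} {X : measurableType dX}.
Variables (P : probability X R) (F : 'rV[R]_n -> X -> R) (g : 'rV[R]_n -> X -> 'rV[R]_n)
    (L : X -> R) (f : 'rV[R]_n -> R) (eta : 'rV[R]_n -> X -> R)
    (L2 sigma Delta t : R) (p m : nat) (xstar : 'rV[R]_n).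
Hypotheses (n8 : (8 <= n)%N) (p12 : p = 1%N \/ p = 2%N).
Hypothesis sp : stochastic_problem P F g L f L2 sigma.
Hypothesis bn : bounded_noise P eta Delta.
Hypotheses (t0 : 0 < t) (m0 : (0 < m)%N).
Hypothesis fmin : minimizer f xstar.

Let L2p : 0 < L2. Proof. by case: sp. Qed.
Let np : 0 < n%:R :> R. Proof. by rewrite ltr0n (leq_trans _ n8). Qed.
Let rp : 0 < rho p n :> R. Proof. exact: rho_gt0. Qed.

Definition scale_Q : R := 96 * n%:R ^+ 2 * rho p n * L2.

Lemma scale_Q_gt0 : 0 < scale_Q.
Proof. by rewrite /scale_Q !mulr_gt0 // exprn_gt0. Qed.

(** With C = (k + 2)^2 / (2 Q) and tau = 2 / (k + 2), the weight of the function gap is C (1 - tau),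
    as produced by the coupling. The weight of the next step is below C, since (k + 1)(k + 3) = (k +
    2)^2 - 1. It vanishes at k = 0, so only the Fenchel gap is left initially. *)
Definition potential k (ys : 'rV[R]_n * 'rV[R]_n) : R :=
  k%:R * (k%:R + 2) / (2 * scale_Q) * (f ys.1 - f xstar) + fenchel_gap p xstar ys.2.

Lemma potential_ge0 k ys : 0 <= potential k ys.
Proof.
rewrite addr_ge0 ?fenchel_gap_ge0 // mulr_ge0 ?subr_ge0 //.
by rewrite divr_ge0 ?mulr_ge0 ?addr_ge0 // ltW // scale_Q_gt0.
Qed.

Lemma measurable_potential k d (T : measurableType d) (y s : T -> 'rV[R]_n) :
  measurable_fun setT (y : T -> rVborel R n) ->
  measurable_fun setT (s : T -> rVborel R n) ->
  measurable_fun setT (fun w => potential k (y w, s w)).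
Proof.
move=> my ms; apply: measurable_funD.
  apply: measurable_funM; first exact: measurable_cst.
  apply: measurable_funB; last exact: measurable_cst.
  exact: measurableT_comp (measurable_objective sp) my.
apply: measurable_funB; last by apply: measurable_dotvr.
by apply: measurable_funD; [exact: measurable_cst | exact: measurable_half_sqr].
Qed.

Section fixed_state.
Variables (k : nat) (ys : 'rV[R]_n * 'rV[R]_n) (mu : R).
Hypothesis mu0 : 0 < mu.

Let x := query_point p k ys.
Let w := mirror p ys.2 - xstar.
Let G := grad f x.
Let C : R := (k%:R + 2) ^+ 2 / (2 * scale_Q).
Let a : R := alpha p n L2 k.+1 * n%:R.

(* The average of the bounds of [gradient_step] and [mirror_step] over the direction. *)
Definition direction_average (h : 'rV[R]_n) (Z : R) : R :=
  C * (f x - f xstar) + fenchel_gap p xstar ys.2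
  + (C * (3 / (4 * L2)) + a * mu / 2 + a ^+ 2 * (6 * rho p n)) * Z ^+ 2
  + a / (2 * mu) * (dotv w w / n%:R) + C * (8 * L2)^-1 * (dotv G G / n%:R)
  + (C * (4 * L2)^-1 / n%:R + a ^+ 2 * (6 * rho p n / n%:R)) * dotv h h
  - C * (2 * L2)^-1 * (dotv G h / n%:R) - a * (dotv w h / n%:R).

Let C0 : 0 < C.
Proof. by rewrite divr_gt0 ?exprn_gt0 ?mulr_gt0 ?scale_Q_gt0 // ltr_wpDl. Qed.

Let aE : a = 2 * C / (k%:R + 2) * n%:R.
Proof.
have k2 : 0 < k%:R + 2 :> R by rewrite ltr_wpDl.
rewrite /a /alpha -/scale_Q /C -[in LHS]addn2 natrD; congr (_ * _).
by move: scale_Q_gt0 => Q0; field; rewrite !gt_eqF.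
Qed.

Let a0 : 0 < a.
Proof.
rewrite aE mulr_gt0 //; apply: divr_gt0; first exact: mulr_gt0.
by rewrite ltr_wpDl.
Qed.

Lemma direction_bound d (Omega : measurableType d) (Pr : probability Omega R)
    (e : Omega -> 'rV[R]_n) (xs : nat -> X) :
  measurable_fun setT (e : Omega -> rVborel R n) ->
  uniform_on_sphere (pushforward Pr (e : Omega -> rVborel R n)) ->
  (forall i, (i < m)%N -> good_sample F g L eta Delta (xs i)) ->
  (\int[Pr]_w (potential k.+1 (dual_step F eta p m L2 t k (e w) xs ys))%:E
    <= (direction_average (batch_gradient g m x xs) (slope_error L Delta t m xs))%:E)%E.
Proof.
move=> me le good; set h := batch_gradient _ _ _ _; set Z := slope_error _ _ _ _ _.
have i0 : 'I_n := Ordinal (leq_trans (isT : (0 < 8)%N) n8).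
have n0 : (0 < n)%N := leq_trans (isT : (0 < 8)%N) n8.
have [mst1 mst2] := @measurable_dual_step R n dX X F eta p m L2 t (measurable_obj sp)
  (measurable_noise bn) d Omega k e (cst ys.1) (cst ys.2) (fun i => cst (xs i))
  me (measurable_cst _) (measurable_cst _) (fun i _ => measurable_cst _).
have mpsi : measurable_fun setT
    (fun w => potential k.+1 (dual_step F eta p m L2 t k (e w) xs ys)).
  have := measurable_potential k.+1 mst1 mst2.
  by rewrite /=; case: (ys).
have W1 := mean_dual_weight_dotv2 n8 p12 me le h.
have W2 := mean_dual_weight n8 p12 me le.
have aa : 0 <= a ^+ 2 by rewrite sqr_ge0.
have aZ : 0 <= a ^+ 2 * Z ^+ 2 by rewrite mulr_ge0 ?sqr_ge0.
have M1 := mean_leD (mean_leZ aa W1) (mean_leZ aZ W2).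
have M2 := mean_eq_le (mean_eqD (mean_eqZ (- (C * (2 * L2)^-1)) (mean_dotvM me le i0 n0 G h))
   (mean_eqZ (- a) (mean_dotvM me le i0 n0 w h))).
have M3 := mean_eq_le (mean_eqD (mean_eqZ (C * (8 * L2)^-1) (mean_dotv2 me le i0 n0 G))
  (mean_eqD (mean_eqZ (C * (4 * L2)^-1) (mean_dotv2 me le i0 n0 h))
     (mean_eqZ (a / (2 * mu)) (mean_dotv2 me le i0 n0 w)))).
have M4 := mean_eq_le (mean_eq_cst Pr (C * (f x - f xstar) + fenchel_gap p xstar ys.2
  + (C * (3 / (4 * L2)) + a * mu / 2) * Z ^+ 2)).
have M := mean_leD (mean_leD M1 M2) (mean_leD M3 M4).
apply: (ae_integral_mean_le _ _ _ (mean_le_trans _ M)).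
- exact/measurable_EFinP.
- by move=> v; rewrite lee_fin potential_ge0.
- apply: filterS (ae_unit me le) => v e1; rewrite lee_fin.
  have sE := slope_error_bound t0 x e1 good.
  rewrite -/h -/Z in sE.
  have gs := gradient_step sp x e1 sE.
  have ms := mirror_step p n8 ys.2 xstar (ltW a0) mu0 sE.
  rewrite /potential -[k.+1%:R]natr1 /dual_step /= -/x -/a.
  set yn := x - _ in gs *.
  (* The weight (k + 1)(k + 3) / (2 Q) is raised to [C], which is harmless because [xstar] is a
     minimizer. *)
  apply: (@le_trans _ _ (C * (f yn - f xstar) + fenchel_gap p xstar
      (ys.2 - (a * slope F eta m t x (e v) xs) *: e v))).
    have Q0 : 0 <= (2 * scale_Q)^-1 by rewrite invr_ge0 mulr_ge0 // ltW // scale_Q_gt0.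
    rewrite lerD2r ler_wpM2r ?subr_ge0 //; apply: (ler_wpM2r Q0).
    by move: (k%:R : R) => K; nra.
  have gs' : C * (f yn - f xstar) <= C * (f x - (2 * L2)^-1 * (dotv G (e v) * dotv h (e v))
    + (8 * L2)^-1 * dotv G (e v) ^+ 2 + (4 * L2)^-1 * dotv h (e v) ^+ 2
    + 3 / (4 * L2) * Z ^+ 2 - f xstar) by rewrite ler_wpM2l ?(ltW C0) // lerD2r.
  apply: (le_trans (lerD gs' ms)); rewrite -/w le_eqVlt; apply/orP; left; apply/eqP.
  move: (dotv G _) (dotv h _) (dotv w _) (dual_weight _ _) (fenchel_gap _ _ _) (f x) (f xstar).
  by move=> *; ring.
- rewrite /direction_average le_eqVlt; apply/orP; left; apply/eqP.
  move: (dotv G _) (dotv h _) (dotv w _) (dotv w _) (dotv G _) (fenchel_gap _ _ _) (f x) (f xstar).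
  by move=> *; ring.
Qed.

Let V : R := sigma ^+ 2 / m%:R.
Let B2 : R := t ^+ 2 * L2 ^+ 2 / 2 + 8 * Delta ^+ 2 / t ^+ 2.
Let al : R := alpha p n L2 k.+1.

Definition step_bound : R :=
  (1 + al / mu) * potential k ys + al * n%:R * mu / 2 * B2
  + C / (8 * L2) * (3 * V / n%:R + 7 * B2).

Let alE : al = 2 * C / (k%:R + 2).
Proof. by apply: (mulIf (lt0r_neq0 np)); rewrite -aE. Qed.

(** Here a^2 = 2 C n^2 / Q, so the dimension and [rho] cancel against Q and 12 / 96 = 1 / 8
    remains. *)
Let a_sqr : a ^+ 2 * (6 * rho p n) = C / (8 * L2).
Proof.
have k2 : 0 < k%:R + 2 :> R by rewrite ltr_wpDl.
rewrite aE /C /scale_Q.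
by move: (k%:R : R) (n%:R) (rho p n) k2 np rp => K N r K0 N0 r0; field; rewrite !gt_eqF.
Qed.

(** Linear coupling: as [x] is the convex combination of the mirror point and [ys.1], tau (z -
    xstar) equals -((1 - tau)(y - x) + tau (xstar - x)), and the gradient inequality at [x] is used
    towards both [y] and [xstar]. *)
Let coupling_bound : C * (f x - f xstar) - al * dotv w G <=
  k%:R * (k%:R + 2) / (2 * scale_Q) * (f ys.1 - f xstar).
Proof.
have k2 : 0 < k%:R + 2 :> R by rewrite ltr_wpDl.
have h1 := gradient_inequality sp x ys.1.
have h2 := gradient_inequality sp x xstar.
pose tau : R := 2 / (k%:R + 2).
have tau0 : 0 <= tau by rewrite divr_ge0 // ltW.
have tau1 : 0 <= 1 - tau.
  by rewrite subr_ge0 ler_pdivrMr // mul1r lerDr.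
have tE : 2 / k.+2%:R = tau :> R by rewrite /tau -[k.+2]addn2 natrD.
have wE : tau * dotv w G = - ((1 - tau) * dotv G (ys.1 - x) + tau * dotv G (xstar - x)).
  transitivity (dotv G (tau *: w)); first by rewrite dotvZr dotvC.
  transitivity (dotv G (- ((1 - tau) *: (ys.1 - x) + tau *: (xstar - x)))); last first.
    by rewrite [LHS]dotvNr [in LHS]dotvDr !dotvZr.
  congr dotv.
  rewrite /w /x /query_point tE.
  move: (mirror _ _) (ys.1) => z y; apply/rowP => i; rewrite !mxE.
  by move: (z _ _) (xstar _ _) (y _ _) => A B D; ring.
have -> : al * dotv w G = C * (tau * dotv w G).
  by rewrite alE /tau; move: (dotv w G) => D; field; rewrite gt_eqF.
have -> : k%:R * (k%:R + 2) / (2 * scale_Q) = C * (1 - tau).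
  rewrite /C /tau; move: scale_Q_gt0; move: (scale_Q) (k%:R : R) k2 => Q K K0 Q0.
  by field; rewrite !gt_eqF.
suff hh : f x - f xstar - tau * dotv w G <= (1 - tau) * (f ys.1 - f xstar).
  by have := ler_wpM2l (ltW C0) hh; rewrite [leLHS]mulrBr [leRHS]mulrA.
rewrite wE; have h1' := ler_wpM2l tau1 h1; have h2' := ler_wpM2l tau0 h2.
move: h1' h2'; move: (dotv G (ys.1 - x)) (dotv G (xstar - x)) (f x) (f xstar) (f ys.1).
by move: (tau) => u A B D E H h1' h2'; lra.
Qed.

Lemma batch_bound d (Omega : measurableType d) (Pr : probability Omega R)
    (xs : nat -> Omega -> X) :
  (forall i, (i < m)%N -> measurable_fun setT (xs i)) ->
  (forall i B, (i < m)%N -> measurable B -> pushforward Pr (xs i) B = P B) ->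
  (forall i j A B, (i < m)%N -> (j < m)%N -> i != j -> measurable A -> measurable B ->
    (Pr (xs i @^-1` A `&` xs j @^-1` B) = Pr (xs i @^-1` A) * Pr (xs j @^-1` B))%E) ->
  mean_le Pr (fun v => direction_average (batch_gradient g m x (xs ^~ v))
    (slope_error L Delta t m (xs ^~ v))) step_bound.
Proof.
move=> mxs law ind.
have Mz := mean_slope_error_sqr Delta sp t0 m0 mxs law.
have Mh := mean_batch_sqr sp m0 mxs law ind x.
have MG := mean_batch_dotv sp m0 mxs law G x.
have Mw := mean_batch_dotv sp m0 mxs law w x.
have b1 : 0 <= C * (3 / (4 * L2)) + a * mu / 2 + a ^+ 2 * (6 * rho p n).
  rewrite a_sqr !addr_ge0 // ltW //; first by rewrite mulr_gt0 // divr_gt0 // mulr_gt0.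
    by rewrite divr_gt0 // mulr_gt0.
  by rewrite divr_gt0 // mulr_gt0.
have b2 : 0 <= C * (4 * L2)^-1 / n%:R + a ^+ 2 * (6 * rho p n / n%:R).
  rewrite [a ^+ 2 * _]mulrA a_sqr addr_ge0 // ltW //.
    by rewrite divr_gt0 // divr_gt0 // mulr_gt0.
  by rewrite divr_gt0 // divr_gt0 // mulr_gt0.
have M0 := mean_eq_le (mean_eq_cst Pr (C * (f x - f xstar) + fenchel_gap p xstar ys.2
   + a / (2 * mu) * (dotv w w / n%:R) + C * (8 * L2)^-1 * (dotv G G / n%:R))).
have M := mean_leD (mean_leD M0 (mean_leD (mean_leZ b1 Mz) (mean_leZ b2 Mh)))
  (mean_eq_le (mean_eqD (mean_eqZ (- (C * (2 * L2)^-1 / n%:R)) MG) (mean_eqZ (- (a / n%:R)) Mw))).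
apply: mean_le_trans (mean_le_eq _ M); last first.
  move=> v; rewrite /direction_average.
  move: (batch_gradient _ _ _ _) (slope_error _ _ _ _ _) => b z.
  move: (dotv G b) (dotv w b) (dotv b b) (dotv w w) (dotv G G) (fenchel_gap _ _ _) => *.
  by rewrite /=; ring.
rewrite -/G -/V -/B2 [a ^+ 2 * (6 * rho p n / _)]mulrA a_sqr.
have aal : a = al * n%:R by [].
have gw := fenchel_gap_strong p n8 xstar ys.2.
have gw' : dotv w w / 2 <= fenchel_gap p xstar ys.2.
  have wN : xstar - mirror p ys.2 = - w by rewrite /w opprB.
  by apply: le_trans gw; rewrite wN dotvNl dotvNr opprK.
have cb := coupling_bound.
have al0 : 0 < al.
  by rewrite alE; apply: divr_gt0; [exact: mulr_gt0 | rewrite ltr_wpDl].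
have Dp : 0 <= al / mu by rewrite divr_ge0 ?ltW.
have gw2 := ler_wpM2l Dp gw'.
have pf : 0 <= al / mu * (k%:R * (k%:R + 2) / (2 * scale_Q) * (f ys.1 - f xstar)).
  apply: mulr_ge0 => //; apply: mulr_ge0; last by rewrite subr_ge0.
  apply: divr_ge0; first by rewrite mulr_ge0 ?addr_ge0.
  by apply: mulr_ge0 => //; rewrite ltW // scale_Q_gt0.
rewrite /step_bound /potential aal.
move: pf gw2 cb.
move: (k%:R * (k%:R + 2) / (2 * scale_Q) * (f ys.1 - f xstar)) (f x - f xstar) => Y FX.
move: (fenchel_gap _ _ _) (dotv w w) (dotv G G) (dotv w G) => gap W2 G2 ip pf gw2 cb.
have -> : al * n%:R / (2 * mu) * (W2 / n%:R) = al / mu * (W2 / 2).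
  by field; rewrite !gt_eqF.
have e2 : - (al * n%:R / n%:R * ip) = - (al * ip) by rewrite mulfK // gt_eqF.
rewrite !mulNr e2 -subr_ge0.
(* The squared gradients cancel, as 1/8 + 1/4 + 1/8 = 1/2 in units of C / L2. What is left is the
   slack of the coupling, the extra term [al / mu * Y], and the slack of strong convexity, which
   absorbs the distance term of Young's inequality. *)
have -> : (1 + al / mu) * (Y + gap) + al * n%:R * mu / 2 * B2 +
   C / (8 * L2) * (3 * V / n%:R + 7 * B2) - (C * FX + gap + al / mu * (W2 / 2) +
   C / (8 * L2) * (G2 / n%:R) + ((C * (3 / (4 * L2)) + al * n%:R * mu / 2 + C / (8 * L2)) * B2 +
   (C / (4 * L2) / n%:R + C / (8 * L2) / n%:R) * (G2 + V)) +
   (- (C / (2 * L2) / n%:R * G2) - al * ip)) =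
   (Y - (C * FX - al * ip)) + al / mu * Y + (al / mu * gap - al / mu * (W2 / 2)).
  by field; rewrite !gt_eqF.
by apply: addr_ge0; [apply: addr_ge0 => //|]; rewrite subr_ge0.
Qed.

End fixed_state.
End expected_step.

Section events.
Context {R : realType} {d d'} {Omega : measurableType d} {T : measurableType d'}.
Variables (Y : Omega -> T).

Lemma events_ofI : setI_closed (events_of Y).
Proof.
move=> _ _ [A mA <-] [B mB <-]; exists (A `&` B); first exact: measurableI.
by rewrite !setTI preimage_setI.
Qed.

Lemma events_ofT : events_of Y setT.
Proof. by exists setT => //; rewrite setTI preimage_setT. Qed.

Lemma events_of_measurable : measurable_fun setT Y -> events_of Y `<=` measurable.
Proof. by move=> mY _ [B mB <-]; exact: mY. Qed.

Lemma measurable_sigma_events (G : set (set Omega)) : events_of Y `<=` G ->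
  measurable_fun setT (Y : g_sigma_algebraType G -> T).
Proof.
move=> YG _ B mB; rewrite setTI; apply: sub_sigma_algebra; apply: YG.
by exists B => //; rewrite setTI.
Qed.

End events.

Lemma measurable_dual_iter {R : realType} {n : nat} {dX} {X : measurableType dX}
    (F eta : 'rV[R]_n -> X -> R) (p m : nat) (L2 t : R) {d} {T : measurableType d}
    (e : nat -> T -> 'rV[R]_n) (xi : nat -> nat -> T -> X) ys0 (k : nat) :
  measurable_fun setT (fun z : rVborel R n * X => F z.1 z.2) ->
  measurable_fun setT (fun z : rVborel R n * X => eta z.1 z.2) ->
  (forall j, (j < k)%N -> measurable_fun setT (e j : T -> rVborel R n)) ->
  (forall j i, (j < k)%N -> (i < m)%N -> measurable_fun setT (xi j i)) ->
  let st w := dual_iter F eta p m L2 t (e ^~ w) (fun j i => xi j i w) ys0 k in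
  measurable_fun setT (fun w => (st w).1 : rVborel R n) /\
  measurable_fun setT (fun w => (st w).2 : rVborel R n).
Proof.
move=> mF meta; elim: k => [|k ih] me mxi st; first by split; exact: measurable_cst.
have [m1 m2] := ih (fun j jk => me j (ltnW jk)) (fun j i jk => mxi j i (ltnW jk)).
exact: (@measurable_dual_step R n dX X F eta p m L2 t mF meta d T k (e k) _ _ (xi k)
  (me k (leqnn _)) m1 m2 (fun i => mxi k i (leqnn _))).
Qed.

Section random_iteration.
Context {R : realType} {n : nat} {dX : measure_display} {X : measurableType dX}.
Variables (P : probability X R) (F : 'rV[R]_n -> X -> R) (g : 'rV[R]_n -> X -> 'rV[R]_n)
    (L : X -> R) (f : 'rV[R]_n -> R) (eta : 'rV[R]_n -> X -> R)
    (L2 sigma Delta t : R) (p N m : nat) (xstar : 'rV[R]_n).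
Hypotheses (n8 : (8 <= n)%N) (p12 : p = 1%N \/ p = 2%N).
Hypothesis sp : stochastic_problem P F g L f L2 sigma.
Hypothesis bn : bounded_noise P eta Delta.
Hypotheses (t0 : 0 < t) (m0 : (0 < m)%N).
Hypothesis fmin : minimizer f xstar.
Context {dO : measure_display} {Omega : measurableType dO}.
Variables (Pr : probability Omega R)
  (e : nat -> Omega -> 'rV[R]_n) (xi : nat -> nat -> Omega -> X).
Hypothesis alg : algorithm_randomness P Pr N m e xi.

Let index := ('I_N + 'I_N * 'I_m)%type.

Let G (s : index) : set (set Omega) :=
  match s with
  | inl k => events_of (e k : Omega -> rVborel R n)
  | inr (k, i) => events_of (xi k i)
  end.

Let mG s : G s `<=` measurable.
Proof.
case: s => [k|[k i]]; apply: events_of_measurable.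
  exact: (measurable_direction alg (ltn_ord k)).
exact: (measurable_sample alg (ltn_ord k) (ltn_ord i)).
Qed.

Let IG s : setI_closed (G s).
Proof. by case: s => [k|[k i]]; exact: events_ofI. Qed.

Let TG s : G s setT.
Proof. by case: s => [k|[k i]]; exact: events_ofT. Qed.

Let indep : mutually_independent Pr G := independent_draws alg.

Let past (k : nat) : {set index} := finset (fun s : index =>
  match s with inl j => (j < k)%N | inr (j, _) => (j < k)%N end).
Let direction (k : nat) : {set index} := finset (fun s : index =>
  match s with inl j => j == k :> nat | inr _ => false end).
Let batch (k : nat) : {set index} := finset (fun s : index =>
  match s with inl _ => false | inr (j, _) => j == k :> nat end).
Let fresh (k : nat) : {set index} := finset (fun s : index =>
  match s with inl j => j == k :> nat | inr (j, _) => j == k :> nat end).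

(** [Omega] seen through the draws indexed by [J] only. *)
Let Om J := g_sigma_algebraType (product_system G J).

Let measurable_e (J : {set index}) (k : 'I_N) : inl k \in J ->
  measurable_fun setT (e k : Om J -> rVborel R n).
Proof.
by move=> kJ; apply: measurable_sigma_events; exact: (product_system_sub TG kJ).
Qed.

Let measurable_xi (J : {set index}) (k : 'I_N) (i : 'I_m) : inr (k, i) \in J ->
  measurable_fun setT (xi k i : Om J -> X).
Proof.
by move=> kJ; apply: measurable_sigma_events; exact: (product_system_sub TG kJ).
Qed.

Let good := good_sample F g L eta Delta.

Let ae_good (k : nat) : (k < N)%N ->
  {ae Pr, forall w, forall i, (i < m)%N -> good (xi k i w)}.
Proof.
move=> kN; have hg : {ae P, forall x, good x}.
  by apply: filterS2 (descent_sample sp) (noise_le bn) => x h1 h2; split.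
apply: ae_foralln => i; have [im|im] := ltnP i m; last by apply: aeW.
have h : {ae Pr, forall w, good (xi k i w)}.
  apply: (ae_law _ _ hg); first exact: (measurable_sample alg kN im).
  by move=> B mB; exact: (sample_law alg kN im mB).
by apply: filterS h.
Qed.

(** The direction is integrated first, with the batch frozen at an almost surely good one, and the
    batch afterwards; the state [ys] is deterministic. *)
Lemma fresh_step_bound (k : nat) (ys : 'rV[R]_n * 'rV[R]_n) (mu : R) :
  (k < N)%N -> 0 < mu ->
  (\int[Pr]_w (potential f L2 p xstar k.+1
      (dual_step F eta p m L2 t k (e k w) (xi k ^~ w) ys))%:E
    <= (step_bound f L2 sigma Delta t p m xstar k ys mu)%:E)%E.
Proof.
move=> kN mu0; pose k' := Ordinal kN.
pose phi (z : Om (batch k) * Om (direction k)) : \bar R :=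
  (potential f L2 p xstar k.+1
      (dual_step F eta p m L2 t k (e k z.2) (fun i => xi k i z.1) ys))%:E.
have kd : inl k' \in direction k by rewrite inE /=.
have kb (i : 'I_m) : inr (k', i) \in batch k by rewrite inE /=.
have mphi : measurable_fun setT phi.
  apply/measurable_EFinP.
  have [m1 m2] := @measurable_dual_step R n dX X F eta p m L2 t (measurable_obj sp)
    (measurable_noise bn) _ (Om (batch k) * Om (direction k))%type k (fun z => e k z.2)
    (cst ys.1) (cst ys.2) (fun i z => xi k i z.1)
    (measurableT_comp (measurable_e kd) measurable_snd) (measurable_cst _) (measurable_cst _)
    (fun i im => measurableT_comp (measurable_xi (kb (Ordinal im))) measurable_fst).
  have := measurable_potential p xstar sp k.+1 m1 m2.
  by rewrite /=; case: (ys).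
apply: (@sigma_tonelli_le R _ Omega Pr (product_system G (batch k))
  (product_system G (direction k)) phi _ _) => //.
- exact: product_system_measurable.
- exact: product_systemI.
- exact: product_systemT.
- exact: product_system_measurable.
- exact: product_systemI.
- exact: product_systemT.
- by apply: product_system_independent => // -[j|[j i]]; rewrite !inE.
- by move=> z; rewrite lee_fin; exact: (potential_ge0 n8 p12 sp fmin).
- apply: filterS (ae_good kN) => w gw.
  exact: (direction_bound n8 p12 sp bn t0 fmin k ys mu0
    (measurable_direction alg kN) (direction_law alg kN) gw).
- apply: (batch_bound Delta n8 p12 sp t0 m0 fmin k ys mu0).
  + by move=> i im; exact: (measurable_sample alg kN im).
  + by move=> i B im mB; exact: (sample_law alg kN im mB).
  + move=> i j A B im jm ij mA mB.
    pose i' := Ordinal im; pose j' := Ordinal jm.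
    have hij : forall s, s \in [set inr (k', i')]%SET -> s \notin [set inr (k', j') : index]%SET.
      move=> s; rewrite !finset.in_set1 => /eqP ->; apply/eqP => -[] /eqP.
      by rewrite (negbTE ij).
    apply: (product_system_independent indep hij).
      apply: (product_system_sub TG (i := inr (k', i'))); first by rewrite finset.set11.
      by exists A => //; rewrite setTI.
    apply: (product_system_sub TG (i := inr (k', j'))); first by rewrite finset.set11.
    by exists B => //; rewrite setTI.
Qed.

(** The state depends on the past draws only and the step on the fresh ones. After the fresh draws
    are integrated out, [step_bound] is affine in the potential of the state with a nonnegative
    slope, so the bound on its mean carries over. *)
Lemma recursion_step (k : nat) (ys0 : 'rV[R]_n * 'rV[R]_n) (mu Phi : R) :
  let iterate k w := dual_iter F eta p m L2 t (e ^~ w) (fun j i => xi j i w) ys0 k in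
  (k < N)%N -> 0 < mu ->
  mean_le Pr (fun w => potential f L2 p xstar k (iterate k w)) Phi ->
  mean_le Pr (fun w => potential f L2 p xstar k.+1 (iterate k.+1 w))
    ((1 + alpha p n L2 k.+1 / mu) * Phi
     + alpha p n L2 k.+1 * n%:R * mu / 2 * (t ^+ 2 * L2 ^+ 2 / 2 + 8 * Delta ^+ 2 / t ^+ 2)
     + (k%:R + 2) ^+ 2 / (2 * @scale_Q R n L2 p) / (8 * L2)
       * (3 * (sigma ^+ 2 / m%:R) / n%:R
          + 7 * (t ^+ 2 * L2 ^+ 2 / 2 + 8 * Delta ^+ 2 / t ^+ 2))).
Proof.
move=> iterate kN mu0 hk.
have mk : measurable_fun setT (fun w => potential f L2 p xstar k.+1 (iterate k.+1 w)).
  have [m1 m2] := @measurable_dual_iter R n dX X F eta p m L2 t dO Omega e xi ys0 k.+1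
    (measurable_obj sp) (measurable_noise bn)
    (fun j jk => measurable_direction alg (leq_trans jk kN))
    (fun j i jk im => measurable_sample alg (leq_trans jk kN) im).
  have := measurable_potential p xstar sp k.+1 m1 m2.
  by congr (measurable_fun _ _); apply/funext => w /=; rewrite -surjective_pairing.
apply: ge0_mean_le => //.
  by move=> w; exact: (potential_ge0 n8 p12 sp fmin).
pose k' := Ordinal kN.
pose phi (z : Om (past k) * Om (fresh k)) : \bar R :=
  (potential f L2 p xstar k.+1
      (dual_step F eta p m L2 t k (e k z.2) (fun i => xi k i z.2) (iterate k z.1)))%:E.
have ed : inl k' \in fresh k by rewrite inE /=.
have xd (i : 'I_m) : inr (k', i) \in fresh k by rewrite inE /=.
have ep j (jk : (j < k)%N) : inl (Ordinal (ltn_trans jk kN)) \in past k by rewrite inE /=.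
have xp j (jk : (j < k)%N) (i : 'I_m) : inr (Ordinal (ltn_trans jk kN), i) \in past k.
  by rewrite inE /=.
have mphi : measurable_fun setT phi.
  apply/measurable_EFinP.
  have [i1 i2] := @measurable_dual_iter R n dX X F eta p m L2 t _ (Om (past k)) e xi ys0 k
    (measurable_obj sp) (measurable_noise bn)
    (fun j jk => measurable_e (ep j jk))
    (fun j i jk im => measurable_xi (xp j jk (Ordinal im))).
  have [m1 m2] := @measurable_dual_step R n dX X F eta p m L2 t (measurable_obj sp)
    (measurable_noise bn) _ (Om (past k) * Om (fresh k))%type k (fun z => e k z.2)
    (fun z => (iterate k z.1).1) (fun z => (iterate k z.1).2) (fun i z => xi k i z.2)
    (measurableT_comp (measurable_e ed) measurable_snd)
    (measurableT_comp i1 measurable_fst) (measurableT_comp i2 measurable_fst)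
    (fun i im => measurableT_comp (measurable_xi (xd (Ordinal im))) measurable_snd).
  have := measurable_potential p xstar sp k.+1 m1 m2.
  by congr (measurable_fun _ _); apply/funext => w /=; rewrite -!surjective_pairing.
apply: (@sigma_tonelli_le R _ Omega Pr (product_system G (past k))
  (product_system G (fresh k)) phi
  (fun w => step_bound f L2 sigma Delta t p m xstar k (iterate k w) mu) _) => //.
- exact: product_system_measurable.
- exact: product_systemI.
- exact: product_systemT.
- exact: product_system_measurable.
- exact: product_systemI.
- exact: product_systemT.
- apply: product_system_independent => // -[j|[j i]]; rewrite !inE /=.
    by move=> jk; rewrite neq_ltn jk.
  by move=> jk; rewrite neq_ltn jk.
- by move=> z; rewrite lee_fin; exact: (potential_ge0 n8 p12 sp fmin).
- by apply: aeW => w; exact: (fresh_step_bound (iterate k w) kN mu0).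
- have al0 : 0 <= 1 + alpha p n L2 k.+1 / mu.
    rewrite addr_ge0 // divr_ge0 ?(ltW mu0) // /alpha.
    by rewrite divr_ge0 // ltW // (scale_Q_gt0 n8 p12 sp).
  rewrite -addrA.
  apply: (mean_le_eq _ (mean_leD (mean_leZ al0 hk) (mean_eq_le (mean_eq_cst Pr _)))).
  by move=> w; rewrite /= /step_bound -[RHS]addrA.
Qed.

End random_iteration.

(** * Parameters *)

Section dimension_cost.
Context {R : realType} (p n : nat).
Hypotheses (n8 : (8 <= n)%N) (p12 : p = 1%N \/ p = 2%N).

(* n^2 rho_n up to a universal factor. *)
Definition dim_cost : R := if p == 1%N then n%:R * ln n%:R else n%:R ^+ 2.

Let n0 : 0 < n%:R :> R. Proof. by rewrite ltr0n (leq_trans _ n8). Qed.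

Lemma dim_cost_gt0 : 0 < dim_cost.
Proof.
have := ln_ge32 (R := R) n8; rewrite /dim_cost.
case: p12 => -> /= h; last by rewrite exprn_gt0.
by rewrite mulr_gt0 //; lra.
Qed.

Let rho_dim : n%:R ^+ 2 * rho p n = if p == 1%N then n%:R * (16 * ln n%:R - 8) else n%:R ^+ 2 :> R.
Proof.
by case: p12 => -> /=; [rewrite rho1; field; rewrite gt_eqF | rewrite rho2 // mulr1].
Qed.

Lemma dim_cost_le : dim_cost <= n%:R ^+ 2 * rho p n.
Proof.
have := ln_ge32 (R := R) n8; rewrite rho_dim /dim_cost.
case: p12 => -> //= h; apply: ler_wpM2l; first exact: ltW.
by lra.
Qed.

Lemma le_dim_cost : n%:R ^+ 2 * rho p n <= 16 * dim_cost.
Proof.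
have := ln_ge32 (R := R) n8; rewrite rho_dim /dim_cost.
case: p12 => -> //= h.
  rewrite mulrCA; apply: ler_wpM2l; first exact: ltW.
  by lra.
by have : 0 < n%:R ^+ 2 :> R by [rewrite exprn_gt0]; lra.
Qed.

Section scales.
Variables (L2 sigma Theta eps : R).
Hypotheses (L0 : 0 < L2) (T0 : 0 < Theta) (e0 : 0 < eps).

(** With [K] and the square root [E] of [eps], the iteration and batch scales and the first
    smoothing bound involve no fractional powers and take the same form for both values of [p]. *)
Let K : R := Num.sqrt (dim_cost * L2 * Theta).
Let E : R := Num.sqrt eps.

Let K2 : 0 < dim_cost * L2 * Theta. Proof. by rewrite !mulr_gt0 // dim_cost_gt0. Qed.
Let K0 : 0 < K. Proof. by rewrite sqrtr_gt0. Qed.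
Let E0 : 0 < E. Proof. by rewrite sqrtr_gt0. Qed.
Let nT0 : 0 < n%:R * Theta. Proof. by rewrite mulr_gt0. Qed.

Lemma iter_scaleE : iter_scale p n L2 Theta eps = K / E.
Proof.
rewrite /K /E -sqrtrV ?(ltW e0) // -sqrtrM ?(ltW K2) // /iter_scale /dim_cost.
by case: (p == 1%N).
Qed.

Let sqr_powR (x r : R) : (x `^ r) ^+ 2 = x `^ (r * 2).
Proof. by rewrite -powR_mulrn ?powR_ge0 // -powRrM. Qed.

Let eps32 : eps `^ (3 / 2) = E ^+ 3.
Proof. by rewrite [3 / 2]mulrC powRrM powR12_sqrt ?(ltW e0) // powR_mulrn ?sqrtr_ge0. Qed.

Let ratio : R := sigma ^+ 2 * K / (E ^+ 3 * n%:R * L2).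

Lemma batch_scaleE : batch_scale p n L2 sigma Theta eps = Num.max 1 ratio.
Proof.
rewrite /batch_scale eps32 /ratio.
have sE (D : R) : 0 < D -> dim_cost * L2 * Theta = (n%:R * L2) ^+ 2 * D ->
    Num.sqrt D = K / (n%:R * L2).
  move=> D0 De; rewrite /K De sqrtrM ?sqr_ge0 // sqrtr_sqr gtr0_norm ?mulr_gt0 //.
  by field; rewrite !gt_eqF.
have h := ln_ge32 (R := R) n8.
have l0 : 0 < ln n%:R :> R by lra.
case: p12 => pE; rewrite pE /=; congr (Num.max _ _).
  rewrite (sE (Theta * ln n%:R / (n%:R * L2))); first by field; rewrite !gt_eqF.
    by rewrite !(mulr_gt0, invr_gt0).
  by rewrite /dim_cost pE /=; field; rewrite !gt_eqF.
rewrite (sE (Theta / L2)); first by field; rewrite !gt_eqF.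
  by rewrite divr_gt0.
by rewrite /dim_cost pE /=; field; rewrite !gt_eqF.
Qed.

(** The maximum in the batch scale distributes over the product with the iteration scale, so the
    bound on the number of calls loses nothing beyond the constants. *)
Lemma call_scaleE : call_scale p n L2 sigma Theta eps =
  iter_scale p n L2 Theta eps * batch_scale p n L2 sigma Theta eps.
Proof.
rewrite batch_scaleE iter_scaleE maxr_pMr ?divr_ge0 ?sqrtr_ge0 // mulr1.
have e2 : eps = E ^+ 2 by rewrite sqr_sqrtr // ltW.
have -> : K / E * ratio = K ^+ 2 * sigma ^+ 2 / (eps ^+ 2 * n%:R * L2).
  rewrite /ratio e2; move: E0 => EE0; move: (E) (K) EE0 => E' K' E'0.
  by field; rewrite !gt_eqF.
rewrite -iter_scaleE /call_scale /iter_scale /K sqr_sqrtr ?(ltW K2) // /dim_cost.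
by case: (p == 1%N); congr (Num.max _ _); field; rewrite !gt_eqF.
Qed.

Let T1 := eps `^ (3 / 4) / (L2 ^+ 2 * (dim_cost * L2 * Theta)) `^ (1 / 4).
Let T2 := eps / (L2 * Num.sqrt (n%:R * Theta)).

Let T1_gt0 : 0 < T1.
Proof. by rewrite divr_gt0 ?powR_gt0 // mulr_gt0 // exprn_gt0. Qed.

Let T2_gt0 : 0 < T2.
Proof. by rewrite divr_gt0 // mulr_gt0 // sqrtr_gt0. Qed.

Let T1_sqr : T1 ^+ 2 = E ^+ 3 / (L2 * K).
Proof.
have X0 : 0 <= L2 ^+ 2 * (dim_cost * L2 * Theta) by rewrite mulr_ge0 ?sqr_ge0 // ltW.
rewrite /T1 expr_div_n !sqr_powR.
have -> : 3 / 4 * 2 = 3 / 2 :> R by field.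
have -> : 1 / 4 * 2 = 2^-1 :> R by field.
by rewrite eps32 powR12_sqrt // sqrtrM ?sqr_ge0 // sqrtr_sqr gtr0_norm.
Qed.

Let T2_sqr : T2 ^+ 2 = eps ^+ 2 / (L2 ^+ 2 * (n%:R * Theta)).
Proof. by rewrite /T2 expr_div_n exprMn sqr_sqrtr // ltW. Qed.

Lemma smoothing_scaleE : smoothing_scale p n L2 Theta eps = Num.min T1 T2.
Proof.
rewrite /smoothing_scale /T1 /T2 /dim_cost.
by case: (p == 1%N); do !congr (Num.min _ _); congr (_ / _ `^ _); ring.
Qed.

Lemma smoothing_scale_gt0 : 0 < smoothing_scale p n L2 Theta eps.
Proof. by rewrite smoothing_scaleE lt_min T1_gt0 T2_gt0. Qed.

Let min_sqr_l (a b : R) : 0 < a -> 0 < b -> Num.min a b ^+ 2 <= a ^+ 2.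
Proof.
by move=> a0 b0; rewrite ler_sqr ?ge_min ?lexx // nnegrE ?le_min ltW //= ltW.
Qed.

Lemma smoothing_scale_sqr_le1 : smoothing_scale p n L2 Theta eps ^+ 2 <= E ^+ 3 / (L2 * K).
Proof. by rewrite smoothing_scaleE -T1_sqr min_sqr_l. Qed.

Lemma smoothing_scale_sqr_le2 :
  smoothing_scale p n L2 Theta eps ^+ 2 <= eps ^+ 2 / (L2 ^+ 2 * (n%:R * Theta)).
Proof. by rewrite smoothing_scaleE -T2_sqr minC min_sqr_l. Qed.

(** The noise scale is the minimum of L2 T1^2 and L2 T2^2 for the two candidates of the smoothing
    scale; this is the balance between a smoothing error of order t L2 and a noise error of order
    Delta / t. *)
Lemma noise_scale_le : noise_scale p n L2 Theta eps <= L2 * smoothing_scale p n L2 Theta eps ^+ 2.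
Proof.
have -> : noise_scale p n L2 Theta eps = Num.min (L2 * T1 ^+ 2) (L2 * T2 ^+ 2).
  rewrite T1_sqr T2_sqr /noise_scale eps32 /K.
  have nn : n%:R = Num.sqrt (n%:R ^+ 2) :> R by rewrite sqrtr_sqr gtr0_norm.
  have e1 : L2 * (E ^+ 3 / (L2 * Num.sqrt (dim_cost * L2 * Theta)))
      = E ^+ 3 / Num.sqrt (dim_cost * L2 * Theta).
    by move: K0; rewrite -/K; move: (K) (E) => K' E' K'0; field; rewrite !gt_eqF.
  have e2 : L2 * (eps ^+ 2 / (L2 ^+ 2 * (n%:R * Theta))) = eps ^+ 2 / (n%:R * L2 * Theta).
    by field; rewrite !gt_eqF.
  rewrite e1 e2 /dim_cost; case: (p == 1%N); congr (Num.min (_ / _) _).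
    by congr Num.sqrt; ring.
  by rewrite {1}nn -sqrtrM ?sqr_ge0 // mulrA.
rewrite smoothing_scaleE; have [h|h] := leP T1 T2.
  by rewrite ge_min lexx.
by rewrite ge_min lexx orbT.
Qed.

End scales.
End dimension_cost.

(** The budget of one step is Th / N. The growth term and the two error terms take at most the
    shares 1/6, 1/6 and 1/3 of it. For the first two, mu = c^2 Th / eps reduces the claim to the
    upper bound on N^2 eps; the third needs the two bounds with N^3. *)
Lemma potential_increment {R : realFieldType} (c H h L2 Th eps N K n V B2 : R) :
  0 < c -> 0 < n -> 0 < L2 -> 0 < Th -> 0 < eps -> 0 < h -> h <= H -> 1 <= N -> 0 <= K -> K + 1 <= N ->
  0 <= V -> 0 <= B2 ->
  N ^+ 2 * eps <= 4 * c ^+ 2 * (h * L2 * Th) ->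
  B2 <= 4 / c ^+ 4 * (eps ^+ 2 / (n * Th)) ->
  N ^+ 3 * V <= 8 * (h * L2 ^+ 2 * Th * n) ->
  N ^+ 3 * B2 <= 2 / 5 * (h * L2 ^+ 2 * Th) ->
  forall Q al mu : R, Q = 96 * H * L2 -> al = (K + 2) / Q -> mu = c ^+ 2 * Th / eps ->
  (1 + al / mu) * (Th * (1 + K / N)) + al * n * mu / 2 * B2
    + (K + 2) ^+ 2 / (2 * Q) / (8 * L2) * (3 * V / n + 7 * B2)
  <= Th * (1 + (K + 1) / N).
Proof.
move=> c0 n0 L0 T0 e0 h0 hH N1 K0 KN V0 B0 hN hB hV hB3 Q al mu QE alE muE.
have N0 := lt_le_trans ltr01 N1.
have H0 := lt_le_trans h0 hH.
have Q0 : 0 < Q by rewrite QE !mulr_gt0.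
have mu0 : 0 < mu by rewrite muE !divr_gt0 // !mulr_gt0.
have K2 : K + 2 <= 2 * N by clear -N1 KN; lra.
have K20 : 0 <= K + 2 by rewrite addr_ge0.
have al0 : 0 <= al by rewrite alE divr_ge0 // ltW.
have al1 : al <= 2 * N / Q by rewrite alE ler_pM2r ?invr_gt0.
have hQ : h * L2 <= Q / 96.
  have -> : Q / 96 = H * L2 by rewrite QE; field.
  by rewrite ler_pM2r.
have hLT : h * L2 * Th <= Q / 96 * Th by rewrite ler_pM2r.
have NNe : N * eps <= 4 * c ^+ 2 * (Q / 96 * Th) / N.
  rewrite ler_pdivlMr //; have -> : N * eps * N = N ^+ 2 * eps by ring.
  by apply: (le_trans hN); rewrite ler_pM2l ?mulr_gt0 ?exprn_gt0.
have t1 : al / mu * (Th * (1 + K / N)) <= Th / (6 * N).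
  have kN : Th * (1 + K / N) <= Th * 2.
    have kn : K / N <= 1 by rewrite ler_pdivrMr // mul1r (le_trans _ KN) // lerDl.
    by rewrite ler_pM2l // lerD2l.
  have h1 : al / mu <= 2 * N / Q / mu by rewrite ler_pM2r ?invr_gt0.
  have h2 : 0 <= al / mu by rewrite divr_ge0 // ltW.
  have h3 : 0 <= Th * (1 + K / N).
    by apply: mulr_ge0; [exact: ltW | apply: addr_ge0 => //; apply: divr_ge0 => //; exact: ltW].
  apply: (le_trans (ler_pM h2 h3 h1 kN)).
  have -> : 2 * N / Q / mu * (Th * 2) = 4 * (N * eps) / (c ^+ 2 * Q).
    by rewrite muE; move: Q0 => /gt_eqF q0; field; rewrite q0 !gt_eqF.
  rewrite ler_pdivrMr ?mulr_gt0 ?exprn_gt0 //.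
  apply: (@le_trans _ _ (4 * (4 * c ^+ 2 * (Q / 96 * Th) / N))); first by rewrite ler_pM2l.
  rewrite le_eqVlt; apply/orP; left; apply/eqP.
  by move: (Q) => q; field; rewrite gt_eqF.
have t2 : al * n * mu / 2 * B2 <= Th / (6 * N).
  have h1 : al * n * mu / 2 <= 2 * N / Q * n * mu / 2.
    by rewrite ler_pM2r ?invr_gt0 // ler_pM2r // ler_pM2r.
  have h2 : 0 <= al * n * mu / 2.
    by apply: divr_ge0 => //; apply: mulr_ge0; [apply: mulr_ge0 => //; exact: ltW | exact: ltW].
  apply: (le_trans (ler_pM h2 B0 h1 hB)).
  have -> : 2 * N / Q * n * mu / 2 * (4 / c ^+ 4 * (eps ^+ 2 / (n * Th))) =
      4 * (N * eps) / (c ^+ 2 * Q).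
    by rewrite muE; move: Q0 => /gt_eqF q0; field; rewrite q0 !gt_eqF.
  rewrite ler_pdivrMr ?mulr_gt0 ?exprn_gt0 //.
  apply: (@le_trans _ _ (4 * (4 * c ^+ 2 * (Q / 96 * Th) / N))); first by rewrite ler_pM2l.
  rewrite le_eqVlt; apply/orP; left; apply/eqP.
  by move: (Q) => q; field; rewrite gt_eqF.
have q1 : 0 < (16 * Q * L2)^-1 by rewrite invr_gt0 !mulr_gt0.
have t3 : (K + 2) ^+ 2 / (2 * Q) / (8 * L2) * (3 * V / n + 7 * B2) <= Th / (3 * N).
  have h1 : (K + 2) ^+ 2 / (2 * Q) / (8 * L2) <= (2 * N) ^+ 2 * (16 * Q * L2)^-1.
    have -> : (K + 2) ^+ 2 / (2 * Q) / (8 * L2) = (K + 2) ^+ 2 * (16 * Q * L2)^-1.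
      by move: Q0 => /gt_eqF q0; field; rewrite q0 gt_eqF.
    by rewrite ler_pM2r // ler_sqr ?nnegrE // mulr_ge0 // ltW.
  have h3 : 0 <= 3 * V / n + 7 * B2.
    by apply: addr_ge0; [apply: divr_ge0; [exact: mulr_ge0 | exact: ltW] | exact: mulr_ge0].
  apply: (le_trans (ler_wpM2r h3 h1)).
  rewrite -(ler_pM2l N0).
  have -> : N * ((2 * N) ^+ 2 * (16 * Q * L2)^-1 * (3 * V / n + 7 * B2)) =
     (12 * (N ^+ 3 * V) / n + 28 * (N ^+ 3 * B2)) * (16 * Q * L2)^-1.
    by move: ((16 * Q * L2)^-1) => q; field; rewrite gt_eqF.
  have -> : N * (Th / (3 * N)) = Th / 3 by field; rewrite gt_eqF.
  rewrite -/(_ / _) ler_pdivrMr ?mulr_gt0 //.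
  have v1 : 12 * (N ^+ 3 * V) / n <= 96 * (h * L2 * Th) * L2.
    rewrite ler_pdivrMr //.
    have -> : 96 * (h * L2 * Th) * L2 * n = 12 * (8 * (h * L2 ^+ 2 * Th * n)) by ring.
    by rewrite ler_pM2l.
  have v2 : 28 * (N ^+ 3 * B2) <= 28 * (2 / 5) * (h * L2 * Th) * L2.
    have -> : 28 * (2 / 5) * (h * L2 * Th) * L2 = 28 * (2 / 5 * (h * L2 ^+ 2 * Th)) by ring.
    by rewrite ler_pM2l.
  apply: (le_trans (lerD v1 v2)).
  have -> : Th / 3 * (16 * Q * L2) = 512 * (Q / 96 * Th) * L2 by field.
  rewrite -mulrDl ler_pM2r // -mulrDl.
  have p0 : 0 < Q / 96 * Th by rewrite mulr_gt0 // divr_gt0.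
  move: hLT p0; move: (Q / 96 * Th) (h * L2 * Th) => u v uv u0; clear -uv u0; lra.
have -> : Th * (1 + (K + 1) / N) = Th * (1 + K / N) + Th / N by field; rewrite gt_eqF.
rewrite mulrDl mul1r -!addrA lerD2l addrA.
apply: (le_trans (lerD (lerD t1 t2) t3)).
(* The three shares add up to 2 / 3 of the budget. *)
rewrite (_ : Th / (6 * N) + Th / (6 * N) + Th / (3 * N) = 2 / 3 * (Th / N)); last first.
  by field; rewrite gt_eqF.
have : 0 < Th / N by rewrite divr_gt0.
by move: (Th / N) => u u0; clear -u0; lra.
Qed.

(** * Parameter choice and the final gap *)

Section gap.
Context {R : realType} {n : nat} {dX : measure_display} {X : measurableType dX}.
Variables (P : probability X R) (F : 'rV[R]_n -> X -> R) (g : 'rV[R]_n -> X -> 'rV[R]_n)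
    (L : X -> R) (f : 'rV[R]_n -> R) (eta : 'rV[R]_n -> X -> R)
    (c L2 sigma Delta Theta eps t : R) (p N m : nat) (xstar : 'rV[R]_n).
Hypotheses (n8 : (8 <= n)%N) (p12 : p = 1%N \/ p = 2%N) (c80 : 80 <= c).
Hypothesis sp : stochastic_problem P F g L f L2 sigma.
Hypothesis bn : bounded_noise P eta Delta.
Hypothesis fmin : minimizer f xstar.
Hypotheses (Theta0 : 0 < Theta) (eps0 : 0 < eps) (Delta0 : 0 < Delta).
Hypothesis DeltaE : Delta = c ^- 4 * noise_scale p n L2 Theta eps.
Hypothesis tE : t = 2 / c ^+ 2 * smoothing_scale p n L2 Theta eps.
Hypotheses (N0 : (0 < N)%N) (m0 : (0 < m)%N).
Hypothesis Nb : c * iter_scale p n L2 Theta eps <= N%:R <= 2 * c * iter_scale p n L2 Theta eps.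
Hypothesis mb : c ^+ 3 * batch_scale p n L2 sigma Theta eps <= m%:R.
Context {dO : measure_display} {Omega : measurableType dO}.
Variables (Pr : probability Omega R)
  (e : nat -> Omega -> 'rV[R]_n) (xi : nat -> nat -> Omega -> X).
Hypothesis alg : algorithm_randomness P Pr N m e xi.
Variables (ys0 : 'rV[R]_n * 'rV[R]_n).
Hypothesis gap0 : fenchel_gap p xstar ys0.2 <= Theta.

Let iterate k w := dual_iter F eta p m L2 t (e ^~ w) (fun j i => xi j i w) ys0 k.

Let L2p : 0 < L2. Proof. by case: sp. Qed.
Let np : 0 < n%:R :> R. Proof. by rewrite ltr0n (leq_trans _ n8). Qed.
Let Np : 0 < N%:R :> R. Proof. by rewrite ltr0n. Qed.
Let c0 : 0 < c. Proof. by apply: lt_le_trans c80; rewrite ltr0n. Qed.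
Let h : R := dim_cost p n.
Let h0 : 0 < h. Proof. exact: dim_cost_gt0. Qed.
Let K : R := Num.sqrt (h * L2 * Theta).
Let E : R := Num.sqrt eps.
Let K0 : 0 < K. Proof. by rewrite sqrtr_gt0 !mulr_gt0. Qed.
Let E0 : 0 < E. Proof. by rewrite sqrtr_gt0. Qed.
Let K2 : K ^+ 2 = h * L2 * Theta. Proof. by rewrite sqr_sqrtr // ltW // !mulr_gt0. Qed.
Let E2 : E ^+ 2 = eps. Proof. by rewrite sqr_sqrtr // ltW. Qed.
Let T : R := smoothing_scale p n L2 Theta eps.
Let T0 : 0 < T. Proof. exact: smoothing_scale_gt0. Qed.
Let V : R := sigma ^+ 2 / m%:R.
Let B2 : R := t ^+ 2 * L2 ^+ 2 / 2 + 8 * Delta ^+ 2 / t ^+ 2.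

Let t0 : 0 < t.
Proof. by rewrite tE mulr_gt0 // divr_gt0 // exprn_gt0. Qed.

Let N_ge : c * K <= N%:R * E.
Proof.
by have /andP[+ _] := Nb; rewrite iter_scaleE // mulrA ler_pdivrMr.
Qed.

Let N_le : N%:R * E <= 2 * c * K.
Proof.
by have /andP[_ +] := Nb; rewrite iter_scaleE // mulrA ler_pdivlMr.
Qed.

Let N3_le : (N%:R * E) ^+ 3 <= (2 * c * K) ^+ 3.
Proof. by rewrite lerXn2r // nnegrE ltW // !mulr_gt0. Qed.

(** The factors 2 / c^2 of [t] and c^(-4) of [Delta] make the smoothing part and the bound on the
    noise part equal, each 2 / c^4 times L2^2 T^2. *)
Let B2_le : B2 <= 4 / c ^+ 4 * (L2 ^+ 2 * T ^+ 2).
Proof.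
have D1 : Delta <= c ^- 4 * (L2 * T ^+ 2).
  by rewrite DeltaE ler_pM2l ?invr_gt0 ?exprn_gt0 // noise_scale_le.
have D2 : Delta ^+ 2 <= (c ^- 4 * (L2 * T ^+ 2)) ^+ 2.
  by rewrite lerXn2r // nnegrE ltW // (lt_le_trans Delta0).
have -> : 4 / c ^+ 4 * (L2 ^+ 2 * T ^+ 2) =
    t ^+ 2 * L2 ^+ 2 / 2 + 8 * (c ^- 4 * (L2 * T ^+ 2)) ^+ 2 / t ^+ 2.
  by rewrite tE -/T; move: T0; move: (T) => u u0; field; rewrite !gt_eqF.
by rewrite lerD2l ler_pM2r ?invr_gt0 ?exprn_gt0 // ler_pM2l.
Qed.

Let B2_small : B2 <= 4 / c ^+ 4 * (eps ^+ 2 / (n%:R * Theta)).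
Proof.
apply: (le_trans B2_le); rewrite ler_pM2l ?divr_gt0 ?exprn_gt0 //.
apply: (le_trans (ler_wpM2l (sqr_ge0 L2) (smoothing_scale_sqr_le2 n8 p12 L2p Theta0 eps0))).
by rewrite le_eqVlt; apply/orP; left; apply/eqP; field; rewrite !gt_eqF.
Qed.

Let N3B2 : N%:R ^+ 3 * B2 <= 2 / 5 * (h * L2 ^+ 2 * Theta).
Proof.
have h1 : B2 <= 4 / c ^+ 4 * (L2 * E ^+ 3 / K).
  apply: (le_trans B2_le); rewrite ler_pM2l ?divr_gt0 ?exprn_gt0 //.
  apply: (le_trans (ler_wpM2l (sqr_ge0 L2) (smoothing_scale_sqr_le1 n8 p12 L2p Theta0 eps0))).
  rewrite -/E -/h -/K.
  rewrite le_eqVlt; apply/orP; left; apply/eqP.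
  by move: K0; move: (E) (K) => E' K' K'0; field; rewrite !gt_eqF.
have N30 : 0 <= N%:R ^+ 3 :> R by rewrite exprn_ge0.
apply: (le_trans (ler_wpM2l N30 h1)).
have -> : N%:R ^+ 3 * (4 / c ^+ 4 * (L2 * E ^+ 3 / K)) =
   (N%:R * E) ^+ 3 * (4 / c ^+ 4 * L2 / K).
  by move: K0; move: (E) (K) (N%:R) => E' K' N' K'0; field; rewrite !gt_eqF.
have q0 : 0 < 4 / c ^+ 4 * L2 / K by rewrite !(mulr_gt0, divr_gt0, exprn_gt0) // invr_gt0 ?exprn_gt0.
apply: (le_trans (ler_wpM2r (ltW q0) N3_le)).
have -> : (2 * c * K) ^+ 3 * (4 / c ^+ 4 * L2 / K) = 32 / c * (L2 * K ^+ 2).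
  by move: K0; move: (K) => K' K'0; field; rewrite !gt_eqF.
have -> : h * L2 ^+ 2 * Theta = L2 * K ^+ 2 by rewrite K2; ring.
rewrite ler_pM2r ?mulr_gt0 ?exprn_gt0 // ler_pdivrMr //.
(* The inequality 32 / c <= 2 / 5 holds exactly when c is at least 80. *)
by move: c80; lra.
Qed.

Let N3V : N%:R ^+ 3 * V <= 8 * (h * L2 ^+ 2 * Theta * n%:R).
Proof.
have mp : 0 < m%:R :> R by rewrite ltr0n.
have h1 : c ^+ 3 * (sigma ^+ 2 * K) <= m%:R * (E ^+ 3 * n%:R * L2).
  rewrite -ler_pdivrMr; last by rewrite !mulr_gt0 // exprn_gt0.
  apply: le_trans mb; rewrite -[c ^+ 3 * _ * _]mulrA ler_pM2l ?exprn_gt0 //.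
  by rewrite batch_scaleE // le_max lexx orbT.
have -> : 8 * (h * L2 ^+ 2 * Theta * n%:R) = 8 * (K ^+ 2 * L2 * n%:R) by rewrite K2; ring.
have h2 : N%:R ^+ 3 * V * E ^+ 3 <= (2 * c * K) ^+ 3 * V.
  have -> : N%:R ^+ 3 * V * E ^+ 3 = (N%:R * E) ^+ 3 * V by ring.
  by apply: ler_wpM2r N3_le; rewrite divr_ge0 ?sqr_ge0.
rewrite -(ler_pM2r (exprn_gt0 3 E0)); apply: (le_trans h2).
have -> : (2 * c * K) ^+ 3 * V = 8 * K ^+ 2 * (c ^+ 3 * (sigma ^+ 2 * K)) / m%:R.
  by rewrite /V; move: (K) => K'; field; rewrite gt_eqF.
rewrite ler_pdivrMr //.
have -> : 8 * (K ^+ 2 * L2 * n%:R) * E ^+ 3 * m%:R = 8 * K ^+ 2 * (m%:R * (E ^+ 3 * n%:R * L2)).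
  by ring.
by rewrite ler_pM2l // mulr_gt0 // exprn_gt0.
Qed.

Let N2eps : N%:R ^+ 2 * eps <= 4 * c ^+ 2 * (h * L2 * Theta).
Proof.
have -> : N%:R ^+ 2 * eps = (N%:R * E) ^+ 2 by rewrite exprMn E2.
have -> : 4 * c ^+ 2 * (h * L2 * Theta) = (2 * c * K) ^+ 2 by rewrite -K2; ring.
by rewrite lerXn2r // nnegrE ltW // !mulr_gt0.
Qed.

Lemma mean_potential k : (k <= N)%N ->
  mean_le Pr (fun w => potential f L2 p xstar k (iterate k w)) (Theta * (1 + k%:R / N%:R)).
Proof.
elim: k => [_|k ih kN].
  rewrite mulr0n mul0r addr0 mulr1.
  apply: (mean_le_eq _ (mean_le_trans gap0 (mean_eq_le (mean_eq_cst Pr _)))) => w.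
  by rewrite /potential mulr0n !mul0r add0r.
have mu0 : 0 < c ^+ 2 * Theta / eps by rewrite !(divr_gt0, mulr_gt0) // exprn_gt0.
apply: mean_le_trans (recursion_step n8 p12 sp bn t0 m0 fmin alg kN mu0 (ih (ltnW kN))).
rewrite -[k.+1%:R]natr1.
apply: (@potential_increment R c (n%:R ^+ 2 * rho p n) h L2 Theta eps) => //.
- exact: dim_cost_le.
- by rewrite ler1n.
- by rewrite natr1 ler_nat.
- by rewrite divr_ge0 ?sqr_ge0.
- apply: addr_ge0; last by rewrite divr_ge0 ?sqr_ge0 // mulr_ge0 ?sqr_ge0.
  by rewrite divr_ge0 // mulr_ge0 ?sqr_ge0.
- by rewrite /scale_Q !mulrA.
- by rewrite /alpha -[k.+2]addn2 natrD.
Qed.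

Lemma mean_gap : mean_le Pr (fun w => f (iterate N w).1 - f xstar) eps.
Proof.
have Q0 : 0 < @scale_Q R n L2 p by exact: (scale_Q_gt0 n8 p12 sp).
have M := mean_potential (leqnn N).
pose a : R := 2 * @scale_Q R n L2 p / (N%:R * (N%:R + 2)).
have N2p : 0 < N%:R + 2 :> R by rewrite ltr_wpDl.
have a0 : 0 < a by apply: divr_gt0; exact: mulr_gt0.
have mi : measurable_fun setT (fun w => f (iterate N w).1 - f xstar).
  have [m1 _] := @measurable_dual_iter R n dX X F eta p m L2 t dO Omega e xi ys0 N
    (measurable_obj sp) (measurable_noise bn)
    (fun j jk => measurable_direction alg jk) (fun j i jk im => measurable_sample alg jk im).
  apply: measurable_funB; last exact: measurable_cst.
  exact: measurableT_comp (measurable_objective sp) m1.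
have ge0 w : 0 <= f (iterate N w).1 - f xstar by rewrite subr_ge0.
have M' := mean_leZ (ltW a0) M.
apply: (ae_mean_le mi ge0 _ (mean_le_trans _ M')).
  apply: aeW => w; rewrite /potential mulrDr mulrA.
  rewrite (_ : a * _ = 1); last by rewrite /a; field; rewrite !gt_eqF.
  by rewrite mul1r lerDl mulr_ge0 ?(ltW a0) // fenchel_gap_ge0.
rewrite divff ?gt_eqF //.
have hQ : @scale_Q R n L2 p * Theta <= 1536 * K ^+ 2.
  rewrite K2 /scale_Q.
  have -> : 96 * n%:R ^+ 2 * rho p n * L2 * Theta = 96 * (n%:R ^+ 2 * rho p n) * (L2 * Theta).
    by ring.
  have -> : 1536 * (h * L2 * Theta) = 96 * (16 * h) * (L2 * Theta) by ring.
  by rewrite ler_pM2r ?mulr_gt0 // ler_pM2l // le_dim_cost.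
have hN : (c * K) ^+ 2 <= N%:R ^+ 2 * eps.
  by rewrite -E2 -exprMn lerXn2r // nnegrE ltW // !mulr_gt0.
(* 6144 = 4 * 1536: the potential is at most twice Theta, the weight contributes another factor 2,
   and 1536 = 96 * 16 comes from Q through [le_dim_cost]. *)
have cc : 6144 <= c ^+ 2 by move: c80; nra.
rewrite /a mulrAC ler_pdivrMr ?mulr_gt0 //.
have K20 : 0 < K ^+ 2 by rewrite exprn_gt0.
have cK := ler_wpM2r (ltW K20) cc.
have NN : 0 <= eps * N%:R by rewrite mulr_ge0 ?(ltW eps0).
move: hQ hN cK NN; rewrite exprMn.
have -> : 2 * @scale_Q R n L2 p * (Theta * (1 + 1)) = 4 * (@scale_Q R n L2 p * Theta) by ring.
have -> : eps * (N%:R * (N%:R + 2)) = N%:R ^+ 2 * eps + 2 * (eps * N%:R) by ring.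
move: (@scale_Q R n L2 p * Theta) (K ^+ 2) (c ^+ 2 * K ^+ 2) (N%:R ^+ 2 * eps) (eps * N%:R).
by move=> *; lra.
Qed.
End gap.

Theorem corollary2p3 (R : realType) :
  exists cN cm cDelta ct C : R,
    [/\ 0 < cN, 0 < cm, 0 < cDelta, 0 < ct & 0 < C] /\
    forall (n p : nat) (dX : measure_display) (X : measurableType dX)
      (P : probability X R)
      (F : 'rV[R]_n -> X -> R) (g : 'rV[R]_n -> X -> 'rV[R]_n) (L : X -> R)
      (f : 'rV[R]_n -> R) (eta : 'rV[R]_n -> X -> R)
      (L2 sigma Delta Theta eps t : R) (x0 xstar : 'rV[R]_n) (N m : nat)
      (dO : measure_display) (Omega : measurableType dO) (Pr : probability Omega R)
      (e : nat -> Omega -> 'rV[R]_n) (xi : nat -> nat -> Omega -> X),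
    (8 <= n)%N ->
    p = 1%N \/ p = 2%N ->
    stochastic_problem P F g L f L2 sigma ->
    bounded_noise P eta Delta ->
    minimizer f xstar ->
    bregman p x0 xstar <= Theta ->
    0 < eps ->
    0 < Delta <= L2 * Theta * n%:R ^+ 3 * rho p n ^+ 2 / 2 ->
    Delta = cDelta * noise_scale p n L2 Theta eps ->
    t = ct * smoothing_scale p n L2 Theta eps ->
    (0 < N)%N ->
    (0 < m)%N ->
    cN * iter_scale p n L2 Theta eps <= N%:R
      <= 2 * cN * iter_scale p n L2 Theta eps ->
    cm * batch_scale p n L2 sigma Theta eps <= m%:R
      <= 2 * cm * batch_scale p n L2 sigma Theta eps ->
    algorithm_randomness P Pr N m e xi ->
    let output w :=
      ardfds F eta p m L2 t x0 (fun k => e k w) (fun k i => xi k i w) N in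
    [/\ ('E_Pr[fun w => f (st_y (output w))] - (f xstar)%:E <= eps%:E)%E,
        forall w, st_calls (output w) = (N * m)%N
      & (N * m)%:R <= C * call_scale p n L2 sigma Theta eps].
Proof.
have c80 : 80 <= 80 :> R by [].
have c0 : 0 < 80 :> R by rewrite ltr0n.
(* All constants are powers of c = 80, up to numerical factors: 80^2 = 6400 exceeds 6144, and 32 /
   80 = 2 / 5. The last one is the product of the upper factors 2 * 80 for N and 2 * 80^3 for m. *)
exists 80, (80 ^+ 3), (80 ^- 4), (2 / 80 ^+ 2), (4 * 80 * 80 ^+ 3); split.
  by split; rewrite ?invr_gt0 ?exprn_gt0.
move=> n p dX X P F g L f eta L2 sigma Delta Theta eps t x0 xstar N m dO Omega Pr e xi.
move=> n8 p12 sp bn fmin gap0 eps0 /andP[Delta0 Delta1] DeltaE tE N0 m0 Nb mb alg output.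
have L2p : 0 < L2 by case: sp.
have np : 0 < n%:R :> R by rewrite ltr0n (leq_trans _ n8).
(* The positive noise level is at most a positive multiple of [Theta]. *)
have Theta0 : 0 < Theta.
  have := lt_le_trans Delta0 Delta1.
  rewrite -!mulrA pmulr_rgt0 // pmulr_lgt0 //.
  by rewrite !mulr_gt0 ?exprn_gt0 ?invr_gt0 ?rho_gt0.
have /andP[mb1 mb2] := mb.
have /andP[Nb1 Nb2] := Nb.
have [s0 s0E] := mirror_surj p n8 x0.
have gap : fenchel_gap p xstar s0 <= Theta by rewrite -bregman_mirror // s0E.
have M := @mean_gap R n dX X P F g L f eta 80 L2 sigma Delta Theta eps t p N m xstar n8 p12 c80
  sp bn fmin Theta0 eps0 Delta0 DeltaE tE N0 m0 Nb mb1 dO Omega Pr e xi alg (x0, s0) gap.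
have outE w : output w = State _ _ _ := ardfds_dual F eta m L2 t (e ^~ w) (fun k i => xi k i w) N n8 s0E.
split.
- have [_ gapN] := mean_leD M (mean_eq_le (mean_eq_cst Pr (f xstar))).
  rewrite leeBlDr // -EFinD; apply: le_trans gapN.
  rewrite unlock le_eqVlt; apply/orP; left; apply/eqP.
  by apply: eq_integral => w _; rewrite outE /= subrK.
- by move=> w; rewrite outE.
- rewrite call_scaleE // natrM.
  have i0 : 0 <= iter_scale p n L2 Theta eps by rewrite iter_scaleE // divr_ge0 ?sqrtr_ge0.
  apply: (le_trans (ler_pM _ _ Nb2 mb2)) => //.
  by rewrite le_eqVlt; apply/orP; left; apply/eqP; ring.
Qed.
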